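(* Let $b\in\mathbb{R}\setminus\{0\}$. On the cylinder $\mathbb{C}/2\pi\mathbb{Z}$, consider the configuration of $4$ vortices with vorticities $\Gamma,\ \Gamma',\ -\Gamma',\ -\Gamma$ ($\Gamma$ and $\Gamma'$ being nonzero reals of the same sign) at, respectively, $$ib+\frac{2\Gamma'}{\Gamma+\Gamma'}\zeta,\qquad ib-\frac{2\Gamma}{\Gamma+\Gamma'}\zeta,\qquad -ib-\frac{2\Gamma}{\Gamma+\Gamma'}\overline{\zeta},\qquad -ib+\frac{2\Gamma'}{\Gamma+\Gamma'}\overline{\zeta},$$ where $\zeta\in\mathbb{C}$ has initial value $\zeta(0)$. Let $H(\zeta)$ denote the value of the Hamiltonian at this configuration. (1) Let $\Gamma/\Gamma'\neq1$. Then for a generic choice of the initial condition $\zeta(0)$ these vortices form a relative periodic orbit, and for isolated choices of $\zeta(0)$ they form a relative equilibrium or a separatrix connecting relative equilibria. (2) If $\Gamma/\Gamma'=1$, the same conclusion holds for $\zeta(0)$ such that $$|\operatorname{Im}\zeta(0)|<|b|\qquad\text{or}\qquad \frac{\pi H(\zeta(0))}{\Gamma^2}<\log\sinh|b|.$$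
   Context: The radius of the cylinder is normalized to $1$, so the cylinder is $\mathbb{C}/2\pi\mathbb{Z}$. The phase space for $N$ vortices is the product of $N$ copies of the cylinder with the diagonals removed (no collisions). The Hamiltonian for point vortices $z_1,\ldots,z_N$ with vorticities $\Gamma_1,\ldots,\Gamma_N\in\mathbb{R}$ is $$H(z_1,\ldots,z_N)=-\frac{1}{2\pi}\sum_{k<l}\Gamma_k\Gamma_l\log\left|\sin\frac{z_k-z_l}{2}\right|,$$ and the motion is governed by $$\frac{dz_k}{dt}=\frac{i}{4\pi}\sum_{l\neq k}\Gamma_l\,\cot\frac{\overline{z_k}-\overline{z_l}}{2},\qquad k=1,\ldots,N.$$ The group $\mathbb{C}/2\pi\mathbb{Z}$ acts diagonally on the phase space by translations. A relative equilibrium is a motion that lies entirely in a single group orbit (it looks stationary up to translation). A relative periodic orbit is a motion that revisits the same group orbit after some time (it looks periodic in time up to translation). A separatrix connecting relative equilibria is a relative heteroclinic orbit: a motion that, modulo translations, is asymptotic to relative equilibria as $t\to\pm\infty$.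
   Formalization: Separatrices fill whole curves of ζ(0), so ''isolated choices of ζ(0)'' is read as: relative equilibria are isolated points ζ(0), and the values H(ζ(0)) at relative equilibria or separatrices are isolated; collision initial conditions are excluded. *)

(* Defs.v *)
(* Stdlib world: concrete reals [R], with Coquelicot's complex numbers [C]. *)
From Stdlib Require Import Reals List.
From Coquelicot Require Import Coquelicot.

Open Scope R_scope.
Open Scope C_scope.

Definition Cexp (z : C) : C :=
  (exp (Re z) * cos (Im z), exp (Re z) * sin (Im z))%R.
Definition Csin (z : C) : C :=
  (Cexp (Ci * z) - Cexp (- (Ci * z))) / (2 * Ci).
Definition Ccos (z : C) : C :=
  (Cexp (Ci * z) + Cexp (- (Ci * z))) / 2.
Definition Ccot (z : C) : C := Ccos z / Csin z.

(** Points of the cylinder C/2piZ are represented by complex numbers, and a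
    configuration of [N] vortices by [z : nat -> C], of which only the values
    at indices [k < N] matter.  Motions are given by lifts to C; since the
    right-hand side of the equations of motion is 2pi-periodic in each
    position, these are exactly the lifts of motions on the cylinder. *)

Definition cyl_eq (z w : C) : Prop :=
  exists n : Z, z - w = RtoC (2 * PI * IZR n).

Definition no_collision (N : nat) (z : nat -> C) : Prop :=
  forall k l, (k < N)%nat -> (l < N)%nat -> k <> l -> ~ cyl_eq (z k) (z l).

(** Sum over the pairs [k < l < N]. *)
Definition hamiltonian (N : nat) (G : nat -> R) (z : nat -> C) : R :=
  (- / (2 * PI) *
   fold_right Rplus 0
     (flat_map (fun k =>
        map (fun l => G k * G l * ln (Cmod (Csin ((z k - z l) / 2))))
            (seq (S k) (N - S k)))
        (seq 0 N)))%R.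

Definition others (N k : nat) : list nat :=
  filter (fun l => negb (Nat.eqb l k)) (seq 0 N).

Definition velocity (N : nat) (G : nat -> R) (z : nat -> C) (k : nat) : C :=
  Ci / RtoC (4 * PI) *
  fold_right Cplus (RtoC 0)
    (map (fun l => RtoC (G l) * Ccot ((Cconj (z k) - Cconj (z l)) / 2))
         (others N k)).

Definition motion (N : nat) (G : nat -> R) (z : R -> nat -> C) : Prop :=
  forall t : R,
    no_collision N (z t) /\
    forall k, (k < N)%nat ->
      is_derive (V := C_R_NormedModule)
        (fun s => z s k) t (velocity N G (z t) k).

Definition same_orbit (N : nat) (z w : nat -> C) : Prop :=
  exists c : C, forall k, (k < N)%nat -> cyl_eq (w k) (z k + c).

Definition relative_equilibrium (N : nat) (G : nat -> R) (z : R -> nat -> C)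
  : Prop :=
  motion N G z /\ forall t, same_orbit N (z 0%R) (z t).

Definition relative_periodic_orbit (N : nat) (G : nat -> R)
    (z : R -> nat -> C) : Prop :=
  motion N G z /\
  exists T : R, (0 < T)%R /\ forall t, same_orbit N (z t) (z (t + T)%R).

(** Convergence, in the quotient of the phase space by translations, of the
    orbit of [z t] to the orbit of [e]: suitable representatives [w t] of the
    orbit of [z t] converge to [e]. *)
Definition orbit_converges (N : nat) (F : (R -> Prop) -> Prop)
    (z : R -> nat -> C) (e : nat -> C) : Prop :=
  exists w : R -> nat -> C,
    (forall t, same_orbit N (z t) (w t)) /\
    forall k, (k < N)%nat -> filterlim (fun t => w t k) F (locally (e k)).

(** A relative equilibrium [e] stays in the orbit of [e 0], so being asymptotic
    to it modulo translations is convergence to the orbit of [e 0]. *)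
Definition relative_heteroclinic_orbit (N : nat) (G : nat -> R)
    (z : R -> nat -> C) : Prop :=
  motion N G z /\
  exists em ep : R -> nat -> C,
    relative_equilibrium N G em /\ relative_equilibrium N G ep /\
    orbit_converges N (Rbar_locally m_infty) z (em 0%R) /\
    orbit_converges N (Rbar_locally p_infty) z (ep 0%R).

Definition vort4 (G G' : R) (k : nat) : R :=
  match k with 0 => G | 1 => G' | 2 => - G' | _ => - G end%R.

Definition conf4 (b G G' : R) (zeta : C) (k : nat) : C :=
  let p := RtoC (2 * G' / (G + G')) in
  let q := RtoC (2 * G / (G + G')) in
  match k with
  | 0 => Ci * RtoC b + p * zeta
  | 1 => Ci * RtoC b - q * zeta
  | 2 => - (Ci * RtoC b) - q * Cconj zeta
  | _ => - (Ci * RtoC b) + p * Cconj zeta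
  end.

Definition ham4 (b G G' : R) (zeta : C) : R :=
  hamiltonian 4 (vort4 G G') (conf4 b G G' zeta).

Definition admissible (b G G' : R) (zeta : C) : Prop :=
  no_collision 4 (conf4 b G G' zeta).

(** The vortices released at [conf4 b G G' zeta0] have a motion defined for all
    time; up to a time-dependent translation it consists of configurations
    [conf4 b G G' (zeta t)] with [zeta 0 = zeta0], and it satisfies [P]. *)
Definition vortices_form (b G G' : R) (P : (R -> nat -> C) -> Prop)
    (zeta0 : C) : Prop :=
  let starts z := forall k, (k < 4)%nat -> z 0%R k = conf4 b G G' zeta0 k in
  (exists z, motion 4 (vort4 G G') z /\ starts z) /\
  forall z, motion 4 (vort4 G G') z -> starts z ->
    (exists zeta : R -> C, zeta 0%R = zeta0 /\
       forall t, exists c : C, forall k, (k < 4)%nat ->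
         z t k = conf4 b G G' (zeta t) k + c) /\
    P z.

Definition forms_rel_periodic (b G G' : R) : C -> Prop :=
  vortices_form b G G' (relative_periodic_orbit 4 (vort4 G G')).

Definition forms_rel_equilibrium (b G G' : R) : C -> Prop :=
  vortices_form b G G' (relative_equilibrium 4 (vort4 G G')).

Definition forms_separatrix (b G G' : R) : C -> Prop :=
  vortices_form b G G' (relative_heteroclinic_orbit 4 (vort4 G G')).

(** [P] holds on an open dense subset of [D]. *)
Definition generically (D P : C -> Prop) : Prop :=
  exists U : C -> Prop,
    open U /\
    (forall x, U x -> D x /\ P x) /\
    (forall x, D x -> forall V, locally x V -> exists y, V y /\ U y).

Definition all_points_isolated {T : UniformSpace} (A : T -> Prop) : Prop :=
  forall x, A x -> locally x (fun y => A y -> y = x).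

(** For initial conditions in [D], generic ones give relative periodic orbits,
    and the exceptional ones are isolated.  A separatrix is a curve in the
    zeta-plane, each point of which is an exceptional initial condition, so that
    exceptional choices are isolated in the sense that they occur at isolated
    values of the Hamiltonian; the relative equilibria are in addition isolated
    as points. *)
Definition periodic_except_isolated (b G G' : R) (D : C -> Prop) : Prop :=
  let exceptional zeta :=
    D zeta /\
    (forms_rel_equilibrium b G G' zeta \/ forms_separatrix b G G' zeta) in
  generically D (forms_rel_periodic b G G') /\
  (forall zeta, D zeta -> forms_rel_periodic b G G' zeta \/ exceptional zeta) /\
  (exists zeta, exceptional zeta) /\
  all_points_isolated
    (fun zeta : C => D zeta /\ forms_rel_equilibrium b G G' zeta) /\
  all_points_isolated
    (fun h : R => exists zeta, exceptional zeta /\ h = ham4 b G G' zeta).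

(* Main.v *)
Require Import Defs.
From Stdlib Require Import Reals Lra Lia List Classical FinFun.
From Coquelicot Require Import Coquelicot.
Open Scope R_scope.

(** Write [zeta = x + i y], [S = G + G'], [m = (G' - G) / S] and [a = b + m * y].
    The configuration is symmetric under the reflection in the real axis, which
    exchanges vortices of opposite vorticity. Together with the conservation of
    [G * Im z_0 + G' * Im z_1] this makes the velocity of the four vortices tangent
    to the family of configurations [conf4 b G G' zeta], up to a real translational
    velocity ([velocity_placed]). So every solution [(x, y)] of a planar system lifts
    to a motion by a quadrature ([lift_exists]), and every motion released at a
    configuration of the family is such a lift, because motions are unique
    ([motion_unique], [lift_unique]).

    The planar system conserves [energy], a constant multiple of the Hamiltonian.
    Along a solution the height [y] stays bounded ([confined_asymmetric],
    [confined_symmetric]): for [m <> 0] the energy tends to minus infinity as [y]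
    does to plus or minus infinity, and for [m = 0] this is where the condition on
    the initial value enters. Bounded height and constant energy keep the vortices
    away from collisions ([gaps_bounded_below]). Hence solutions are global ([global_solution]).

    The classification rests on reversibility. The system depends on [x] only
    through [sin x ^ 2], up to the factor [sin x * cos x] in the velocity of [y], so
    that reversing time and reflecting [x] in a multiple of [PI / 2] is a symmetry.
    A solution that meets the axes [sin x * cos x = 0] at two different times is
    therefore invariant under two such reflections, whose composition shifts time by
    a positive amount and [x] by a multiple of [PI]
    ([periodic_of_two_symmetric_times]); and [zeta + n * PI] describes the same
    vortices as [zeta], up to translation. A solution that meets the axes at most
    once has [y] monotone for large times in both directions, so it converges
    to an equilibrium at both ends ([limit_equilibrium]): it is a separatrix, and its
    energy is the energy of an equilibrium.

    Equilibria lie on the axes and satisfy there an equation in [y] with finitely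
    many solutions ([finite_axis0], [finite_axis1]); so there are only finitely many
    critical energies. All initial values with another energy give relative
    periodic orbits, and they are dense because at a fixed height the energy is an
    injective function of [sin x ^ 2] ([sin_sq_of_energy]). Finally, an exceptional
    motion that is also periodic modulo translations must rest, since a periodic
    height that converges is constant; this excludes exceptional initial values of
    other energies. *)

(** * Real analysis *)

Lemma continuous_R_eps (f : R -> R) (t : R) :
  continuous f t <->
  forall e, 0 < e -> exists d, 0 < d /\
    forall s, Rabs (s - t) < d -> Rabs (f s - f t) < e.
Proof.
  split.
  - intros Hf e He.
    destruct (proj1 (filterlim_locally (F := locally t) f (f t)) Hf
                (mkposreal e He)) as [d Hd].
    exists d; split; [apply cond_pos|]. intros s Hs. apply (Hd s Hs).
  - intros H. apply filterlim_locally. intros [e He].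
    destruct (H e He) as [d [Hd Hs]]. exists (mkposreal d Hd).
    intros s Hst. apply (Hs s Hst).
Qed.

Lemma locally_R_ball (P : R -> Prop) (t : R) :
  locally t P <-> exists d, 0 < d /\ forall s, Rabs (s - t) < d -> P s.
Proof.
  split.
  - intros [d Hd]. exists d; split; [apply cond_pos|]. intros s Hs. apply (Hd s Hs).
  - intros [d [Hd H]]. exists (mkposreal d Hd). intros s Hs. apply (H s Hs).
Qed.

Lemma continuous_of_derive (f : R -> R) (t l : R) :
  is_derive f t l -> continuous f t.
Proof. intros H. apply (ex_derive_continuous f). exists l; exact H. Qed.

(** [auto_derive] leaves the derivatives of unknown functions in the goal; this
    tactic replaces them by their values. *)
Ltac known_derivatives :=
  repeat match goal with
  | H : is_derive ?f _ ?l |- context [Derive ?g ?t] =>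
    replace (Derive g t) with l by (symmetry; apply is_derive_unique; exact H)
  end.

(** Connectedness of the line, which propagates a property along a solution in both
    directions of time. *)
Lemma clopen_R (A : R -> Prop) :
  (forall t, A t -> locally t A) ->
  (forall t, (forall d, 0 < d -> exists s, Rabs (s - t) < d /\ A s) -> A t) ->
  A 0 -> forall t, A t.
Proof.
  assert (half : forall B : R -> Prop,
    (forall t, B t -> locally t B) ->
    (forall t, (forall d, 0 < d -> exists s, Rabs (s - t) < d /\ B s) -> B t) ->
    B 0 -> forall t, 0 <= t -> B t).
  { intros B Bo Bc B0 T HT. apply NNPP. intros HBT.
    set (E := fun s => 0 <= s <= T /\ forall r, 0 <= r <= s -> B r).
    assert (E0 : E 0).
    { split; [lra|]. intros r Hr. replace r with 0 by lra. exact B0. }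
    destruct (completeness E) as [m [Hub Hlub]].
    { exists T. intros s [Hs _]. lra. }
    { exists 0. exact E0. }
    assert (m0 : 0 <= m) by (apply Hub, E0).
    assert (mT : m <= T) by (apply Hlub; intros s [Hs _]; lra).
    assert (below : forall r, 0 <= r < m -> B r).
    { intros r Hr. apply NNPP. intros HBr.
      assert (m <= r); [|lra]. apply Hlub. intros s [Hs HsB].
      destruct (Rle_or_lt s r) as [?|Hrs]; [assumption|].
      exfalso. apply HBr, HsB. lra. }
    assert (Bm : B m).
    { destruct (Req_dec m 0) as [->|Hm]; [exact B0|]. apply Bc. intros d Hd.
      exists (Rmax 0 (m - d / 2)).
      assert (H1 := Rmax_l 0 (m - d/2)). assert (H2 := Rmax_r 0 (m - d/2)).
      assert (H3 : Rmax 0 (m - d/2) < m) by (apply Rmax_lub_lt; lra).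
      split; [|apply below; lra].
      rewrite Rabs_left1 by lra. lra. }
    destruct (Req_dec m T) as [->|HmT]; [contradiction|].
    destruct (proj1 (locally_R_ball _ _) (Bo m Bm)) as [d [Hd HB]].
    set (s := Rmin T (m + d / 2)).
    assert (H1 := Rmin_l T (m + d/2)). assert (H2 := Rmin_r T (m + d/2)).
    assert (H3 : m < s) by (apply Rmin_glb_lt; lra). fold s in H1, H2.
    assert (E s).
    { split; [lra|]. intros r Hr. destruct (Rlt_or_le r m); [apply below; lra|].
      apply HB. rewrite Rabs_right by lra. lra. }
    assert (s <= m) by (apply Hub; assumption). lra. }
  intros Ao Ac A0 t. destruct (Rle_or_lt 0 t) as [Ht|Ht].
  { exact (half A Ao Ac A0 t Ht). }
  rewrite <- (Ropp_involutive t).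
  apply (half (fun s => A (- s))); [| | |lra].
  - intros s Hs. destruct (proj1 (locally_R_ball _ _) (Ao _ Hs)) as [d [Hd H]].
    apply locally_R_ball. exists d; split; [assumption|]. intros r Hr. apply H.
    replace (- r - - s) with (- (r - s)) by ring. now rewrite Rabs_Ropp.
  - intros s Hs. apply Ac. intros d Hd. destruct (Hs d Hd) as [r [Hr HA]].
    exists (- r). split; [|assumption].
    replace (- r - - s) with (- (r - s)) by ring. now rewrite Rabs_Ropp.
  - now rewrite Ropp_0.
Qed.

Lemma mvt (f f' : R -> R) (a b : R) :
  a < b -> (forall t, a <= t <= b -> is_derive f t (f' t)) ->
  exists c, a <= c <= b /\ f b - f a = f' c * (b - a).
Proof.
  intros Hab Hf.
  destruct (MVT_gen f a b f') as [c [Hc Heq]];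
    rewrite ?Rmin_left, ?Rmax_right in * by lra.
  - intros t Ht. apply Hf. lra.
  - intros t Ht. apply continuity_pt_filterlim.
    apply (continuous_of_derive f t (f' t)), Hf. lra.
  - exists c. split; assumption.
Qed.

Lemma constant_of_derive_0 (f : R -> R) (a b : R) :
  (forall t, Rmin a b <= t <= Rmax a b -> is_derive f t 0) -> f a = f b.
Proof.
  intros Hf. destruct (Rtotal_order a b) as [H|[->|H]]; [|reflexivity|].
  - rewrite Rmin_left, Rmax_right in Hf by lra.
    destruct (mvt f (fun _ => 0) a b H Hf) as [c [_ Hc]]. lra.
  - rewrite Rmin_right, Rmax_left in Hf by lra.
    destruct (mvt f (fun _ => 0) b a H Hf) as [c [_ Hc]]. lra.
Qed.

(** [E t * exp (- L * Rabs t)] does not increase with [Rabs t]. *)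
Lemma gronwall_zero (E E' : R -> R) (T L : R) :
  (forall t, is_derive E t (E' t)) -> (forall t, 0 <= E t) -> E 0 = 0 ->
  (forall t, Rabs t <= T -> Rabs (E' t) <= L * E t) ->
  forall t, Rabs t <= T -> E t = 0.
Proof.
  intros HE Epos E0 HL t Ht.
  assert (key : forall K s, is_derive (fun r => E r * exp (K * r)) s
            ((E' s + K * E s) * exp (K * s))).
  { intros K s. assert (H := HE s). auto_derive; [now exists (E' s)|].
    known_derivatives. ring. }
  assert (Hexp : E t * exp (- (Rabs t * L)) <= 0).
  { apply Rabs_le_between in Ht as Ht'.
    destruct (Rtotal_order t 0) as [Hn|[->|Hp]].
    - destruct (mvt _ _ t 0 Hn (fun s _ => key L s)) as [c [Hc Heq]].
      rewrite E0, Rmult_0_l in Heq.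
      assert (Hc' : Rabs c <= T) by (apply Rabs_le; lra).
      assert (H1 := HL c Hc'). apply Rabs_le_between in H1.
      rewrite (Rabs_left t) by lra.
      replace (- (- t * L)) with (L * t) by ring.
      assert (0 <= (E' c + L * E c) * exp (L * c) * (0 - t)); [|lra].
      apply Rmult_le_pos; [|lra]. apply Rmult_le_pos; [lra|].
      left; apply exp_pos.
    - rewrite E0. lra.
    - destruct (mvt _ _ 0 t Hp (fun s _ => key (- L) s)) as [c [Hc Heq]].
      rewrite E0, Rmult_0_l in Heq.
      assert (Hc' : Rabs c <= T) by (apply Rabs_le; lra).
      assert (H1 := HL c Hc'). apply Rabs_le_between in H1.
      rewrite (Rabs_right t) by lra.
      replace (- (t * L)) with (- L * t) by ring.
      assert (0 <= - ((E' c + - L * E c) * exp (- L * c) * (t - 0))); [|lra].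
      rewrite Ropp_mult_distr_l, Ropp_mult_distr_l.
      apply Rmult_le_pos; [|lra]. apply Rmult_le_pos; [lra|].
      left; apply exp_pos. }
  assert (H1 := exp_pos (- (Rabs t * L))). assert (H2 := Epos t). nra.
Qed.

(** * Finite sets of zeros *)

Definition finite_set {T : Type} (A : T -> Prop) : Prop :=
  exists l, forall x, A x -> In x l.

Lemma finite_set_subset {T : Type} (A B : T -> Prop) :
  finite_set B -> (forall x, A x -> B x) -> finite_set A.
Proof. intros [l Hl] H. exists l. auto. Qed.

Lemma finite_set_union {T : Type} (A B : T -> Prop) :
  finite_set A -> finite_set B -> finite_set (fun x => A x \/ B x).
Proof.
  intros [l Hl] [l' Hl']. exists (l ++ l'). intros x [H|H]; apply in_or_app; auto.
Qed.

Lemma finite_set_image {T U : Type} (f : T -> U) (A : T -> Prop) :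
  finite_set A -> finite_set (fun y => exists x, A x /\ y = f x).
Proof.
  intros [l Hl]. exists (map f l). intros y [x [H ->]]. apply in_map; auto.
Qed.

(** Between two zeros of [f] there is a zero of [f'], so the zeros of [f']
    cut [I] into finitely many pieces on each of which [f] is injective. *)
Lemma finite_zeros (f f' : R -> R) (I : R -> Prop) :
  (forall a b c, I a -> I b -> a <= c <= b -> I c) ->
  (forall x, I x -> is_derive f x (f' x)) ->
  finite_set (fun x => I x /\ f' x = 0) -> finite_set (fun x => I x /\ f x = 0).
Proof.
  intros HI Hf [l Hl]. revert I HI Hf Hl.
  induction l as [|c l IH]; intros I HI Hf Hl.
  - destruct (classic (exists x, I x /\ f x = 0)) as [[x [Ix fx]]|H].
    + exists (x :: nil). intros y [Iy fy]. left.
      destruct (Rtotal_order x y) as [Hxy|[?|Hxy]]; [exfalso|assumption|exfalso].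
      * destruct (mvt f f' x y Hxy) as [c [Hc Heq]].
        { intros t Ht. apply Hf, (HI x y); assumption. }
        apply (Hl c). split; [apply (HI x y); assumption|]. nra.
      * destruct (mvt f f' y x Hxy) as [c [Hc Heq]].
        { intros t Ht. apply Hf, (HI y x); assumption. }
        apply (Hl c). split; [apply (HI y x); assumption|]. nra.
    + exists nil. intros x Hx. exfalso. apply H. exists x. exact Hx.
  - destruct (IH (fun x => I x /\ x < c)) as [l1 H1].
    { intros x y z [Hx ?] [Hy ?] Hz. split; [apply (HI x y); assumption|lra]. }
    { intros x [Hx _]. auto. }
    { intros x [[Hx ?] H0]. destruct (Hl x (conj Hx H0)); [lra|assumption]. }
    destruct (IH (fun x => I x /\ c < x)) as [l2 H2].
    { intros x y z [Hx ?] [Hy ?] Hz. split; [apply (HI x y); assumption|lra]. }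
    { intros x [Hx _]. auto. }
    { intros x [[Hx ?] H0]. destruct (Hl x (conj Hx H0)); [lra|assumption]. }
    exists (c :: l1 ++ l2). intros x [Hx H0].
    destruct (Rtotal_order x c) as [H|[->|H]].
    + right. apply in_or_app. left. auto.
    + left; reflexivity.
    + right. apply in_or_app. right. auto.
Qed.

Lemma finite_set_isolated (A : R -> Prop) :
  finite_set A ->
  forall x, exists d, 0 < d /\ forall y, A y -> Rabs (y - x) < d -> y = x.
Proof.
  intros [l Hl] x. revert A Hl. induction l as [|c l IH]; intros A Hl.
  - exists 1. split; [lra|]. intros y Hy. destruct (Hl y Hy).
  - destruct (IH (fun y => In y l)) as [d [Hd H]]; [auto|].
    destruct (Req_dec c x) as [->|Hc].
    + exists d. split; [assumption|]. intros y Hy Hyx.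
      destruct (Hl y Hy) as [<-|?]; [reflexivity|auto].
    + exists (Rmin d (Rabs (c - x))).
      split; [apply Rmin_glb_lt; [assumption|apply Rabs_pos_lt; lra]|].
      intros y Hy Hyx. destruct (Hl y Hy) as [<-|?].
      * assert (H1 := Rmin_r d (Rabs (c - x))). lra.
      * apply H; [assumption|]. assert (H1 := Rmin_l d (Rabs (c - x))). lra.
Qed.

(** Pigeonhole: [g] takes more values at the points [e / (i + 2)] than [A] has
    elements. *)
Lemma injective_avoids_finite_set (g : R -> R) (A : R -> Prop) (e : R) :
  0 < e -> finite_set A ->
  (forall s s', 0 < s < e -> 0 < s' < e -> g s = g s' -> s = s') ->
  exists s, 0 < s < e /\ ~ A (g s).
Proof.
  intros He [l Hl] Hg. apply NNPP. intros Hno.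
  set (r := fun i : nat => e / (INR i + 2)).
  assert (Hr : forall i, 0 < r i < e).
  { intros i. unfold r. assert (H := pos_INR i). split.
    - apply Rdiv_lt_0_compat; lra.
    - apply (Rmult_lt_reg_r (INR i + 2)); [lra|]. field_simplify; [nra|lra]. }
  assert (Hin : incl (map (fun i => g (r i)) (seq 0 (S (length l)))) l).
  { intros y Hy. apply in_map_iff in Hy as [i [<- _]].
    apply Hl, NNPP. intros H. apply Hno. exists (r i). split; [apply Hr|exact H]. }
  assert (Hnd : NoDup (map (fun i => g (r i)) (seq 0 (S (length l))))).
  { apply Injective_map_NoDup; [|apply seq_NoDup].
    intros i j Hij. apply Hg in Hij; [|apply Hr|apply Hr].
    apply INR_eq. unfold r, Rdiv in Hij. apply Rmult_eq_reg_l in Hij; [|lra].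
     assert (H' := pos_INR j).
    apply Rinv_eq_reg in Hij. lra. }
  assert (H := NoDup_incl_length Hnd Hin).
  rewrite length_map, length_seq in H. lia.
Qed.

(** * Behaviour at infinity *)

Lemma filterlim_p_infty_eps (f : R -> R) (l : R) :
  filterlim f (Rbar_locally p_infty) (locally l) <->
  forall e, 0 < e -> exists M, forall t, M < t -> Rabs (f t - l) < e.
Proof.
  split.
  - intros Hf e He.
    destruct (proj1 (filterlim_locally (F := Rbar_locally p_infty) f l) Hf
                (mkposreal e He)) as [M HM].
    exists M. exact HM.
  - intros H. apply filterlim_locally. intros [e He].
    destruct (H e He) as [M HM]. exists M. exact HM.
Qed.

(** By the mean value theorem, a limit [L <> 0] of the derivative would change [f]
    by about [L] in every unit of time. *)
Lemma derive_limit_0 (f f' : R -> R) (l L : R) :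
  (forall t, is_derive f t (f' t)) ->
  filterlim f (Rbar_locally p_infty) (locally l) ->
  filterlim f' (Rbar_locally p_infty) (locally L) -> L = 0.
Proof.
  intros Hf Hl HL. apply NNPP. intros H0.
  assert (HL0 : 0 < Rabs L) by (apply Rabs_pos_lt; assumption).
  destruct (proj1 (filterlim_p_infty_eps f l) Hl (Rabs L / 4)) as [M HM]; [lra|].
  destruct (proj1 (filterlim_p_infty_eps f' L) HL (Rabs L / 2)) as [M' HM'];
    [lra|].
  set (t := Rmax M M' + 1).
  assert (H1 := Rmax_l M M'). assert (H2 := Rmax_r M M').
  destruct (mvt f f' t (t + 1)) as [c [Hc Heq]]; [lra|intros s _; apply Hf|].
  assert (A1 := HM t ltac:(unfold t; lra)).
  assert (A2 := HM (t + 1) ltac:(unfold t; lra)).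
  assert (A3 := HM' c ltac:(unfold t in *; lra)).
  apply Rabs_lt_between in A1, A2, A3.
  assert (Hf' : Rabs (f' c) < Rabs L / 2) by (apply Rabs_def1; lra).
  assert (H3 := Rabs_triang (f' c) (- (f' c - L))).
  replace (f' c + - (f' c - L)) with L in H3 by ring.
  rewrite Rabs_Ropp in H3.
  assert (Rabs (f' c - L) < Rabs L / 2) by (apply Rabs_def1; lra). lra.
Qed.

Lemma increasing_bounded_limit (f : R -> R) (t0 M : R) :
  (forall s t, t0 < s -> s <= t -> f s <= f t) -> (forall t, t0 < t -> f t <= M) ->
  exists l, filterlim f (Rbar_locally p_infty) (locally l).
Proof.
  intros Hinc HM.
  set (E := fun v => exists t, t0 < t /\ v = f t).
  destruct (completeness E) as [l [Hub Hlub]].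
  { exists M. intros v [t [Ht ->]]. auto. }
  { exists (f (t0 + 1)), (t0 + 1). split; [lra|reflexivity]. }
  exists l. apply filterlim_p_infty_eps. intros e He.
  assert (exists t, t0 < t /\ l - e < f t) as [t [Ht Hlt]].
  { apply NNPP. intros H. assert (l <= l - e); [|lra]. apply Hlub.
    intros v [t [Ht ->]]. destruct (Rle_or_lt (f t) (l - e)); [assumption|].
    exfalso. apply H. exists t. split; assumption. }
  exists t. intros s Hs.
  assert (f t <= f s) by (apply Hinc; lra).
  assert (f s <= l) by (apply Hub; exists s; split; [lra|reflexivity]).
  apply Rabs_def1; lra.
Qed.

Lemma constant_sign (g : R -> R) (t0 : R) :
  (forall t, continuous g t) -> (forall t, t0 < t -> g t <> 0) ->
  (forall t, t0 < t -> 0 < g t) \/ (forall t, t0 < t -> g t < 0).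
Proof.
  intros Hc Hn.
  assert (Hsign : forall s t, t0 < s -> s < t -> 0 < g s * g t).
  { intros s t Hs Hst. apply NNPP. intros H.
    destruct (IVT_gen g s t 0) as [x [Hx Hx0]].
    - intros u. apply continuity_pt_filterlim, Hc.
    - unfold Rmin, Rmax. destruct (Rle_dec (g s) (g t)); split; nra.
    - rewrite Rmin_left, Rmax_right in Hx by lra. apply (Hn x); [lra|assumption]. }
  assert (H1 := Hn (t0 + 1) ltac:(lra)).
  destruct (Rtotal_order (g (t0 + 1)) 0) as [H|[H|H]]; [right|lra|left];
  intros t Ht; (destruct (Rtotal_order t (t0 + 1)) as [Hlt|[->|Hlt]];
    [assert (X := Hsign t (t0 + 1) Ht Hlt); nra|lra
    |assert (X := Hsign (t0 + 1) t ltac:(lra) Hlt); nra]).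
Qed.

Lemma monotone_bounded_limit (f f' : R -> R) (t0 M : R) :
  (forall t, is_derive f t (f' t)) -> (forall t, continuous f' t) ->
  (forall t, t0 < t -> f' t <> 0) -> (forall t, Rabs (f t) <= M) ->
  exists l, filterlim f (Rbar_locally p_infty) (locally l).
Proof.
  intros Hf Hc Hn HM.
  assert (HM' := fun t => proj1 (Rabs_le_between _ _) (HM t)).
  destruct (constant_sign f' t0 Hc Hn) as [Hs|Hs].
  - apply (increasing_bounded_limit f t0 M); [|intros; apply HM'].
    intros s t Hs' [Hst| ->]; [|lra].
    destruct (mvt f f' s t Hst) as [c [Hc' Heq]]; [auto|].
    assert (0 < f' c) by (apply Hs; lra). nra.
  - destruct (increasing_bounded_limit (fun t => - f t) t0 M) as [l Hl].
    + intros s t Hs' [Hst| ->]; [|lra].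
      destruct (mvt f f' s t Hst) as [c [Hc' Heq]]; [auto|].
      assert (f' c < 0) by (apply Hs; lra). nra.
    + intros t _. specialize (HM' t). lra.
    + exists (- l). apply filterlim_p_infty_eps. intros e He.
      destruct (proj1 (filterlim_p_infty_eps _ _) Hl e He) as [T HT]. exists T.
      intros t Ht. specialize (HT t Ht).
      replace (f t - - l) with (- (- f t - l)) by ring. now rewrite Rabs_Ropp.
Qed.

(** * Hyperbolic functions *)

Lemma cosh_sinh_sq (y : R) : cosh y ^ 2 = 1 + sinh y ^ 2.
Proof.
  unfold cosh, sinh. assert (H : exp y * exp (- y) = 1)
    by (rewrite <- exp_plus, Rplus_opp_r; apply exp_0). nra.
Qed.

Lemma sinh_plus (x y : R) : sinh (x + y) = sinh x * cosh y + cosh x * sinh y.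
Proof. unfold sinh, cosh. rewrite Ropp_plus_distr, !exp_plus. field. Qed.

Lemma cosh_plus (x y : R) : cosh (x + y) = cosh x * cosh y + sinh x * sinh y.
Proof. unfold sinh, cosh. rewrite Ropp_plus_distr, !exp_plus. field. Qed.

Lemma sinh_opp (x : R) : sinh (- x) = - sinh x.
Proof. unfold sinh. rewrite Ropp_involutive. field. Qed.

Lemma cosh_opp (x : R) : cosh (- x) = cosh x.
Proof. unfold cosh. rewrite Ropp_involutive. field. Qed.

Lemma sinh_minus (x y : R) : sinh (x - y) = sinh x * cosh y - cosh x * sinh y.
Proof. unfold Rminus. rewrite sinh_plus, sinh_opp, cosh_opp. ring. Qed.

Lemma cosh_minus (x y : R) : cosh (x - y) = cosh x * cosh y - sinh x * sinh y.
Proof. unfold Rminus. rewrite cosh_plus, sinh_opp, cosh_opp. ring. Qed.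

Lemma cosh_pos (y : R) : 0 < cosh y.
Proof.
  unfold cosh. assert (H1 := exp_pos y). assert (H2 := exp_pos (- y)). lra.
Qed.

Lemma sinh_pos (y : R) : 0 < y -> 0 < sinh y.
Proof. intros H. rewrite <- sinh_0. now apply sinh_lt. Qed.

Lemma sinh_neg (y : R) : y < 0 -> sinh y < 0.
Proof. intros H. rewrite <- sinh_0. now apply sinh_lt. Qed.

Lemma sinh_eq_0 (y : R) : sinh y = 0 -> y = 0.
Proof.
  intros H. destruct (Rtotal_order y 0) as [Hy|[Hy|Hy]]; [|assumption|].
  - apply sinh_neg in Hy. lra.
  - apply sinh_pos in Hy. lra.
Qed.

Lemma is_derive_sinh (y : R) : is_derive sinh y (cosh y).
Proof. apply is_derive_Reals, derivable_pt_lim_sinh. Qed.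

Lemma is_derive_cosh (y : R) : is_derive cosh y (sinh y).
Proof. apply is_derive_Reals, derivable_pt_lim_cosh. Qed.

Lemma sinh_ge (y : R) : 0 <= y -> y <= sinh y.
Proof.
  intros [H|<-]; [|rewrite sinh_0; lra].
  destruct (mvt sinh cosh 0 y H) as [c [Hc Heq]].
  { intros t _. apply is_derive_sinh. }
  assert (1 <= cosh c).
  { assert (X := cosh_sinh_sq c). assert (Y := cosh_pos c). nra. }
  rewrite sinh_0 in Heq. nra.
Qed.

Lemma sinh_sq_ge (y : R) : y ^ 2 <= sinh y ^ 2.
Proof.
  destruct (Rle_or_lt 0 y) as [H|H].
  - apply sinh_ge in H as H1. nra.
  - assert (H1 := sinh_ge (- y) ltac:(lra)). rewrite sinh_opp in H1. nra.
Qed.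

Lemma sinh_sq_even (y : R) : sinh (Rabs y) ^ 2 = sinh y ^ 2.
Proof.
  unfold Rabs. destruct (Rcase_abs y); [rewrite sinh_opp; ring|reflexivity].
Qed.

Lemma sinh_sq_mult (a y : R) :
  sinh (a + y) * sinh (a - y) = sinh a ^ 2 - sinh y ^ 2.
Proof.
  rewrite sinh_plus, sinh_minus.
  assert (H1 := cosh_sinh_sq a). assert (H2 := cosh_sinh_sq y).
  replace ((sinh a * cosh y + cosh a * sinh y) *
           (sinh a * cosh y - cosh a * sinh y))
    with (sinh a ^ 2 * cosh y ^ 2 - cosh a ^ 2 * sinh y ^ 2) by ring.
  rewrite H1, H2. ring.
Qed.

Lemma sinh_sq_lt (a y : R) : sinh y ^ 2 < sinh a ^ 2 -> Rabs y < Rabs a.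
Proof.
  rewrite <- (sinh_sq_even y), <- (sinh_sq_even a). intros H.
  destruct (Rlt_or_le (Rabs y) (Rabs a)) as [?|Hle]; [assumption|].
  assert (sinh (Rabs a) <= sinh (Rabs y)).
  { destruct Hle as [Hle| ->]; [left; now apply sinh_lt|lra]. }
  assert (0 <= Rabs a) by apply Rabs_pos.
  assert (Rabs a <= sinh (Rabs a)) by now apply sinh_ge. nra.
Qed.

(** * Bounded Lipschitz vector fields of the plane *)

(** A single constant serves as bound and as Lipschitz constant, so that the
    class is visibly closed under sums, products and inverses. *)
Definition bounded_lipschitz (f : R -> R -> R) : Prop :=
  exists M, forall x y x' y',
    Rabs (f x y) <= M /\
    Rabs (f x y - f x' y') <= M * (Rabs (x - x') + Rabs (y - y')).

Lemma bound_nonneg (f : R -> R -> R) (M : R) (P : R -> R -> R -> R -> Prop) :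
  (forall x y x' y', Rabs (f x y) <= M /\ P x y x' y') -> 0 <= M.
Proof.
  intros H. destruct (H 0 0 0 0) as [H0 _]. assert (X := Rabs_pos (f 0 0)). lra.
Qed.

Lemma bounded_lipschitz_filterlim {T : Type} (F : (T -> Prop) -> Prop)
    {FF : Filter F} (f : R -> R -> R) (x y : T -> R) (xl yl : R) :
  bounded_lipschitz f ->
  filterlim x F (locally xl) -> filterlim y F (locally yl) ->
  filterlim (fun s => f (x s) (y s)) F (locally (f xl yl)).
Proof.
  intros [M HM] Hx Hy.
  assert (M0 := bound_nonneg _ _ _ HM).
  apply filterlim_locally. intros [e He].
  assert (He' : 0 < e / (2 * (M + 1))) by (apply Rdiv_lt_0_compat; lra).
  assert (Hx' := proj1 (filterlim_locally x xl) Hx (mkposreal _ He')).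
  assert (Hy' := proj1 (filterlim_locally y yl) Hy (mkposreal _ He')).
  apply (filter_imp _ _) with (2 := filter_and _ _ Hx' Hy').
  intros s [Hdx Hdy]. change (Rabs (x s - xl) < e / (2 * (M + 1))) in Hdx.
  change (Rabs (y s - yl) < e / (2 * (M + 1))) in Hdy.
  change (Rabs (f (x s) (y s) - f xl yl) < e).
  destruct (HM (x s) (y s) xl yl) as [_ H].
  set (e' := e / (2 * (M + 1))) in *.
  apply (Rle_lt_trans _ _ _ H).
  apply (Rle_lt_trans _ (M * (e' + e'))); [apply Rmult_le_compat_l; lra|].
  unfold e'. apply (Rmult_lt_reg_r (M + 1)); [lra|]. field_simplify; [nra|lra].
Qed.

Lemma bounded_lipschitz_continuous (f : R -> R -> R) (x y : R -> R) (t : R) :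
  bounded_lipschitz f -> continuous x t -> continuous y t ->
  continuous (fun s => f (x s) (y s)) t.
Proof. apply bounded_lipschitz_filterlim, locally_filter. Qed.

Lemma is_derive_integral (g : R -> R) (t : R) :
  (forall s, continuous g s) -> is_derive (fun t => RInt g 0 t) t (g t).
Proof.
  intros Hg. apply (is_derive_RInt g (fun t => RInt g 0 t) 0 t); [|apply Hg].
  apply filter_forall. intros s. apply (RInt_correct (V := R_CompleteNormedModule)).
  apply (ex_RInt_continuous (V := R_CompleteNormedModule)). intros; apply Hg.
Qed.

Lemma is_derive_const_plus_integral (c : R) (g : R -> R) (t : R) :
  (forall s, continuous g s) -> is_derive (fun t => c + RInt g 0 t) t (g t).
Proof.
  intros Hg. replace (g t) with (0 + g t) by ring.
  apply (is_derive_plus (V := R_NormedModule) (fun _ => c)).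
  - apply (is_derive_const (V := R_NormedModule)).
  - now apply is_derive_integral.
Qed.

(** Integration gains a factor [/ lam] in the norm with weight [exp (- lam * Rabs t)]. *)
Lemma primitive_exp_bound (h g : R -> R) (K lam : R) :
  0 < lam -> 0 <= K -> h 0 = 0 -> (forall t, is_derive h t (g t)) ->
  (forall t, Rabs (g t) <= K * exp (lam * Rabs t)) ->
  forall t, Rabs (h t) <= K / lam * exp (lam * Rabs t).
Proof.
  intros Hlam HK h0 Hh Hg.
  assert (HKl : 0 <= K / lam) by (apply Rdiv_le_0_compat; lra).
  (* [e] is a sign of [h] and [d] a direction of time *)
  assert (half : forall e d t, Rabs e = 1 -> Rabs d = 1 -> 0 <= t ->
    e * h (d * t) <= K / lam * exp (lam * t)).
  { intros e d t He Hd [Ht|<-]; [|rewrite !Rmult_0_r, h0, exp_0; lra].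
    destruct (mvt (fun s => e * h (d * s) - K / lam * exp (lam * s))
      (fun s => e * d * g (d * s) - K * exp (lam * s)) 0 t Ht) as [c [Hc Heq]].
    - intros s _. assert (H := Hh (d * s)). auto_derive; [now exists (g (d * s))|].
      known_derivatives. field. lra.
    - specialize (Hg (d * c)). rewrite Rabs_mult, Hd, Rmult_1_l, (Rabs_right c) in Hg by lra.
      assert (Hle := Rle_abs (e * d * g (d * c))).
      rewrite !Rabs_mult, He, Hd, !Rmult_1_l in Hle.
      rewrite !Rmult_0_r, h0, exp_0, Rmult_0_r in Heq. nra. }
  assert (H1 : Rabs 1 = 1) by (apply Rabs_right; lra).
  assert (H2 : Rabs (- 1) = 1) by (rewrite Rabs_left; lra).
  intros t. apply Rabs_le. destruct (Rle_or_lt 0 t) as [Ht|Ht].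
  - rewrite (Rabs_right t) by lra. assert (A := half 1 1 t H1 H1 Ht).
    assert (B := half (- 1) 1 t H2 H1 Ht). rewrite !Rmult_1_l in *. lra.
  - rewrite (Rabs_left t) by lra. assert (A := half 1 (- 1) (- t) H1 H2 ltac:(lra)).
    assert (B := half (- 1) (- 1) (- t) H2 H2 ltac:(lra)).
    replace (- 1 * - t) with t in * by ring. lra.
Qed.

Lemma geometric_limit (u : nat -> R) (c : R) :
  (forall n, Rabs (u (S n) - u n) <= c * (/ 2) ^ n) ->
  forall n, Rabs (real (Lim_seq u) - u n) <= 2 * c * (/ 2) ^ n.
Proof.
  intros Hu.
  assert (c0 : 0 <= c).
  { specialize (Hu O). rewrite pow_O, Rmult_1_r in Hu.
    assert (H := Rabs_pos (u 1%nat - u O)). lra. }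
  assert (Hk : forall n k,
    Rabs (u (n + k)%nat - u n) <= 2 * c * ((/ 2) ^ n - (/ 2) ^ (n + k))).
  { intros n k. induction k as [|k IH].
    - rewrite Nat.add_0_r, !Rminus_diag, Rabs_R0. lra.
    - rewrite <- plus_n_Sm. specialize (Hu (n + k)%nat). simpl.
      replace (u (S (n + k)) - u n)
        with ((u (S (n + k)) - u (n + k)%nat) + (u (n + k)%nat - u n)) by ring.
      assert (H := Rabs_triang (u (S (n + k)) - u (n + k)%nat) (u (n + k)%nat - u n)).
      lra. }
  assert (Hpos : forall n, 0 < (/ 2) ^ n) by (intros n; apply pow_lt; lra).
  assert (Hsmall : forall e, 0 < e -> exists N, 2 * c * (/ 2) ^ N < e).
  { intros e He. destruct (pow_lt_1_zero (/ 2)) with (y := e / (2 * c + 1))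
      as [N HN]; [rewrite Rabs_right; lra|apply Rdiv_lt_0_compat; lra|].
    exists N. specialize (HN N (le_n N)). rewrite Rabs_right in HN by (specialize (Hpos N); lra).
    apply (Rmult_lt_compat_r (2 * c + 1)) in HN; [|lra].
    unfold Rdiv in HN. rewrite Rmult_assoc, Rinv_l, Rmult_1_r in HN by lra.
    specialize (Hpos N). nra. }
  assert (Hcauchy : ex_lim_seq_cauchy u).
  { intros [e He]; simpl. destruct (Hsmall (e / 2)) as [N HN]; [lra|]. exists N.
    assert (Hb : forall n, (N <= n)%nat -> Rabs (u n - u N) < e / 2).
    { intros n Hn. replace n with (N + (n - N))%nat by lia.
      assert (H := Hk N (n - N)%nat). assert (H' := Hpos (N + (n - N))%nat). nra. }
    intros n m Hn Hm. simpl. apply Hb in Hn, Hm.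
    replace (u n - u m) with ((u n - u N) - (u m - u N)) by ring.
    eapply Rle_lt_trans; [apply Rabs_triang|]. rewrite Rabs_Ropp. lra. }
  destruct (proj2 (ex_lim_seq_cauchy_corr u) Hcauchy) as [l Hl].
  rewrite (is_lim_seq_unique _ _ Hl). simpl. intros n.
  apply Rnot_lt_le. intros Hlt.
  apply is_lim_seq_spec in Hl.
  destruct (Hl (mkposreal _ (proj2 (Rlt_0_minus _ _) Hlt))) as [N HN]. simpl in HN.
  specialize (HN (n + N)%nat ltac:(lia)). specialize (Hk n N).
  assert (H := Rabs_triang (u (n + N)%nat - u n) (- (u (n + N)%nat - l))).
  rewrite Rabs_Ropp in H.
  replace (u (n + N)%nat - u n + - (u (n + N)%nat - l)) with (l - u n) in H by ring.
  specialize (Hpos (n + N)%nat). nra.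
Qed.

Lemma le_of_geometric_error (a b c : R) :
  (forall n, a <= b + c * (/ 2) ^ n) -> a <= b.
Proof.
  intros H. apply Rnot_lt_le. intros Hlt.
  destruct (pow_lt_1_zero (/ 2)) with (y := (a - b) / (Rabs c + 1)) as [N HN].
  - rewrite Rabs_right; lra.
  - assert (X := Rabs_pos c). apply Rdiv_lt_0_compat; lra.
  - specialize (HN N (le_n N)). specialize (H N).
    assert (Hp : 0 < (/ 2) ^ N) by (apply pow_lt; lra).
    rewrite Rabs_right in HN by lra. assert (X := Rabs_pos c).
    apply (Rmult_lt_compat_r (Rabs c + 1)) in HN; [|lra].
    unfold Rdiv in HN. rewrite Rmult_assoc, Rinv_l, Rmult_1_r in HN by lra.
    assert (Y := Rle_abs c). nra.
Qed.

(** The two components are indexed by booleans, so that they are treated alike. *)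
Fixpoint picard_iterate (F : bool -> R -> R -> R) (u0 : bool -> R)
    (n : nat) (i : bool) (t : R) : R :=
  match n with
  | O => u0 i
  | S n => u0 i + RInt (fun s => F i (picard_iterate F u0 n true s)
                                     (picard_iterate F u0 n false s)) 0 t
  end.

(** Picard iteration converges on the whole line because the differences of
    consecutive iterates are measured in the norm weighted by
    [exp (- 4 * M * Rabs t)], for which one step is a contraction by [/ 2]. *)
Lemma picard (F : bool -> R -> R -> R) (u0 : bool -> R) :
  (forall i, bounded_lipschitz (F i)) ->
  exists u : bool -> R -> R, forall i, u i 0 = u0 i /\
    forall t, is_derive (u i) t (F i (u true t) (u false t)).
Proof.
  intros HF.
  assert (exists M, 0 < M /\ forall i x y x' y', Rabs (F i x y) <= M /\
    Rabs (F i x y - F i x' y') <= M * (Rabs (x - x') + Rabs (y - y'))) as [M [HM Hf]].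
  { destruct (HF true) as [M1 H1], (HF false) as [M2 H2].
    assert (A1 := bound_nonneg _ _ _ H1). assert (A2 := bound_nonneg _ _ _ H2).
    exists (M1 + M2 + 1). split; [lra|].
    intros [] x y x' y'; [destruct (H1 x y x' y')|destruct (H2 x y x' y')];
    assert (A := Rabs_pos (x - x')); assert (B := Rabs_pos (y - y'));
    (split; [lra|nra]). }
  set (u := picard_iterate F u0).
  set (f := fun i (v : bool -> R -> R) s => F i (v true s) (v false s)).
  set (dist := fun (v w : bool -> R -> R) s =>
    Rabs (v true s - w true s) + Rabs (v false s - w false s)).
  set (lam := 4 * M). assert (Hlam : 0 < lam) by (unfold lam; lra).
  assert (Hdist : forall v w s i, Rabs (v i s - w i s) <= dist v w s).
  { intros v w s i. unfold dist. assert (A := Rabs_pos (v true s - w true s)).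
    assert (B := Rabs_pos (v false s - w false s)). destruct i; lra. }
  assert (Hcf : forall v, (forall i s, continuous (v i) s) ->
    forall i s, continuous (f i v) s).
  { intros v Hv i s. now apply bounded_lipschitz_continuous. }
  assert (Hint : forall v w K, (forall i s, continuous (v i) s) ->
    (forall i s, continuous (w i) s) -> 0 <= K ->
    (forall s, dist v w s <= K * exp (lam * Rabs s)) ->
    forall i t, Rabs (RInt (f i v) 0 t - RInt (f i w) 0 t) <= K / 4 * exp (lam * Rabs t)).
  { intros v w K Hv Hw HK Hd i.
    replace (K / 4) with (M * K / lam) by (unfold lam; field; lra).
    apply (primitive_exp_bound (fun t => RInt (f i v) 0 t - RInt (f i w) 0 t)
      (fun t => f i v t - f i w t)); [assumption|nra| | |].
    - rewrite !RInt_point. apply Rminus_diag.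
    - intros s. apply (is_derive_minus (V := R_NormedModule) (fun t => RInt (f i v) 0 t));
      apply is_derive_integral; now apply Hcf.
    - intros s. eapply Rle_trans; [apply Hf|].
      rewrite Rmult_assoc. apply Rmult_le_compat_l; [lra|apply Hd]. }
  assert (Hder : forall n i t, (forall i s, continuous (u n i) s) ->
    is_derive (u (S n) i) t (f i (u n) t)).
  { intros n i t Hn. apply (is_derive_const_plus_integral _ (f i (u n))). now apply Hcf. }
  assert (Hu : forall n i t, continuous (u n i) t).
  { induction n as [|n IH]; intros i t; [apply continuous_const|].
    exact (continuous_of_derive _ _ _ (Hder n i t IH)). }
  assert (Hcancel : forall a b c : R, a + b - (a + c) = b - c) by (intros; ring).
  assert (Hhalf : forall n, 0 < (/ 2) ^ n) by (intros n; apply pow_lt; lra).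
  assert (Hstep : forall n t, dist (u (S n)) (u n) t <= (/ 2) ^ n * exp (lam * Rabs t)).
  { induction n as [|n IH]; intros t; unfold dist.
    - assert (Hb : forall i, Rabs (u 1%nat i t - u O i t) <= M * Rabs t).
      { intros i. change (Rabs (u0 i + RInt (fun _ => F i (u0 true) (u0 false)) 0 t - u0 i)
          <= M * Rabs t).
        rewrite RInt_const. unfold scal; simpl; unfold mult; simpl.
        replace (u0 i + (t - 0) * F i (u0 true) (u0 false) - u0 i)
          with (F i (u0 true) (u0 false) * t) by ring.
        rewrite Rabs_mult. apply Rmult_le_compat_r; [apply Rabs_pos|].
        apply (Hf i _ _ 0 0). }
      assert (H1 := Hb true). assert (H2 := Hb false).
      assert (H3 := exp_ineq1_le (lam * Rabs t)). unfold lam in *.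
      assert (H4 := Rabs_pos t). simpl pow. nra.
    - assert (H := Hint (u (S n)) (u n) _ (Hu (S n)) (Hu n) (Rlt_le _ _ (Hhalf n)) IH).
      change (Rabs (u0 true + RInt (f true (u (S n))) 0 t - (u0 true + RInt (f true (u n)) 0 t))
        + Rabs (u0 false + RInt (f false (u (S n))) 0 t - (u0 false + RInt (f false (u n)) 0 t))
        <= (/ 2) ^ S n * exp (lam * Rabs t)).
      rewrite !Hcancel, <- tech_pow_Rmult.
      assert (H1 := H true t). assert (H2 := H false t). lra. }
  set (v := fun i t => real (Lim_seq (fun n => u n i t))).
  assert (Hlim : forall n i t, Rabs (v i t - u n i t) <= 2 * (/ 2) ^ n * exp (lam * Rabs t)).
  { intros n i t.
    assert (H : Rabs (v i t - u n i t) <= 2 * exp (lam * Rabs t) * (/ 2) ^ n); [|lra].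
    apply (geometric_limit (fun n => u n i t)). intros k.
    eapply Rle_trans; [apply Hdist|]. specialize (Hstep k t). lra. }
  (* all iterates are Lipschitz with the constant [M], and so is the limit *)
  assert (Hlip : forall n i s t, s < t -> Rabs (u (S n) i t - u (S n) i s) <= M * (t - s)).
  { intros n i s t Hst. destruct (mvt _ _ s t Hst (fun r _ => Hder n i r (Hu n))) as [c [_ ->]].
    rewrite Rabs_mult, (Rabs_right (t - s)) by lra.
    apply Rmult_le_compat_r; [lra|]. apply (Hf i _ _ 0 0). }
  assert (Hvlip : forall i s t, s < t -> Rabs (v i t - v i s) <= M * (t - s)).
  { intros i s t Hst. apply le_of_geometric_error
      with (2 * exp (lam * Rabs s) + 2 * exp (lam * Rabs t)). intros n.
    assert (H1 := Hlip n i s t Hst).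
    assert (H2 := Hlim (S n) i s). assert (H3 := Hlim (S n) i t).
    rewrite <- tech_pow_Rmult in H2, H3. assert (Hp := Hhalf n).

    apply Rabs_le_between in H1, H2, H3. apply Rabs_le. lra. }
  assert (Hv : forall i t, continuous (v i) t).
  { intros i t. apply continuous_R_eps. intros e He. exists (e / M).
    split; [apply Rdiv_lt_0_compat; lra|]. intros s Hs.
    apply (Rmult_lt_compat_l M) in Hs; [|lra].
    replace (M * (e / M)) with e in Hs by (field; lra).
    eapply Rle_lt_trans; [|exact Hs].
    destruct (Rtotal_order s t) as [Hst|[->|Hst]].
    - rewrite Rabs_minus_sym, (Rabs_minus_sym s), (Rabs_right (t - s)) by lra. auto.
    - rewrite !Rminus_diag, Rabs_R0. lra.
    - rewrite (Rabs_right (s - t)) by lra. auto. }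
  assert (Hfix : forall i t, v i t = u0 i + RInt (f i v) 0 t).
  { intros i t. apply Rminus_diag_uniq.
    enough (H : Rabs (v i t - (u0 i + RInt (f i v) 0 t)) <= 0).
    { apply NNPP. intros Hn. apply Rabs_pos_lt in Hn. lra. }
    apply le_of_geometric_error with (2 * exp (lam * Rabs t)). intros n.
    assert (H1 := Hint v (u n) (4 * (/ 2) ^ n) Hv (Hu n)
      ltac:(assert (Hp := Hhalf n); lra)
      ltac:(intros s; assert (A := Hlim n true s); assert (B := Hlim n false s);
            unfold dist; lra) i t).
    assert (H2 := Hlim (S n) i t). rewrite <- tech_pow_Rmult in H2.
    change (u (S n) i t) with (u0 i + RInt (f i (u n)) 0 t) in H2.
    set (A := RInt (f i v) 0 t) in *. set (B := RInt (f i (u n)) 0 t) in *.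
    apply Rabs_le_between in H1, H2. apply Rabs_le. lra. }
  exists v. intros i. split.
  - rewrite Hfix, RInt_point. apply Rplus_0_r.
  - intros t. apply (is_derive_ext (fun t => u0 i + RInt (f i v) 0 t)).
    + intros s. symmetry. apply Hfix.
    + apply (is_derive_const_plus_integral _ (f i v)). now apply Hcf.
Qed.

Lemma bounded_lipschitz_const (c : R) : bounded_lipschitz (fun _ _ => c).
Proof.
  exists (Rabs c). intros x y x' y'. rewrite Rminus_diag, Rabs_R0.
  split; [lra|]. repeat apply Rmult_le_pos || apply Rplus_le_le_0_compat; apply Rabs_pos.
Qed.

Lemma bounded_lipschitz_plus (f g : R -> R -> R) :
  bounded_lipschitz f -> bounded_lipschitz g ->
  bounded_lipschitz (fun x y => f x y + g x y).
Proof.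
  intros [M HM] [N HN]. exists (M + N). intros x y x' y'.
  destruct (HM x y x' y') as [A1 A2]. destruct (HN x y x' y') as [B1 B2].
  split.
  - eapply Rle_trans; [apply Rabs_triang|lra].
  - replace (f x y + g x y - (f x' y' + g x' y'))
      with ((f x y - f x' y') + (g x y - g x' y')) by ring.
    eapply Rle_trans; [apply Rabs_triang|lra].
Qed.

Lemma bounded_lipschitz_mult (f g : R -> R -> R) :
  bounded_lipschitz f -> bounded_lipschitz g ->
  bounded_lipschitz (fun x y => f x y * g x y).
Proof.
  intros [M HM] [N HN].
  assert (M0 := bound_nonneg _ _ _ HM).
  assert (N0 := bound_nonneg _ _ _ HN).
  exists (2 * (M * N)). intros x y x' y'.
  destruct (HM x y x' y') as [A1 A2]. destruct (HN x y x' y') as [B1 B2].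
  destruct (HM x' y' x y) as [A3 _].
  assert (P1 := Rabs_pos (f x y)). assert (P2 := Rabs_pos (g x y)).
  assert (P3 := Rabs_pos (f x' y')).
  assert (P4 := Rabs_pos (f x y - f x' y')). assert (P5 := Rabs_pos (g x y - g x' y')).
  split.
  - rewrite Rabs_mult. assert (Rabs (f x y) * Rabs (g x y) <= M * N)
      by (apply Rmult_le_compat; assumption).
    assert (0 <= M * N) by (apply Rmult_le_pos; assumption). lra.
  - replace (f x y * g x y - f x' y' * g x' y')
      with ((f x y - f x' y') * g x y + f x' y' * (g x y - g x' y')) by ring.
    eapply Rle_trans; [apply Rabs_triang|]. rewrite !Rabs_mult.
    set (d := Rabs (x - x') + Rabs (y - y')) in *.
    assert (Rabs (f x y - f x' y') * Rabs (g x y) <= (M * d) * N)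
      by (apply Rmult_le_compat; assumption).
    assert (Rabs (f x' y') * Rabs (g x y - g x' y') <= M * (N * d))
      by (apply Rmult_le_compat; assumption).
    lra.
Qed.

Lemma bounded_lipschitz_comp (g g' : R -> R) (f : R -> R -> R) :
  (forall v, is_derive g v (g' v)) -> (forall v, continuous g' v) ->
  bounded_lipschitz f -> bounded_lipschitz (fun x y => g (f x y)).
Proof.
  intros Hg Hg' [M HM].
  assert (M0 := bound_nonneg _ _ _ HM).
  assert (Hmax : forall h : R -> R, (forall v, continuous h v) ->
    exists K, 0 <= K /\ forall v, Rabs v <= M -> Rabs (h v) <= K).
  { intros h Hh.
    destruct (continuity_ab_maj (fun v => Rabs (h v)) (- M) M) as [v0 [Hv0 _]]; [lra| |].
    - intros c _. apply continuity_pt_filterlim.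
      apply (continuous_comp h Rabs); [apply Hh|apply continuous_Rabs].
    - exists (Rabs (h v0)). split; [apply Rabs_pos|].
      intros v Hv. apply Hv0. now apply Rabs_le_between. }
  destruct (Hmax g) as [K [K0 HK]].
  { intros v. apply (continuous_of_derive _ _ _ (Hg v)). }
  destruct (Hmax g' Hg') as [K' [K'0 HK']].
  exists (K + K' * M). intros x y x' y'.
  destruct (HM x y x' y') as [A1 A2]. destruct (HM x' y' x y) as [A3 _].
  set (d := Rabs (x - x') + Rabs (y - y')) in *.
  assert (0 <= d) by (apply Rplus_le_le_0_compat; apply Rabs_pos).
  assert (0 <= K' * M) by (now apply Rmult_le_pos).
  split.
  - specialize (HK _ A1). lra.
  - assert (Hlip : forall u v, Rabs u <= M -> Rabs v <= M -> u < v ->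
      Rabs (g v - g u) <= K' * Rabs (v - u)).
    { intros u v Hu Hv Huv. destruct (mvt g g' u v Huv) as [c [Hc ->]]; [auto|].
      rewrite Rabs_mult. apply Rmult_le_compat_r; [apply Rabs_pos|]. apply HK'.
      apply Rabs_le_between in Hu, Hv. apply Rabs_le. lra. }
    assert (H1 : Rabs (g (f x y) - g (f x' y')) <= K' * Rabs (f x y - f x' y')).
    { destruct (Rtotal_order (f x y) (f x' y')) as [H1|[->|H1]].
      - rewrite Rabs_minus_sym, (Rabs_minus_sym (f x y)). auto.
      - rewrite !Rminus_diag, Rabs_R0. lra.
      - auto. }
    assert (K' * Rabs (f x y - f x' y') <= K' * (M * d)) by (now apply Rmult_le_compat_l).
    assert (0 <= K * d) by (now apply Rmult_le_pos). lra.
Qed.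

Lemma bounded_lipschitz_inv_max (d : R) (f : R -> R -> R) :
  0 < d -> bounded_lipschitz f -> bounded_lipschitz (fun x y => / Rmax d (f x y)).
Proof.
  intros Hd [M HM].
  assert (M0 := bound_nonneg _ _ _ HM).
  assert (Hd' : 0 < / d) by now apply Rinv_0_lt_compat.
  exists (/ d + / d * / d * M). intros x y x' y'. destruct (HM x y x' y') as [A1 A2].
  assert (0 <= / d * / d * M).
  { apply Rmult_le_pos; [|assumption]. apply Rmult_le_pos; lra. }
  assert (U := Rmax_l d (f x y)). assert (U' := Rmax_l d (f x' y')).
  assert (Hmax : Rabs (Rmax d (f x y) - Rmax d (f x' y')) <= Rabs (f x y - f x' y')).
  { unfold Rmax. destruct (Rle_dec d (f x y)), (Rle_dec d (f x' y'));
    unfold Rabs; repeat destruct Rcase_abs; lra. }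
  set (u := Rmax d (f x y)) in *. set (u' := Rmax d (f x' y')) in *.
  assert (I : 0 < / u <= / d)
    by (split; [apply Rinv_0_lt_compat; lra|apply Rinv_le_contravar; lra]).
  assert (I' : 0 < / u' <= / d)
    by (split; [apply Rinv_0_lt_compat; lra|apply Rinv_le_contravar; lra]).
  split; [rewrite Rabs_right; lra|].
  set (D := Rabs (x - x') + Rabs (y - y')) in *.
  assert (0 <= D) by (apply Rplus_le_le_0_compat; apply Rabs_pos).
  replace (/ u - / u') with (/ u * / u' * (u' - u)) by (field; lra).
  rewrite Rabs_mult, (Rabs_minus_sym u'), Rabs_right
    by (apply Rle_ge, Rmult_le_pos; lra).
  assert (/ u * / u' * Rabs (u - u') <= / d * / d * (M * D)).
  { apply Rmult_le_compat; [apply Rmult_le_pos; lra|apply Rabs_pos| |lra].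
    apply Rmult_le_compat; lra. }
  assert (0 <= / d * D) by (apply Rmult_le_pos; lra). lra.
Qed.

Definition clamp (Y y : R) : R := Rmax (- Y) (Rmin Y y).

Lemma clamp_id (Y y : R) : Rabs y <= Y -> clamp Y y = y.
Proof.
  intros H. apply Rabs_le_between in H. unfold clamp.
  rewrite Rmin_right, Rmax_right by lra. reflexivity.
Qed.

Lemma bounded_lipschitz_clamp (Y : R) :
  0 <= Y -> bounded_lipschitz (fun _ y => clamp Y y).
Proof.
  intros HY. exists (Y + 1). intros x y x' y'.
  assert (H := Rabs_pos (x - x')). assert (H0 := Rabs_pos (y - y')).
  unfold clamp. split.
  - unfold Rmax, Rmin, Rabs.
    repeat (destruct Rle_dec || destruct Rcase_abs); lra.
  - assert (Rabs (Rmax (- Y) (Rmin Y y) - Rmax (- Y) (Rmin Y y')) <= Rabs (y - y')).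
    { clear. unfold Rmax, Rmin, Rabs.
      repeat (destruct Rle_dec || destruct Rcase_abs); lra. }
    nra.
Qed.

Lemma bounded_lipschitz_trig (g g' : R -> R) :
  (forall v, is_derive g v (g' v)) ->
  (forall v, Rabs (g v) <= 1) -> (forall v, Rabs (g' v) <= 1) ->
  bounded_lipschitz (fun x _ => g x).
Proof.
  intros Hg H1 H2. exists 1. intros x y x' y'. split; [apply H1|].
  assert (H0 := Rabs_pos (y - y')). assert (H3 := Rabs_pos (x - x')).
  assert (Hl : forall u v, u < v -> Rabs (g v - g u) <= Rabs (v - u)).
  { intros u v Huv. destruct (mvt g g' u v Huv) as [c [_ ->]]; [auto|].
    rewrite Rabs_mult. specialize (H2 c). assert (X := Rabs_pos (v - u)). nra. }
  destruct (Rtotal_order x x') as [H|[->|H]].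
  - rewrite Rabs_minus_sym, (Rabs_minus_sym x).
    specialize (Hl _ _ H). rewrite (Rabs_minus_sym x x') in *. lra.
  - rewrite !Rminus_diag, Rabs_R0 in *. lra.
  - specialize (Hl _ _ H). lra.
Qed.

Lemma bounded_lipschitz_sin : bounded_lipschitz (fun x _ => sin x).
Proof.
  apply (bounded_lipschitz_trig sin cos).
  - exact is_derive_sin.
  - intros v. apply Rabs_le, SIN_bound.
  - intros v. apply Rabs_le, COS_bound.
Qed.

Lemma bounded_lipschitz_cos : bounded_lipschitz (fun x _ => cos x).
Proof.
  apply (bounded_lipschitz_trig cos (fun v => - sin v)).
  - exact is_derive_cos.
  - intros v. apply Rabs_le, COS_bound.
  - intros v. rewrite Rabs_Ropp. apply Rabs_le, SIN_bound.
Qed.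

Lemma bounded_lipschitz_sinh (f : R -> R -> R) :
  bounded_lipschitz f -> bounded_lipschitz (fun x y => sinh (f x y)).
Proof.
  apply (bounded_lipschitz_comp sinh cosh); [exact is_derive_sinh|].
  intros v. apply (continuous_of_derive _ _ _ (is_derive_cosh v)).
Qed.

Lemma bounded_lipschitz_cosh (f : R -> R -> R) :
  bounded_lipschitz f -> bounded_lipschitz (fun x y => cosh (f x y)).
Proof.
  apply (bounded_lipschitz_comp cosh sinh); [exact is_derive_cosh|].
  intros v. apply (continuous_of_derive _ _ _ (is_derive_sinh v)).
Qed.

(** * The reduced system *)

(** The square of the modulus of [sin (x + i y)]. *)
Definition sin_norm2 (x y : R) : R := sin x ^ 2 + sinh y ^ 2.

(** The squared moduli of [sin ((z_k - z_l) / 2)] for the configuration with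
    [zeta = x + i y]: [gap1] belongs to the pairs (0, 1) and (2, 3), [gap2] to (0, 2)
    and (1, 3), [gap3] to (0, 3) and [gap4] to (1, 2). *)
Definition gap1 (x y : R) : R := sin_norm2 x y.
Definition gap2 (b m x y : R) : R := sin_norm2 x (b + m * y).
Definition gap3 (b m y : R) : R := sinh (b + m * y + y) ^ 2.
Definition gap4 (b m y : R) : R := sinh (b + m * y - y) ^ 2.

Definition regular (b m x y : R) : Prop :=
  0 < gap1 x y /\ 0 < gap2 b m x y /\ 0 < gap3 b m y /\ 0 < gap4 b m y.

(** The arguments [r1], ..., [r4] stand for the inverses of the gaps; they are
    separate from [x] and [y] because truncated gaps take their place below. *)
Definition velocity_x (kap b m x y r1 r2 r3 r4 : R) : R :=
  kap * (- (2 * (sinh y * cosh y)) * r1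
         + 2 * m * (sinh (b + m * y) * cosh (b + m * y)) * r2
         + (1 - m) * (cosh (b + m * y + y) * sinh (b + m * y + y)) * r3
         + - (1 + m) * (cosh (b + m * y - y) * sinh (b + m * y - y)) * r4).

Definition velocity_y (kap x r1 r2 : R) : R :=
  kap * (2 * (sin x * cos x) * (r1 + - r2)).

Definition field_x (kap b m x y : R) : R :=
  velocity_x kap b m x y (/ gap1 x y) (/ gap2 b m x y) (/ gap3 b m y) (/ gap4 b m y).

Definition field_y (kap b m x y : R) : R :=
  velocity_y kap x (/ gap1 x y) (/ gap2 b m x y).

Definition solution (kap b m : R) (x y : R -> R) : Prop :=
  forall t, regular b m (x t) (y t) /\
    is_derive x t (field_x kap b m (x t) (y t)) /\
    is_derive y t (field_y kap b m (x t) (y t)).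

(** A negative multiple of the Hamiltonian. *)
Definition energy (b m x y : R) : R :=
  2 * (1 - m ^ 2) * (ln (gap1 x y) - ln (gap2 b m x y))
  - (1 - m) ^ 2 * ln (gap3 b m y) - (1 + m) ^ 2 * ln (gap4 b m y).

(** The difference of the second gap and the first, in which [x] cancels. It is the
    product [sinh (a + y) * sinh (a - y)] with [a = b + m * y], and so vanishes only
    on the lines where [gap3] or [gap4] does. *)
Definition gap_difference (b m y : R) : R := sinh (b + m * y) ^ 2 - sinh y ^ 2.

Lemma gap2_minus_gap1 (b m x y : R) :
  gap2 b m x y - gap1 x y = gap_difference b m y.
Proof. unfold gap1, gap2, sin_norm2, gap_difference. ring. Qed.

Lemma gap_difference_sq (b m y : R) :
  gap_difference b m y ^ 2 = gap3 b m y * gap4 b m y.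
Proof. unfold gap_difference, gap3, gap4. rewrite <- sinh_sq_mult. ring. Qed.

Lemma regular_gap_difference (b m x y : R) :
  regular b m x y -> gap_difference b m y <> 0.
Proof.
  intros (_ & _ & H3 & H4) H0. assert (H := gap_difference_sq b m y).
  rewrite H0 in H. nra.
Qed.

(** The field is a multiple of the gradient of the energy, turned by a right
    angle. *)
Lemma energy_conserved (kap b m : R) (x y : R -> R) (t : R) :
  regular b m (x t) (y t) ->
  is_derive x t (field_x kap b m (x t) (y t)) ->
  is_derive y t (field_y kap b m (x t) (y t)) ->
  is_derive (fun s => energy b m (x s) (y s)) t 0.
Proof.
  intros (H1 & H2 & H3 & H4) Hx Hy.
  assert (Ex := is_derive_unique _ _ _ Hx). assert (Ey := is_derive_unique _ _ _ Hy).
  unfold field_x, field_y, velocity_x, velocity_y in *.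
  unfold energy, gap1, gap2, gap3, gap4, sin_norm2 in *.
  auto_derive.
  - repeat split; try assumption; eexists; eassumption.
  - replace (Derive (fun x0 => x x0) t) with (Derive x t) by reflexivity.
    replace (Derive (fun x0 => y x0) t) with (Derive y t) by reflexivity.
    rewrite Ex, Ey. unfold Rminus in *. field. repeat split; intros H; rewrite H in *; lra || nra.
Qed.

(** * Confinement of the level sets of the energy *)

Lemma sinh_sq_le (v w : R) : Rabs v <= w -> sinh v ^ 2 <= sinh w ^ 2.
Proof.
  intros H. rewrite <- (sinh_sq_even v). assert (H0 := Rabs_pos v).
  assert (sinh (Rabs v) <= sinh w).
  { destruct H as [H| ->]; [left; now apply sinh_lt|lra]. }
  assert (Rabs v <= sinh (Rabs v)) by now apply sinh_ge. nra.
Qed.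

Lemma sin_norm2_bounds (x y : R) : sinh y ^ 2 <= sin_norm2 x y <= 1 + sinh y ^ 2.
Proof.
  unfold sin_norm2. assert (H := sin2_cos2 x). unfold Rsqr in H.
  nra.
Qed.

(** The four gaps dominate the squares of [y], [a], [a + y] and [a - y], where
    [a = b + m * y].  If [b <> 0], no two of these linear forms vanish together. *)
Lemma two_gaps (b m x y : R) : Rabs m < 1 ->
  let e := b ^ 2 / 16 in
  (e <= gap1 x y \/ e <= gap2 b m x y) /\ (e <= gap1 x y \/ e <= gap3 b m y) /\
  (e <= gap1 x y \/ e <= gap4 b m y) /\ (e <= gap2 b m x y \/ e <= gap3 b m y) /\
  (e <= gap2 b m x y \/ e <= gap4 b m y) /\ (e <= gap3 b m y \/ e <= gap4 b m y).
Proof.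
  intros Hm e.
  assert (Hmy : Rabs (m * y) <= Rabs y).
  { rewrite Rabs_mult. assert (H := Rabs_pos y). nra. }
  assert (Hsmall : forall v g, v ^ 2 <= g -> g < e -> Rabs v < Rabs b / 4).
  { intros v g Hv Hg. assert (H := Rabs_pos b). assert (H' := Rabs_pos v).
    rewrite <- (pow2_abs v) in Hv. unfold e in Hg. rewrite <- (pow2_abs b) in Hg. nra. }
  assert (G1 : y ^ 2 <= gap1 x y).
  { eapply Rle_trans; [apply sinh_sq_ge|apply sin_norm2_bounds]. }
  assert (G2 : (b + m * y) ^ 2 <= gap2 b m x y).
  { eapply Rle_trans; [apply sinh_sq_ge|apply sin_norm2_bounds]. }
  assert (G3 : (b + m * y + y) ^ 2 <= gap3 b m y) by apply sinh_sq_ge.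
  assert (G4 : (b + m * y - y) ^ 2 <= gap4 b m y) by apply sinh_sq_ge.
  set (z := m * y) in *.
  repeat split;
  match goal with |- ?u \/ ?v =>
    apply NNPP; intros Hn; apply not_or_and in Hn as [Hn1 Hn2];
    apply Rnot_le_lt in Hn1, Hn2 end;
  match goal with
  | G : ?u ^ 2 <= ?g, G' : ?v ^ 2 <= ?g', H : ?g < e, H' : ?g' < e |- _ =>
    tryif constr_eq g g' then fail else
    (apply (Hsmall u g G) in H; apply (Hsmall v g' G') in H')
  end;
  revert Hmy Hn1 Hn2; clear; intros; unfold Rabs in *;
  repeat destruct Rcase_abs; lra.
Qed.

Lemma weighted_log_bound (w wi l K B : R) :
  0 < w <= wi -> 0 <= K -> 0 <= B -> - K <= wi * l -> - (K / w + B) <= l.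
Proof.
  intros Hw HK HB Hl. assert (0 <= K / w) by (apply Rdiv_le_0_compat; lra).
  destruct (Rle_or_lt 0 l) as [H0|H0]; [lra|].
  assert (- (K / w) <= l); [|lra]. apply (Rmult_le_reg_l w); [lra|].
  replace (w * - (K / w)) with (- K) by (field; lra). nra.
Qed.

(** At a given energy, at most one gap can be small, and then its logarithm is
    determined by the energy and by the other three. *)
Lemma gaps_bounded_below (b m h Y : R) : b <> 0 -> Rabs m < 1 ->
  exists d, 0 < d /\ forall x y, regular b m x y -> energy b m x y = h ->
    Rabs y <= Y ->
    d < gap1 x y /\ d < gap2 b m x y /\ d < gap3 b m y /\ d < gap4 b m y.
Proof.
  intros Hb Hm.
  set (e := b ^ 2 / 16).
  assert (He : 0 < e) by (unfold e; assert (0 < b ^ 2) by (now apply pow2_gt_0); lra).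
  set (C := 1 + sinh (Rabs b + 2 * Rabs Y) ^ 2).
  assert (HC : 1 <= C) by (unfold C; assert (X := pow2_ge_0 (sinh (Rabs b + 2 * Rabs Y))); lra).
  assert (Hc : 0 <= ln C) by (rewrite <- ln_1; destruct HC as [HC|<-];
    [left; apply ln_increasing; lra|lra]).
  set (B := ln C + Rabs (ln e)). assert (Habs := Rabs_pos (ln e)).
  assert (HB : 0 <= B) by (unfold B; lra).
  assert (Hgood : forall g, g <= C -> e <= g -> - B <= ln g <= B).
  { intros g H1 H2. assert (ln g <= ln C) by (apply ln_le; lra).
    assert (ln e <= ln g) by (apply ln_le; lra).
    assert (X := Rle_abs (- ln e)). rewrite Rabs_Ropp in X. unfold B. lra. }
  set (al := 2 * (1 - m ^ 2)). set (be := (1 - m) ^ 2). set (ga := (1 + m) ^ 2).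
  assert (Hm' := proj1 (Rabs_lt_between _ _) Hm).
  assert (Hal : 0 < al <= 4) by (unfold al; nra).
  assert (Hbe : 0 < be <= 4) by (unfold be; nra).
  assert (Hga : 0 < ga <= 4) by (unfold ga; nra).
  set (w := Rmin al (Rmin be ga)).
  assert (Hw : 0 < w) by (unfold w; repeat apply Rmin_glb_lt; lra).
  assert (Hwal : w <= al) by apply Rmin_l.
  assert (Hwbe : w <= be) by (eapply Rle_trans; [apply Rmin_r|apply Rmin_l]).
  assert (Hwga : w <= ga) by (eapply Rle_trans; [apply Rmin_r|apply Rmin_r]).
  set (K := Rabs h + 12 * B).
  assert (HK : 0 <= K) by (unfold K; assert (X := Rabs_pos h); lra).
  exists (exp (- (K / w + B) - 1)). split; [apply exp_pos|].
  intros x y (P1 & P2 & P3 & P4) Hen Hy.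
  assert (Hmy : Rabs (m * y) <= Rabs Y).
  { rewrite Rabs_mult. assert (X := Rabs_pos y). assert (X' := Rle_abs Y). nra. }
  assert (Hy' : Rabs y <= Rabs Y) by (assert (X' := Rle_abs Y); lra).
  assert (C1 : gap1 x y <= C).
  { eapply Rle_trans; [apply sin_norm2_bounds|]. apply Rplus_le_compat_l, sinh_sq_le.
    assert (X := Rabs_pos b). assert (X' := Rabs_pos Y). lra. }
  assert (C2 : gap2 b m x y <= C).
  { eapply Rle_trans; [apply sin_norm2_bounds|]. apply Rplus_le_compat_l, sinh_sq_le.
    eapply Rle_trans; [apply Rabs_triang|]. assert (X' := Rabs_pos Y). lra. }
  assert (C3 : gap3 b m y <= C).
  { assert (gap3 b m y <= sinh (Rabs b + 2 * Rabs Y) ^ 2); [|unfold C; lra].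
    apply sinh_sq_le. eapply Rle_trans; [apply Rabs_triang|].
    assert (X := Rabs_triang b (m * y)). lra. }
  assert (C4 : gap4 b m y <= C).
  { assert (gap4 b m y <= sinh (Rabs b + 2 * Rabs Y) ^ 2); [|unfold C; lra].
    apply sinh_sq_le. unfold Rminus. eapply Rle_trans; [apply Rabs_triang|].
    assert (X := Rabs_triang b (m * y)). rewrite Rabs_Ropp. lra. }
  destruct (two_gaps b m x y Hm) as (T12 & T13 & T14 & T23 & T24 & T34). fold e in T12, T13, T14, T23, T24, T34.
  unfold energy in Hen. fold al be ga in Hen.
  assert (Hprod : forall u l, 0 < u <= 4 -> - B <= l <= B -> - (4 * B) <= u * l <= 4 * B).
  { intros u l Hu Hl. split; nra. }
  assert (Hh := proj1 (Rabs_le_between h (Rabs h)) (Rle_refl _)).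
  assert (HBw : 0 <= K / w) by (apply Rdiv_le_0_compat; lra).
  assert (Hconcl : forall g, 0 < g -> - (K / w + B) <= ln g -> exp (- (K / w + B) - 1) < g).
  { intros g Hg Hl. rewrite <- (exp_ln g Hg). apply exp_increasing. lra. }
  set (l1 := ln (gap1 x y)) in *. set (l2 := ln (gap2 b m x y)) in *.
  set (l3 := ln (gap3 b m y)) in *. set (l4 := ln (gap4 b m y)) in *.
  assert (A1 : e <= gap1 x y -> - B <= l1 <= B) by (intros; apply Hgood; assumption).
  assert (A2 : e <= gap2 b m x y -> - B <= l2 <= B) by (intros; apply Hgood; assumption).
  assert (A3 : e <= gap3 b m y -> - B <= l3 <= B) by (intros; apply Hgood; assumption).
  assert (A4 : e <= gap4 b m y -> - B <= l4 <= B) by (intros; apply Hgood; assumption).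
  assert (Q1 : - B <= l1 <= B -> - (4 * B) <= al * l1 <= 4 * B) by (apply Hprod, Hal).
  assert (Q2 : - B <= l2 <= B -> - (4 * B) <= al * l2 <= 4 * B) by (apply Hprod, Hal).
  assert (Q3 : - B <= l3 <= B -> - (4 * B) <= be * l3 <= 4 * B) by (apply Hprod, Hbe).
  assert (Q4 : - B <= l4 <= B -> - (4 * B) <= ga * l4 <= 4 * B) by (apply Hprod, Hga).
  assert (U2 : l2 <= B).
  { assert (l2 <= ln C) by (apply ln_le; assumption). unfold B; lra. }
  repeat split; apply Hconcl; try assumption.
  - destruct (Rle_or_lt e (gap1 x y)) as [H|H]; [specialize (A1 H); fold l1; lra|].
    destruct T12, T13, T14; try lra.
    apply (weighted_log_bound w al); [lra|assumption|assumption|]. fold l1. unfold K. lra.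
  - destruct (Rle_or_lt e (gap2 b m x y)) as [H|H]; [specialize (A2 H); fold l2; lra|].
    destruct T12, T23, T24; try lra.
    (* the second gap has the negative weight, so that a small value of it makes
       the energy large *)
    apply (weighted_log_bound w al); [lra|assumption|assumption|]. fold l2. unfold K. lra.
  - destruct (Rle_or_lt e (gap3 b m y)) as [H|H]; [specialize (A3 H); fold l3; lra|].
    destruct T13, T23, T34; try lra.
    apply (weighted_log_bound w be); [lra|assumption|assumption|]. fold l3. unfold K. lra.
  - destruct (Rle_or_lt e (gap4 b m y)) as [H|H]; [specialize (A4 H); fold l4; lra|].
    destruct T14, T24, T34; try lra.
    apply (weighted_log_bound w ga); [lra|assumption|assumption|]. fold l4. unfold K. lra.
Qed.

(** The motions through [(x0, y0)] cannot escape vertically: the level set of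
    the energy is bounded in the part where [gap_difference] has the same sign,
    which contains the connected component of [(x0, y0)]. *)
Definition confined (b m x0 y0 : R) : Prop :=
  exists Y, forall x y, regular b m x y -> energy b m x y = energy b m x0 y0 ->
    0 < gap_difference b m y0 * gap_difference b m y -> Rabs y <= Y.

Lemma ln_sinh_sq_ge (v : R) : 1 <= Rabs v -> 2 * Rabs v - ln 16 <= ln (sinh v ^ 2).
Proof.
  intros H. rewrite <- (sinh_sq_even v). set (u := Rabs v) in *.
  assert (He : exp u / 4 <= sinh u).
  { unfold sinh. assert (exp (- u) <= 1).
    { rewrite <- exp_0. left. apply exp_increasing. lra. }
    assert (2 <= exp u) by (assert (X := exp_ineq1_le u); lra). lra. }
  assert (Hp := exp_pos u).
  replace (2 * u - ln 16) with (ln ((exp u / 4) ^ 2)).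
  - apply ln_le; [apply pow_lt; lra|]. apply pow_incr. lra.
  - replace ((exp u / 4) ^ 2) with (exp (2 * u) / 16).
    + unfold Rdiv. rewrite ln_mult, ln_exp, ln_Rinv by (apply exp_pos || lra). ring.
    + replace (2 * u) with (u + u) by ring. rewrite exp_plus. field.
Qed.

Lemma ln_sin_norm2_le (x y : R) : 0 < sin_norm2 x y -> ln (sin_norm2 x y) <= 2 * Rabs y.
Proof.
  intros H. rewrite <- (ln_exp (2 * Rabs y)). apply ln_le; [assumption|].
  eapply Rle_trans; [apply sin_norm2_bounds|].
  rewrite <- (sinh_sq_even y). rewrite <- cosh_sinh_sq.
  replace (2 * Rabs y) with (Rabs y + Rabs y) by ring. rewrite exp_plus.
  assert (exp (- Rabs y) <= exp (Rabs y)).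
  { assert (X := Rabs_pos y). destruct X as [X|<-]; [|rewrite Ropp_0; lra].
    left. apply exp_increasing. lra. }
  unfold cosh. assert (X' := exp_pos (- Rabs y)). nra.
Qed.

(** For large [y], the terms linear in [Rabs y] add up to
    [- 4 * (1 - m ^ 2) * Rabs m * Rabs y]. *)
Lemma confined_asymmetric (b m x0 y0 : R) :
  m <> 0 -> Rabs m < 1 -> confined b m x0 y0.
Proof.
  intros Hm0 Hm.
  assert (Hm' := proj1 (Rabs_lt_between _ _) Hm).
  assert (Hmp : 0 < Rabs m) by (now apply Rabs_pos_lt).
  set (h := energy b m x0 y0). set (al := 1 - m ^ 2).
  assert (Hal : 0 < al) by (unfold al; nra).
  set (w := Rmin (Rabs m) (Rmin (1 - m) (1 + m))).
  assert (Hw : 0 < w) by (unfold w; repeat apply Rmin_glb_lt; lra).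
  assert (W1 : w <= Rabs m) by apply Rmin_l.
  assert (W2 : w <= 1 - m) by (eapply Rle_trans; [apply Rmin_r|apply Rmin_l]).
  assert (W3 : w <= 1 + m) by (eapply Rle_trans; [apply Rmin_r|apply Rmin_r]).
  set (C := 2 * al * (2 * Rabs b + ln 16) + (1 - m) ^ 2 * (2 * Rabs b + ln 16)
            + (1 + m) ^ 2 * (2 * Rabs b + ln 16)).
  exists (Rmax ((1 + Rabs b) / w) ((C - h) / (4 * al * Rabs m))).
  intros x y (P1 & P2 & P3 & P4) Hen _. apply Rnot_lt_le. intros Hlt.
  assert (Y1 := Rle_lt_trans _ _ _ (Rmax_l _ _) Hlt).
  assert (Y2 := Rle_lt_trans _ _ _ (Rmax_r _ _) Hlt). clear Hlt.
  apply (Rmult_lt_compat_l w) in Y1; [|assumption].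
  replace (w * ((1 + Rabs b) / w)) with (1 + Rabs b) in Y1 by (field; lra).
  assert (Hk : 0 < 4 * al * Rabs m) by (apply Rmult_lt_0_compat; lra).
  apply (Rmult_lt_compat_l (4 * al * Rabs m)) in Y2; [|assumption].
  replace (4 * al * Rabs m * ((C - h) / (4 * al * Rabs m))) with (C - h) in Y2
    by (field; lra).
  assert (Y0 := Rabs_pos y).
  assert (L1 := ln_sin_norm2_le x y P1).
  assert (Hlow : forall c, w <= Rabs c ->
     2 * (Rabs c * Rabs y - Rabs b) - ln 16 <= ln (sinh (b + c * y) ^ 2)).
  { intros c Hc. assert (X := Rabs_triang (b + c * y) (- b)).
    replace (b + c * y + - b) with (c * y) in X by ring.
    rewrite Rabs_Ropp, Rabs_mult in X.
    assert (w * Rabs y <= Rabs c * Rabs y) by (now apply Rmult_le_compat_r).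
    assert (Y := ln_sinh_sq_ge (b + c * y) ltac:(lra)). lra. }
  assert (L2 : 2 * (Rabs m * Rabs y - Rabs b) - ln 16 <= ln (gap2 b m x y)).
  { eapply Rle_trans; [apply (Hlow m W1)|]. apply ln_le; [|apply sin_norm2_bounds].
    assert (X := pow2_ge_0 (sinh (b + m * y))). destruct X as [X|X]; [assumption|].
    exfalso. assert (S0 : sinh (b + m * y) = 0) by nra. apply sinh_eq_0 in S0.
    assert (X' := Rabs_triang (b + m * y) (- b)).
    replace (b + m * y + - b) with (m * y) in X' by ring.
    rewrite Rabs_Ropp, Rabs_mult, S0, Rabs_R0 in X'.
    assert (w * Rabs y <= Rabs m * Rabs y) by (now apply Rmult_le_compat_r). lra. }
  assert (L3 : 2 * ((1 + m) * Rabs y - Rabs b) - ln 16 <= ln (gap3 b m y)).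
  { rewrite <- (Rabs_right (1 + m)) at 1 by lra. unfold gap3.
    replace (b + m * y + y) with (b + (1 + m) * y) by ring. apply Hlow.
    rewrite Rabs_right; lra. }
  assert (L4 : 2 * ((1 - m) * Rabs y - Rabs b) - ln 16 <= ln (gap4 b m y)).
  { replace (1 - m) with (Rabs (m - 1)) at 1
      by (rewrite Rabs_left1 by lra; ring). unfold gap4.
    replace (b + m * y - y) with (b + (m - 1) * y) by ring. apply Hlow.
    rewrite Rabs_left1; lra. }
  fold h in Hen. unfold energy in Hen. fold al in Hen. change (sin_norm2 x y) with (gap1 x y) in L1.
  assert (Q1 : 2 * al * (ln (gap1 x y) - ln (gap2 b m x y))
     <= 2 * al * (2 * Rabs y - (2 * (Rabs m * Rabs y - Rabs b) - ln 16)))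
    by (apply Rmult_le_compat_l; lra).
  assert (Q3 : (1 - m) ^ 2 * (2 * ((1 + m) * Rabs y - Rabs b) - ln 16)
     <= (1 - m) ^ 2 * ln (gap3 b m y)) by (apply Rmult_le_compat_l; [apply pow2_ge_0|lra]).
  assert (Q4 : (1 + m) ^ 2 * (2 * ((1 - m) * Rabs y - Rabs b) - ln 16)
     <= (1 + m) ^ 2 * ln (gap4 b m y)) by (apply Rmult_le_compat_l; [apply pow2_ge_0|lra]).
  unfold C, al in *. lra.
Qed.

(** If [m = 0], the inner strip is bounded, and in the outer strips the energy
    is at most [2 * ln (s / (B * (s - B)))] with [s = sinh y ^ 2] and
    [B = sinh b ^ 2], which tends to [- 2 * ln B]. *)
Lemma confined_symmetric (b x0 y0 : R) :
  b <> 0 -> (0 < gap_difference b 0 y0 \/ - 2 * ln (sinh b ^ 2) < energy b 0 x0 y0) ->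
  confined b 0 x0 y0.
Proof.
  intros Hb Hcase.
  assert (HB : 0 < sinh b ^ 2).
  { apply pow2_gt_0. intros H. now apply Hb, sinh_eq_0. }
  set (B := sinh b ^ 2) in *.
  assert (Hgd : forall y, gap_difference b 0 y = B - sinh y ^ 2).
  { intros y. unfold gap_difference. rewrite Rmult_0_l, Rplus_0_r. reflexivity. }
  assert (Hinner : forall y, 0 < gap_difference b 0 y -> Rabs y <= Rabs b).
  { intros y Hy. left. apply sinh_sq_lt. rewrite Hgd in Hy. unfold B in Hy. lra. }
  destruct (Rlt_or_le 0 (gap_difference b 0 y0)) as [H0|H0].
  { exists (Rabs b). intros x y _ _ Hpos. apply Hinner. nra. }
  destruct Hcase as [?|Hen]; [lra|].
  set (k := exp (energy b 0 x0 y0 / 2)).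
  assert (Hk : 0 < k) by apply exp_pos.
  assert (HkB : 1 < k * B).
  { unfold k. rewrite <- (exp_ln B HB) at 1. rewrite <- exp_plus, <- exp_0.
    apply exp_increasing. lra. }
  exists (1 + k * B ^ 2 / (k * B - 1)). intros x y (P1 & P2 & P3 & P4) Heq Hpos.
  set (s := sinh y ^ 2) in *. set (u := sin x ^ 2).
  assert (Hs : B < s).
  { rewrite (Hgd y) in Hpos. fold s in Hpos. nra. }
  assert (Hu : 0 <= u) by apply pow2_ge_0.
  assert (E1 : gap1 x y = u + s) by reflexivity.
  assert (E2 : gap2 b 0 x y = u + B).
  { unfold gap2. rewrite Rmult_0_l, Rplus_0_r. reflexivity. }
  assert (E34 : gap3 b 0 y * gap4 b 0 y = (s - B) * (s - B)).
  { rewrite <- gap_difference_sq, Hgd. fold s. ring. }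
  assert (Hkv : k * ((u + B) * (s - B)) = u + s).
  { apply ln_inv; [apply Rmult_lt_0_compat; [assumption|apply Rmult_lt_0_compat; lra]|lra|].
    rewrite !ln_mult by (try apply Rmult_lt_0_compat; lra).
    unfold k. rewrite ln_exp, <- Heq. unfold energy. rewrite E1, E2.
    assert (E34' : ln (gap3 b 0 y) + ln (gap4 b 0 y) = 2 * ln (s - B)).
    { rewrite <- ln_mult by assumption. rewrite E34, ln_mult by lra. ring. }
    replace (ln (gap3 b 0 y)) with (2 * ln (s - B) - ln (gap4 b 0 y)) by lra.
    field. }
  assert (Hks : k * B * (s - B) <= s).
  { apply (Rmult_le_reg_r (u + B)); [lra|].
    replace (k * B * (s - B) * (u + B)) with (B * (k * ((u + B) * (s - B)))) by ring.
    rewrite Hkv. nra. }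
  assert (Hsb : s <= k * B ^ 2 / (k * B - 1)).
  { apply (Rmult_le_reg_l (k * B - 1)); [lra|].
    replace ((k * B - 1) * (k * B ^ 2 / (k * B - 1))) with (k * B ^ 2) by (field; lra).
    nra. }
  assert (Hy : Rabs y ^ 2 <= s) by (rewrite pow2_abs; apply sinh_sq_ge).
  nra.
Qed.

(** * Global solutions *)

(** The field with all denominators truncated at [d] and [y] clamped is bounded
    and Lipschitz, and agrees with the field where the truncations are void. *)
Definition truncated_x (kap b m Y d x y : R) : R :=
  let z := clamp Y y in
  velocity_x kap b m x z (/ Rmax d (gap1 x z)) (/ Rmax d (gap2 b m x z))
    (/ Rmax d (gap3 b m z)) (/ Rmax d (gap4 b m z)).

Definition truncated_y (kap b m Y d x y : R) : R :=
  let z := clamp Y y in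
  velocity_y kap x (/ Rmax d (gap1 x z)) (/ Rmax d (gap2 b m x z)).

Definition thick (b m Y d x y : R) : Prop :=
  Rabs y <= Y /\
  d <= gap1 x y /\ d <= gap2 b m x y /\ d <= gap3 b m y /\ d <= gap4 b m y.

Lemma truncated_x_thick (kap b m Y d x y : R) :
  thick b m Y d x y -> truncated_x kap b m Y d x y = field_x kap b m x y.
Proof.
  intros (HY & H1 & H2 & H3 & H4). unfold truncated_x, field_x.
  rewrite clamp_id by assumption. rewrite !Rmax_right by assumption. reflexivity.
Qed.

Lemma truncated_y_thick (kap b m Y d x y : R) :
  thick b m Y d x y -> truncated_y kap b m Y d x y = field_y kap b m x y.
Proof.
  intros (HY & H1 & H2 & H3 & H4). unfold truncated_y, field_y.
  rewrite clamp_id by assumption. rewrite !Rmax_right by assumption. reflexivity.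
Qed.

Lemma thick_regular (b m Y d x y : R) : 0 < d -> thick b m Y d x y -> regular b m x y.
Proof. intros Hd (_ & H1 & H2 & H3 & H4). repeat split; lra. Qed.

Lemma bounded_lipschitz_sq (f : R -> R -> R) :
  bounded_lipschitz f -> bounded_lipschitz (fun x y => f x y ^ 2).
Proof.
  apply (bounded_lipschitz_comp (fun v => v ^ 2) (fun v => 2 * v)).
  - intros v. auto_derive; [trivial|ring].
  - intros v. apply (continuous_of_derive _ v 2). auto_derive; [trivial|ring].
Qed.

Ltac bounded_lipschitz_tac :=
  lazymatch goal with
  | |- bounded_lipschitz (fun x y => / Rmax ?d _) =>
      apply bounded_lipschitz_inv_max; [assumption|bounded_lipschitz_tac]
  | |- bounded_lipschitz (fun x y => clamp _ y) =>
      apply bounded_lipschitz_clamp; assumption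
  | |- bounded_lipschitz (fun x y => sin x) => apply bounded_lipschitz_sin
  | |- bounded_lipschitz (fun x y => cos x) => apply bounded_lipschitz_cos
  | |- bounded_lipschitz (fun x y => sinh _) =>
      apply bounded_lipschitz_sinh; bounded_lipschitz_tac
  | |- bounded_lipschitz (fun x y => cosh _) =>
      apply bounded_lipschitz_cosh; bounded_lipschitz_tac
  | |- bounded_lipschitz (fun x y => _ + _) =>
      apply bounded_lipschitz_plus; bounded_lipschitz_tac
  | |- bounded_lipschitz (fun x y => _ * _) =>
      apply bounded_lipschitz_mult; bounded_lipschitz_tac
  | |- bounded_lipschitz (fun x y => _ ^ 2) =>
      apply bounded_lipschitz_sq; bounded_lipschitz_tac
  | |- bounded_lipschitz (fun x y => - _) =>
      apply (bounded_lipschitz_comp Ropp (fun _ => - 1));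
      [intros; auto_derive; [trivial|ring]|intros; apply continuous_const
      |bounded_lipschitz_tac]
  | |- _ => apply bounded_lipschitz_const
  end.

Lemma bounded_lipschitz_truncated_x (kap b m Y d : R) :
  0 <= Y -> 0 < d -> bounded_lipschitz (truncated_x kap b m Y d).
Proof.
  intros HY Hd.
  unfold truncated_x, velocity_x, gap1, gap2, gap3, gap4, sin_norm2, Rminus.
  bounded_lipschitz_tac.
Qed.

Lemma bounded_lipschitz_truncated_y (kap b m Y d : R) :
  0 <= Y -> 0 < d -> bounded_lipschitz (truncated_y kap b m Y d).
Proof.
  intros HY Hd.
  unfold truncated_y, velocity_y, gap1, gap2, gap3, gap4, sin_norm2, Rminus.
  bounded_lipschitz_tac.
Qed.

Lemma continuous_gaps (b m t : R) (x y : R -> R) : ex_derive x t -> ex_derive y t ->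
  continuous (fun s => gap1 (x s) (y s)) t /\
  continuous (fun s => gap2 b m (x s) (y s)) t /\
  continuous (fun s => gap3 b m (y s)) t /\
  continuous (fun s => gap4 b m (y s)) t /\
  continuous (fun s => gap_difference b m (y s)) t.
Proof.
  intros Hx Hy. unfold gap1, gap2, gap3, gap4, gap_difference, sin_norm2.
  repeat split;
  apply (ex_derive_continuous (V := R_NormedModule));
  auto_derive; repeat split; assumption.
Qed.

Lemma closed_le (g : R -> R) (t c : R) : continuous g t ->
  (forall d, 0 < d -> exists s, Rabs (s - t) < d /\ g s <= c) -> g t <= c.
Proof.
  intros Hg H. apply Rnot_lt_le. intros Hlt.
  destruct (proj1 (continuous_R_eps g t) Hg (g t - c)) as [d [Hd Hgd]]; [lra|].
  destruct (H d Hd) as [s [Hs Hgs]]. specialize (Hgd s Hs).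
  apply Rabs_lt_between in Hgd. lra.
Qed.

Lemma locally_gt (g : R -> R) (t c : R) : continuous g t -> c < g t ->
  locally t (fun s => c < g s).
Proof.
  intros Hg Hlt. apply locally_R_ball.
  destruct (proj1 (continuous_R_eps g t) Hg (g t - c)) as [d [Hd Hgd]]; [lra|].
  exists d. split; [assumption|]. intros s Hs. specialize (Hgd s Hs).
  apply Rabs_lt_between in Hgd. lra.
Qed.

(** The truncated field has global solutions.  As long as the truncations are void,
    the energy is conserved, which keeps the solution at a positive distance from
    the boundary of the region where they are void; by connectedness of the time
    axis it never leaves this region. *)
Lemma global_solution (kap b m x0 y0 : R) :
  b <> 0 -> Rabs m < 1 -> regular b m x0 y0 -> confined b m x0 y0 ->
  exists (x y : R -> R) (Y d : R), x 0 = x0 /\ y 0 = y0 /\ solution kap b m x y /\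
    0 < d /\ forall t, thick b m Y d (x t) (y t).
Proof.
  intros Hb Hm Hreg [Y HY].
  destruct (gaps_bounded_below b m (energy b m x0 y0) Y Hb Hm) as [d [Hd Hgaps]].
  set (h := energy b m x0 y0) in *.
  assert (Hd0 := regular_gap_difference b m x0 y0 Hreg).
  assert (HY0 : Rabs y0 <= Y) by (apply (HY x0 y0); [assumption|reflexivity|nra]).
  assert (Y0 : 0 <= Y + 1) by (assert (X := Rabs_pos y0); lra).
  destruct (picard
    (fun i : bool => if i then truncated_x kap b m (Y + 1) d else truncated_y kap b m (Y + 1) d)
    (fun i : bool => if i then x0 else y0)) as [u Hu].
  { intros []; [now apply bounded_lipschitz_truncated_x|now apply bounded_lipschitz_truncated_y]. }
  set (x := u true). set (y := u false).
  assert (Hx0 : x 0 = x0) by apply (Hu true). assert (Hy0 : y 0 = y0) by apply (Hu false).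
  assert (Hder : forall t, is_derive x t (truncated_x kap b m (Y + 1) d (x t) (y t)) /\
    is_derive y t (truncated_y kap b m (Y + 1) d (x t) (y t))) 
    by (intros t; split; [apply (Hu true)|apply (Hu false)]).
  assert (Hex : forall t, ex_derive x t /\ ex_derive y t).
  { intros t. destruct (Hder t). split; eexists; eassumption. }
  assert (Hen : forall t, thick b m (Y + 1) d (x t) (y t) ->
    is_derive (fun s => energy b m (x s) (y s)) t 0).
  { intros t Ht. apply (energy_conserved kap).
    - apply (thick_regular _ _ _ _ _ _ Hd Ht).
    - rewrite <- (truncated_x_thick kap b m _ _ _ _ Ht). apply Hder.
    - rewrite <- (truncated_y_thick kap b m _ _ _ _ Ht). apply Hder. }
  set (A := fun t => regular b m (x t) (y t) /\ energy b m (x t) (y t) = h /\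
    0 < gap_difference b m y0 * gap_difference b m (y t)).
  assert (HA : forall t, A t -> Rabs (y t) <= Y /\
    d < gap1 (x t) (y t) /\ d < gap2 b m (x t) (y t) /\
    d < gap3 b m (y t) /\ d < gap4 b m (y t)).
  { intros t (R1 & R2 & R3). assert (HYt := HY _ _ R1 R2 R3).
    split; [assumption|]. now apply Hgaps. }
  assert (Hall : forall t, A t).
  { apply clopen_R.
    - intros t At. destruct (HA t At) as (B0 & B1 & B2 & B3 & B4).
      destruct At as (R1 & R2 & R3). destruct (Hex t) as [Ex Ey].
      destruct (continuous_gaps b m t x y Ex Ey) as (C1 & C2 & C3 & C4 & C5).
      assert (L : locally t (fun s => thick b m (Y + 1) d (x s) (y s) /\
        0 < gap_difference b m y0 * gap_difference b m (y s))).
      { apply locally_gt with (c := d) in C1, C2, C3, C4; try assumption.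
        assert (L5 := locally_gt _ t 0 (continuous_scal_r (K := R_AbsRing) (V := R_NormedModule)
          (gap_difference b m y0) _ t C5) R3).
        assert (Cy : continuous (fun s => - Rabs (y s)) t).
        { apply (continuous_opp (V := R_NormedModule) (fun s => Rabs (y s))).
          apply (continuous_comp y Rabs); [|apply continuous_Rabs].
          now apply (ex_derive_continuous (V := R_NormedModule)). }
        assert (L6 := locally_gt _ t (- (Y + 1)) Cy ltac:(cbv beta; lra)).
        generalize (filter_and _ _ (filter_and _ _ C1 C2)
          (filter_and _ _ (filter_and _ _ C3 C4) (filter_and _ _ L5 L6))).
        apply filter_imp. intros s [[S1 S2] [[S3 S4] [S5 S6]]].
        split; [|exact S5]. repeat split; lra. }
      apply locally_R_ball in L. destruct L as [e [He L]].
      apply locally_R_ball. exists e. split; [assumption|]. intros s Hs.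
      destruct (L s Hs) as [Lt Lg]. repeat split; try apply (thick_regular _ _ _ _ _ _ Hd Lt).
      + rewrite <- R2. symmetry.
        apply (constant_of_derive_0 (fun s => energy b m (x s) (y s))).
        intros r Hr. apply Hen, L.
        apply Rabs_lt_between in Hs. apply Rabs_lt_between.
        unfold Rmin, Rmax in Hr. destruct (Rle_dec t s); lra.
      + exact Lg.
    - intros t Ht. destruct (Hex t) as [Ex Ey].
      destruct (continuous_gaps b m t x y Ex Ey) as (C1 & C2 & C3 & C4 & C5).
      assert (Hlim : forall g, continuous g t -> (forall s, A s -> d <= g s) -> d <= g t).
      { intros g Hg HAg. assert (- g t <= - d); [|lra].
        apply (closed_le (fun s => - g s)).
        - now apply (continuous_opp (V := R_NormedModule) g).
        - intros e He. destruct (Ht e He) as [s [Hs As]]. exists s.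
          split; [assumption|]. specialize (HAg s As). lra. }
      assert (Hth : thick b m (Y + 1) d (x t) (y t)).
      { repeat split.
        - assert (Rabs (y t) <= Y); [|lra].
          apply (closed_le (fun s => Rabs (y s))).
          + apply (continuous_comp y Rabs); [|apply continuous_Rabs].
            now apply (ex_derive_continuous (V := R_NormedModule)).
          + intros e He. destruct (Ht e He) as [s [Hs As]]. exists s.
            split; [assumption|]. apply (HA s As).
        - apply (Hlim _ C1). intros s As. left. apply (HA s As).
        - apply (Hlim _ C2). intros s As. left. apply (HA s As).
        - apply (Hlim _ C3). intros s As. left. apply (HA s As).
        - apply (Hlim _ C4). intros s As. left. apply (HA s As). }
      assert (Rt := thick_regular _ _ _ _ _ _ Hd Hth).
      assert (Ce := continuous_of_derive _ _ _ (Hen t Hth)).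
      split; [assumption|]. split.
      + apply Rle_antisym.
        * apply (closed_le _ _ _ Ce). intros e He. destruct (Ht e He) as [s [Hs As]].
          exists s. split; [assumption|]. right. apply As.
        * apply Ropp_le_cancel.
          apply (closed_le (fun s => - energy b m (x s) (y s))).
          { now apply (continuous_opp (V := R_NormedModule)). }
          intros e He. destruct (Ht e He) as [s [Hs As]].
          exists s. split; [assumption|]. right. f_equal. apply As.
      + assert (N := regular_gap_difference _ _ _ _ Rt).
        assert (- (gap_difference b m y0 * gap_difference b m (y t)) <= 0).
        { apply (closed_le (fun s => - (gap_difference b m y0 * gap_difference b m (y s)))).
          - apply (continuous_opp (V := R_NormedModule)).
            now apply (continuous_scal_r (K := R_AbsRing) (V := R_NormedModule)).
          - intros e He. destruct (Ht e He) as [s [Hs As]].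
            exists s. split; [assumption|]. destruct As as (_ & _ & As). lra. }
        assert (gap_difference b m y0 * gap_difference b m (y t) <> 0)
          by (now apply Rmult_integral_contrapositive_currified). lra.
    - unfold A. rewrite Hx0, Hy0. repeat split; try apply Hreg. nra. }
  assert (Hthick : forall t, thick b m (Y + 1) d (x t) (y t)).
  { intros t. destruct (HA t (Hall t)) as (B0 & B1 & B2 & B3 & B4).
    repeat split; lra. }
  exists x, y, (Y + 1), d. split; [assumption|]. split; [assumption|].
  split; [|split; assumption].
  intros t. split; [apply Hall|].
  rewrite <- (truncated_x_thick kap b m _ _ _ _ (Hthick t)).
  rewrite <- (truncated_y_thick kap b m _ _ _ _ (Hthick t)). apply Hder.
Qed.

(** * Complex trigonometry *)

Lemma C_eq (z w : C) : Re z = Re w -> Im z = Im w -> z = w.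
Proof. destruct z, w. simpl. intros -> ->. reflexivity. Qed.

Lemma Csin_coords (z : C) :
  Csin z = (sin (Re z) * cosh (Im z), cos (Re z) * sinh (Im z)).
Proof.
  destruct z as [x y]. unfold Csin, Cexp, Ci, cosh, sinh.
  apply C_eq; simpl; rewrite ?Ropp_involutive;
  replace (0 * x - 1 * y) with (- y) by ring;
  replace (0 * y + 1 * x) with x by ring;
  rewrite ?Ropp_involutive, ?cos_neg, ?sin_neg; field.
Qed.

Lemma Ccos_coords (z : C) :
  Ccos z = (cos (Re z) * cosh (Im z), - (sin (Re z) * sinh (Im z))).
Proof.
  destruct z as [x y]. unfold Ccos, Cexp, Ci, cosh, sinh.
  apply C_eq; simpl; rewrite ?Ropp_involutive;
  replace (0 * x - 1 * y) with (- y) by ring;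
  replace (0 * y + 1 * x) with x by ring;
  rewrite ?Ropp_involutive, ?cos_neg, ?sin_neg; field.
Qed.

Lemma cos_sq (x : R) : cos x ^ 2 = 1 - sin x ^ 2.
Proof. assert (H := sin2_cos2 x). unfold Rsqr in H. lra. Qed.

Lemma Cmod_sq (z : C) : Cmod z ^ 2 = Re z ^ 2 + Im z ^ 2.
Proof.
  unfold Cmod. rewrite pow2_sqrt; [reflexivity|].
  assert (X := pow2_ge_0 (fst z)). assert (X' := pow2_ge_0 (snd z)). lra.
Qed.

Lemma Cmod_Csin_sq (z : C) : Cmod (Csin z) ^ 2 = sin_norm2 (Re z) (Im z).
Proof.
  rewrite Cmod_sq, Csin_coords. simpl Re. simpl Im.
  rewrite !Rpow_mult_distr, cos_sq, cosh_sinh_sq. unfold sin_norm2. ring.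
Qed.

Lemma sin_norm2_nonneg (x y : R) : 0 <= sin_norm2 x y.
Proof.
  unfold sin_norm2. assert (X := pow2_ge_0 (sin x)).
  assert (X' := pow2_ge_0 (sinh y)). lra.
Qed.

Lemma ln_Cmod_Csin (z : C) :
  0 < sin_norm2 (Re z) (Im z) ->
  ln (Cmod (Csin z)) = ln (sin_norm2 (Re z) (Im z)) / 2.
Proof.
  intros H. rewrite <- Cmod_Csin_sq in *.
  assert (H0 := Cmod_ge_0 (Csin z)). assert (0 < Cmod (Csin z)) by nra.
  replace (Cmod (Csin z) ^ 2) with (Cmod (Csin z) * Cmod (Csin z)) by ring.
  rewrite ln_mult by assumption. field.
Qed.

Lemma Csin_neq_0 (z : C) : 0 < sin_norm2 (Re z) (Im z) -> Csin z <> 0%C.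
Proof.
  intros H H0. rewrite <- Cmod_Csin_sq, H0, Cmod_0 in H. lra.
Qed.

Lemma Ccot_coords (z : C) :
  0 < sin_norm2 (Re z) (Im z) ->
  Ccot z = (sin (Re z) * cos (Re z) * / sin_norm2 (Re z) (Im z),
            - (sinh (Im z) * cosh (Im z) * / sin_norm2 (Re z) (Im z))).
Proof.
  intros H. assert (Hs := Csin_neq_0 z H).
  set (N := sin_norm2 (Re z) (Im z)) in *.
  match goal with |- _ = ?w => enough (Heq : (w * Csin z)%C = Ccos z)
    by (unfold Ccot; rewrite <- Heq; field; assumption) end.
  rewrite Ccos_coords, Csin_coords.
  destruct z as [x y]. simpl Re in *. simpl Im in *.
  assert (Hc := cosh_sinh_sq y). assert (Hc' := cos_sq x).
  apply C_eq; simpl.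
  - transitivity (cos x * cosh y * N * / N); [|field; lra].
    transitivity (cos x * cosh y * (sin x ^ 2 + sinh y ^ 2) * / N); [ring|reflexivity].
  - transitivity (- (sin x * sinh y) * N * / N); [|field; lra].
    transitivity (sin x * sinh y * (cos x ^ 2 - cosh y ^ 2) * / N); [ring|].
    rewrite Hc, Hc'. unfold N, sin_norm2. ring.
Qed.

(** * Points of the cylinder *)

Lemma sin_norm2_eq_0 (x y : R) :
  sin_norm2 x y = 0 <-> y = 0 /\ exists n : Z, x = IZR n * PI.
Proof.
  unfold sin_norm2.
  assert (X' := pow2_ge_0 (sinh y)). split.
  - intros H. split.
    + apply sinh_eq_0. nra.
    + apply sin_eq_0_0. nra.
  - intros [-> Hn]. apply sin_eq_0_1 in Hn. rewrite Hn, sinh_0. ring.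
Qed.

Lemma cyl_eq_sin_norm2 (z w : C) :
  cyl_eq z w <-> sin_norm2 ((Re z - Re w) / 2) ((Im z - Im w) / 2) = 0.
Proof.
  rewrite sin_norm2_eq_0. unfold cyl_eq. split.
  - intros [n Hn]. apply (f_equal Re) in Hn as H1. apply (f_equal Im) in Hn as H2.
    destruct z, w. simpl in *. split; [lra|]. exists n. lra.
  - intros [H2 [n H1]]. exists n. destruct z, w. apply C_eq; simpl in *; lra.
Qed.

Lemma not_cyl_eq_sin_norm2 (z w : C) :
  ~ cyl_eq z w <-> 0 < sin_norm2 ((Re z - Re w) / 2) ((Im z - Im w) / 2).
Proof.
  rewrite cyl_eq_sin_norm2.
  assert (H := sin_norm2_nonneg ((Re z - Re w) / 2) ((Im z - Im w) / 2)). lra.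
Qed.

(** * Uniqueness of motions *)

Lemma is_derive_C (f : R -> C) (t : R) (l : C) :
  is_derive (V := C_R_NormedModule) f t l <->
  is_derive (fun s => Re (f s)) t (Re l) /\ is_derive (fun s => Im (f s)) t (Im l).
Proof.
  split.
  - intros H. split.
    + apply (filterdiff_comp' (K := R_AbsRing) (U := R_NormedModule)
        (V := prod_NormedModule R_AbsRing R_NormedModule R_NormedModule)
        (W := R_NormedModule) f fst t _ fst H).
      apply filterdiff_linear, is_linear_fst.
    + apply (filterdiff_comp' (K := R_AbsRing) (U := R_NormedModule)
        (V := prod_NormedModule R_AbsRing R_NormedModule R_NormedModule)
        (W := R_NormedModule) f snd t _ snd H).
      apply filterdiff_linear, is_linear_snd.
  - intros [H1 H2].
    apply (is_derive_ext (V := C_R_NormedModule)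
      (fun s => plus (scal (Re (f s)) ((1, 0) : C_R_NormedModule))
                     (scal (Im (f s)) ((0, 1) : C_R_NormedModule)))).
    { intros s. destruct (f s) as [u v]. unfold plus, scal; simpl.
      unfold prod_plus, prod_scal; simpl. unfold plus, scal, mult; simpl.
      unfold mult; simpl. apply C_eq; simpl; ring. }
    replace l with (plus (scal (Re l) ((1, 0) : C_R_NormedModule))
                         (scal (Im l) ((0, 1) : C_R_NormedModule))).
    + apply (is_derive_plus (V := C_R_NormedModule));
      apply (is_derive_scal_l (K := R_AbsRing) (V := C_R_NormedModule)); assumption.
    + destruct l as [u v]. unfold plus, scal; simpl.
      unfold prod_plus, prod_scal; simpl. unfold plus, scal, mult; simpl.
      unfold mult; simpl. apply C_eq; simpl; ring.
Qed.

Lemma Cmod_Csin_le (w : C) : Cmod (Csin w) ^ 2 <= Cmod w ^ 2 * cosh (Im w) ^ 2.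
Proof.
  rewrite Cmod_Csin_sq, Cmod_sq. destruct w as [x y]. simpl Re; simpl Im.
  unfold sin_norm2.
  assert (Hgen : forall g g' v, (forall u, is_derive g u (g' u)) -> g 0 = 0 ->
    exists c, Rabs c <= Rabs v /\ g v = g' c * v).
  { intros g g' v Hg Hg0. destruct (Rtotal_order 0 v) as [Hv|[<-|Hv]].
    - destruct (mvt g g' 0 v Hv) as [c [Hc Heq]]; [auto|]. exists c.
      split; [rewrite !Rabs_right; lra|]. lra.
    - exists 0. split; [lra|]. lra.
    - destruct (mvt g g' v 0 Hv) as [c [Hc Heq]]; [auto|]. exists c.
      split; [rewrite !Rabs_left1; lra|]. lra. }
  destruct (Hgen sin cos x is_derive_sin sin_0) as [c [_ ->]].
  destruct (Hgen sinh cosh y is_derive_sinh sinh_0) as [c' [Hc' ->]].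
  rewrite !Rpow_mult_distr.
  assert (H1 : cosh c' ^ 2 <= cosh y ^ 2).
  { rewrite !cosh_sinh_sq. apply Rplus_le_compat_l.
    rewrite <- (sinh_sq_even y). now apply sinh_sq_le. }
  assert (H2 : cos c ^ 2 <= 1).
  { rewrite cos_sq. assert (X := pow2_ge_0 (sin c)). lra. }
  assert (H3 : 1 <= cosh y ^ 2).
  { rewrite cosh_sinh_sq. assert (X := pow2_ge_0 (sinh y)). lra. }
   assert (X' := pow2_ge_0 y). nra.
Qed.

Lemma Ccot_minus (z w : C) :
  Csin z <> 0%C -> Csin w <> 0%C ->
  (Ccot z - Ccot w = Csin (w - z) / (Csin z * Csin w))%C.
Proof.
  intros Hz Hw.
  assert (H : Csin (w - z)%C = (Csin w * Ccos z - Ccos w * Csin z)%C).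
  { rewrite !Csin_coords, !Ccos_coords. destruct z as [x y], w as [u v].
    apply C_eq; simpl;
    change (u + - x) with (u - x); change (v + - y) with (v - y);
    rewrite ?sin_minus, ?cos_minus, ?sinh_minus, ?cosh_minus; ring. }
  rewrite H. unfold Ccot. field. split; assumption.
Qed.

Lemma ex_derive_cot_quotient (u v w z : R -> R) (t : R) :
  ex_derive u t -> ex_derive v t -> ex_derive w t -> ex_derive z t ->
  sin_norm2 (u t) (v t) * sin_norm2 (w t) (z t) <> 0 ->
  ex_derive (fun s => cosh (z s - v s) ^ 2
    / (sin_norm2 (u s) (v s) * sin_norm2 (w s) (z s))) t.
Proof.
  intros Hu Hv Hw Hz H0. unfold sin_norm2 in *. auto_derive. tauto.
Qed.

(** In [cot z - cot w = sin (w - z) / (sin z * sin w)] the denominator is bounded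
    below along the curves on compact time intervals, by continuity. *)
Lemma Ccot_lipschitz_along (a b : R -> C) (T : R) :
  (forall t, ex_derive (fun s => Re (a s)) t /\ ex_derive (fun s => Im (a s)) t) ->
  (forall t, ex_derive (fun s => Re (b s)) t /\ ex_derive (fun s => Im (b s)) t) ->
  (forall t, 0 < sin_norm2 (Re (a t)) (Im (a t))) ->
  (forall t, 0 < sin_norm2 (Re (b t)) (Im (b t))) ->
  exists K, 0 <= K /\ forall t, Rabs t <= T ->
    Cmod (Ccot (a t) - Ccot (b t)) <= K * Cmod (a t - b t).
Proof.
  intros Ha Hb Na Nb.
  set (mu := fun t => cosh (Im (b t) - Im (a t)) ^ 2
    / (sin_norm2 (Re (a t)) (Im (a t)) * sin_norm2 (Re (b t)) (Im (b t)))).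
  assert (Hmu : forall t, continuous mu t).
  { intros t. apply (ex_derive_continuous (V := R_NormedModule)).
    destruct (Ha t) as [A1 A2], (Hb t) as [B1 B2].
    specialize (Na t). specialize (Nb t).
    apply (ex_derive_cot_quotient (fun s => Re (a s)) (fun s => Im (a s))
      (fun s => Re (b s)) (fun s => Im (b s))); try assumption.
    apply Rmult_integral_contrapositive_currified; lra. }
  destruct (Rle_or_lt 0 T) as [HT|HT].
  2:{ exists 0. split; [lra|]. intros t Ht. assert (X := Rabs_pos t). lra. }
  destruct (continuity_ab_maj mu (- T) T) as [v0 [Hv0 _]]; [lra| |].
  { intros c _. apply continuity_pt_filterlim, Hmu. }
  assert (Hpos : 0 <= mu v0).
  { unfold mu. apply Rmult_le_pos; [apply pow2_ge_0|].
    left. apply Rinv_0_lt_compat, Rmult_lt_0_compat; auto. }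
  exists (mu v0 + 1). split; [lra|]. intros t Ht.
  apply Rabs_le_between in Ht. specialize (Hv0 t Ht).
  assert (Sa := Csin_neq_0 _ (Na t)). assert (Sb := Csin_neq_0 _ (Nb t)).
  rewrite Ccot_minus by assumption.
  assert (Hd : Cmod (Csin (b t - a t)) ^ 2
     <= Cmod (a t - b t) ^ 2 * cosh (Im (b t) - Im (a t)) ^ 2).
  { eapply Rle_trans; [apply Cmod_Csin_le|].
    replace (Cmod (a t - b t)) with (Cmod (b t - a t))
      by (rewrite <- Cmod_opp; f_equal; ring).
    right. f_equal. }
  rewrite Cmod_div by (now apply Cmult_neq_0). rewrite Cmod_mult.
  set (s := Cmod (Csin (b t - a t))) in *. set (d := Cmod (a t - b t)) in *.
  assert (d0 : 0 <= d) by apply Cmod_ge_0.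
  assert (Pa : 0 < Cmod (Csin (a t))) by (now apply Cmod_gt_0).
  assert (Pb : 0 < Cmod (Csin (b t))) by (now apply Cmod_gt_0).
  unfold mu in Hv0 at 1. rewrite <- !Cmod_Csin_sq in Hv0.
  set (p := Cmod (Csin (a t))) in *. set (q := Cmod (Csin (b t))) in *.
  set (c2 := cosh (Im (b t) - Im (a t)) ^ 2) in *.
  assert (Hpq : 0 < p * q) by (now apply Rmult_lt_0_compat).
  apply Rsqr_incr_0_var; [|apply Rmult_le_pos; lra]. unfold Rsqr.
  apply (Rle_trans _ (d ^ 2 * mu v0)); [|assert (X := pow2_ge_0 d); nra].
  apply (Rle_trans _ (d ^ 2 * (c2 / (p ^ 2 * q ^ 2))));
    [|apply Rmult_le_compat_l; [apply pow2_ge_0|assumption]].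
  replace (s / (p * q) * (s / (p * q))) with (s ^ 2 * / (p ^ 2 * q ^ 2)) by (field; lra).
  unfold Rdiv. rewrite <- Rmult_assoc. apply Rmult_le_compat_r; [|assumption].
  left. apply Rinv_0_lt_compat. nra.
Qed.

(** The argument of the cotangent in the equations of motion. *)
Definition half_conj (z w : C) : C := ((Cconj z - Cconj w) / 2)%C.

Lemma half_conj_coords (z w : C) :
  half_conj z w = ((Re z - Re w) / 2, - ((Im z - Im w) / 2)).
Proof. destruct z, w. apply C_eq; simpl; field. Qed.

Lemma sin_norm2_opp (x y : R) : sin_norm2 (- x) y = sin_norm2 x y.
Proof. unfold sin_norm2. rewrite sin_neg. ring. Qed.

Lemma sin_norm2_opp_r (x y : R) : sin_norm2 x (- y) = sin_norm2 x y.
Proof. unfold sin_norm2. rewrite sinh_opp. ring. Qed.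

Lemma half_conj_pos (z w : C) :
  ~ cyl_eq z w -> 0 < sin_norm2 (Re (half_conj z w)) (Im (half_conj z w)).
Proof.
  rewrite not_cyl_eq_sin_norm2, half_conj_coords. simpl Re. simpl Im.
  now rewrite sin_norm2_opp_r.
Qed.

Lemma in_others (N k l : nat) : In l (others N k) -> (l < N)%nat /\ l <> k.
Proof.
  unfold others. rewrite filter_In, in_seq. intros [H1 H2]. split; [lia|].
  intros ->. now rewrite Nat.eqb_refl in H2.
Qed.

Lemma motion_pair_derivable (N : nat) (G : nat -> R) (z : R -> nat -> C) (k l : nat) :
  motion N G z -> (k < N)%nat -> (l < N)%nat -> forall t,
  ex_derive (fun s => Re (half_conj (z s k) (z s l))) t /\
  ex_derive (fun s => Im (half_conj (z s k) (z s l))) t.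
Proof.
  intros Hz Hk Hl t. destruct (Hz t) as [_ Hd].
  destruct (proj1 (is_derive_C _ _ _) (Hd k Hk)) as [K1 K2].
  destruct (proj1 (is_derive_C _ _ _) (Hd l Hl)) as [L1 L2].
  assert (H : forall c (u v : R -> R), ex_derive u t -> ex_derive v t ->
    ex_derive (fun s => c * ((u s - v s) / 2)) t)
    by (intros c u v Hu Hv; auto_derive; repeat split; assumption).
  split.
  - apply ex_derive_ext with (f := fun s => 1 * ((Re (z s k) - Re (z s l)) / 2)).
    + intros s. rewrite half_conj_coords. apply Rmult_1_l.
    + apply (H 1 (fun s => Re (z s k)) (fun s => Re (z s l))); eexists; eassumption.
  - apply ex_derive_ext with (f := fun s => - 1 * ((Im (z s k) - Im (z s l)) / 2)).
    + intros s. rewrite half_conj_coords. exact (eq_trans (Ropp_mult_distr_l_reverse _ _) (f_equal Ropp (Rmult_1_l _))).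
    + apply (H (- 1) (fun s => Im (z s k)) (fun s => Im (z s l))); eexists; eassumption.
Qed.

(** The sum runs over a list rather than over all [k < N], for induction. *)
Definition distance2 (ks : list nat) (z w : nat -> C) : R :=
  fold_right Rplus 0 (map (fun k => Cmod (z k - w k) ^ 2) ks).

Lemma distance2_cons (k : nat) (ks : list nat) (z w : nat -> C) :
  distance2 (k :: ks) z w = Cmod (z k - w k) ^ 2 + distance2 ks z w.
Proof. reflexivity. Qed.

Lemma distance2_nonneg (ks : list nat) (z w : nat -> C) : 0 <= distance2 ks z w.
Proof.
  induction ks as [|k ks IH]; [apply Rle_refl|]. rewrite distance2_cons.
  assert (H := pow2_ge_0 (Cmod (z k - w k))). lra.
Qed.

Lemma distance2_ge (ks : list nat) (z w : nat -> C) (k : nat) :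
  In k ks -> Cmod (z k - w k) ^ 2 <= distance2 ks z w.
Proof.
  induction ks as [|j ks IH]; [intros []|]. rewrite distance2_cons.
  assert (H := distance2_nonneg ks z w).
  assert (H' := pow2_ge_0 (Cmod (z j - w j))).
  intros [->|Hin]; [lra|]. specialize (IH Hin). lra.
Qed.

Lemma velocity_lipschitz_along (N : nat) (G : nat -> R) (z w : R -> nat -> C)
    (T : R) (k : nat) :
  motion N G z -> motion N G w -> (k < N)%nat ->
  exists L, 0 <= L /\ forall t, Rabs t <= T ->
    Cmod (velocity N G (z t) k - velocity N G (w t) k)
      <= L * sqrt (distance2 (seq 0 N) (z t) (w t)).
Proof.
  intros Hz Hw Hk.
  set (E := fun t => distance2 (seq 0 N) (z t) (w t)).
  assert (HE : forall t l, (l < N)%nat -> Cmod (z t l - w t l) <= sqrt (E t)).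
  { intros t l Hl. rewrite <- (sqrt_pow2 (Cmod (z t l - w t l))) by apply Cmod_ge_0.
    apply sqrt_le_1_alt, (distance2_ge _ _ _ l). apply in_seq. lia. }
  set (term := fun (v : nat -> C) l =>
    (RtoC (G l) * Ccot (half_conj (v k) (v l)))%C).
  assert (Hsum : forall ls, incl ls (others N k) -> exists L, 0 <= L /\
    forall t, Rabs t <= T ->
      Cmod (fold_right Cplus (RtoC 0) (map (term (z t)) ls)
            - fold_right Cplus (RtoC 0) (map (term (w t)) ls)) <= L * sqrt (E t)).
  { induction ls as [|l ls IH]; intros Hincl.
    - exists 0. split; [lra|]. intros t _. simpl.
      replace (0 - 0)%C with (RtoC 0) by ring. rewrite Cmod_0. lra.
    - destruct IH as [L [L0 HL]]; [intros j Hj; apply Hincl; now right|].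
      destruct (in_others N k l (Hincl l (or_introl eq_refl))) as [Hl Hlk].
      destruct (Ccot_lipschitz_along (fun t => half_conj (z t k) (z t l))
        (fun t => half_conj (w t k) (w t l)) T) as [K [K0 HK]].
      + now apply (motion_pair_derivable N G).
      + now apply (motion_pair_derivable N G).
      + intros t. apply half_conj_pos, (Hz t); auto.
      + intros t. apply half_conj_pos, (Hw t); auto.
      + exists (Rabs (G l) * K + L).
        assert (GK : 0 <= Rabs (G l) * K)
          by (apply Rmult_le_pos; [apply Rabs_pos|assumption]).
        split; [lra|]. intros t Ht. specialize (HL t Ht). specialize (HK t Ht).
        simpl map. simpl fold_right.
        match goal with |- Cmod (?a + ?b - (?c + ?d)) <= _ =>
          replace (a + b - (c + d))%C with ((a - c) + (b - d))%C by ring end.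
        eapply Rle_trans; [apply Cmod_triangle|].
        rewrite Rmult_plus_distr_r. apply Rplus_le_compat; [|exact HL].
        unfold term.
        replace (RtoC (G l) * Ccot (half_conj (z t k) (z t l))
          - RtoC (G l) * Ccot (half_conj (w t k) (w t l)))%C
          with (RtoC (G l) * (Ccot (half_conj (z t k) (z t l))
          - Ccot (half_conj (w t k) (w t l))))%C by ring.
        rewrite Cmod_mult, Cmod_R, Rmult_assoc.
        apply Rmult_le_compat_l; [apply Rabs_pos|].
        eapply Rle_trans; [exact HK|]. apply Rmult_le_compat_l; [assumption|].
        assert (Hh : (half_conj (z t k) (z t l) - half_conj (w t k) (w t l)
          = Cconj ((z t k - w t k) - (z t l - w t l)) / 2)%C).
        { rewrite !half_conj_coords.
          destruct (z t k), (z t l), (w t k), (w t l). apply C_eq; simpl; field. }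
        rewrite Hh, Cmod_div by (intros X; injection X; lra).
        rewrite Cmod_conj, Cmod_R, (Rabs_right 2) by lra.
        assert (A := Cmod_triangle (z t k - w t k) (- (z t l - w t l))).
        rewrite Cmod_opp in A.
        assert (A1 := HE t k Hk). assert (A2 := HE t l Hl).
        unfold Cminus at 1. lra. }
  destruct (Hsum (others N k) (incl_refl _)) as [L [L0 HL]].
  exists (Cmod (Ci / RtoC (4 * PI)) * L).
  split; [apply Rmult_le_pos; [apply Cmod_ge_0|assumption]|].
  intros t Ht. specialize (HL t Ht). unfold velocity.
  match goal with |- Cmod (?c * ?a - ?c * ?b) <= _ =>
    replace (c * a - c * b)%C with (c * (a - b))%C by ring end.
  rewrite Cmod_mult, Rmult_assoc. apply Rmult_le_compat_l; [apply Cmod_ge_0|].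
  exact HL.
Qed.

(** On every compact time interval the squared distance of the two motions
    satisfies a linear differential inequality, with a constant depending on the
    interval and on the motions. *)
Lemma motion_unique (N : nat) (G : nat -> R) (z w : R -> nat -> C) :
  motion N G z -> motion N G w ->
  (forall k, (k < N)%nat -> z 0 k = w 0 k) ->
  forall t k, (k < N)%nat -> z t k = w t k.
Proof.
  intros Hz Hw H0.
  set (dE := fun k t => 2 * (Re (z t k - w t k) * Re (velocity N G (z t) k - velocity N G (w t) k)
     + Im (z t k - w t k) * Im (velocity N G (z t) k - velocity N G (w t) k))).
  set (E := fun t => distance2 (seq 0 N) (z t) (w t)).
  assert (E0 : E 0 = 0).
  { assert (X : forall ks, incl ks (seq 0 N) -> distance2 ks (z 0) (w 0) = 0).
    { induction ks as [|k ks IH]; intros Hk; [reflexivity|].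
      rewrite distance2_cons, IH by (intros j Hj; apply Hk; now right).
      assert (Hin := Hk k (or_introl eq_refl)). apply in_seq in Hin.
      rewrite H0 by lia. replace (w 0 k - w 0 k)%C with (RtoC 0) by ring.
      rewrite Cmod_0. ring. }
    apply X, incl_refl. }
  assert (Hder : forall ks, incl ks (seq 0 N) -> forall t,
    is_derive (fun t => distance2 ks (z t) (w t)) t
      (fold_right Rplus 0 (map (fun k => dE k t) ks))).
  { induction ks as [|k ks IH]; intros Hk t.
    - change (is_derive (fun _ : R => 0) t 0).
      apply (is_derive_const (V := R_NormedModule) 0).
    - assert (Hin := Hk k (or_introl eq_refl)). apply in_seq in Hin.
      specialize (IH ltac:(intros j Hj; apply Hk; now right) t).
      apply (is_derive_plus (V := R_NormedModule)
        (fun t => Cmod (z t k - w t k) ^ 2) _ t (dE k t)); [|exact IH].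
      destruct (proj1 (is_derive_C _ _ _) (proj2 (Hz t) k ltac:(lia))) as [Z1 Z2].
      destruct (proj1 (is_derive_C _ _ _) (proj2 (Hw t) k ltac:(lia))) as [W1 W2].
      apply (is_derive_ext (fun t => (Re (z t k) - Re (w t k)) ^ 2
        + (Im (z t k) - Im (w t k)) ^ 2)).
      { intros s. rewrite Cmod_sq. reflexivity. }
      assert (X : forall (u v u' v' : R -> R) du dv du' dv', is_derive u t du ->
        is_derive v t dv -> is_derive u' t du' -> is_derive v' t dv' ->
        is_derive (fun s => (u s - u' s) ^ 2 + (v s - v' s) ^ 2) t
          (2 * ((u t - u' t) * (du - du') + (v t - v' t) * (dv - dv')))).
      { intros u v u' v' du dv du' dv' Hu Hv Hu' Hv'. auto_derive.
        - repeat split; eexists; eassumption.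
        - known_derivatives. ring. }
      exact (X _ _ _ _ _ _ _ _ Z1 Z2 W1 W2). }
  assert (HL : forall T, exists L, forall t, Rabs t <= T ->
    Rabs (fold_right Rplus 0 (map (fun k => dE k t) (seq 0 N))) <= L * E t).
  { intros T.
    assert (X : forall ks, incl ks (seq 0 N) -> exists L, forall t, Rabs t <= T ->
      Rabs (fold_right Rplus 0 (map (fun k => dE k t) ks)) <= L * E t).
    { induction ks as [|k ks IH]; intros Hk.
      - exists 0. intros t _. simpl. rewrite Rabs_R0. lra.
      - assert (Hin := Hk k (or_introl eq_refl)).
        destruct (IH ltac:(intros j Hj; apply Hk; now right)) as [L HL].
        destruct (velocity_lipschitz_along N G z w T k Hz Hw) as [L' [L'0 HL']];
          [apply in_seq in Hin; lia|].
        exists (2 * L' + L). intros t Ht. specialize (HL t Ht). specialize (HL' t Ht).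
        simpl map. simpl fold_right. eapply Rle_trans; [apply Rabs_triang|].
        rewrite Rmult_plus_distr_r. apply Rplus_le_compat; [|exact HL].
        fold (E t) in HL'.
        assert (Hd : Cmod (z t k - w t k) <= sqrt (E t)).
        { rewrite <- (sqrt_pow2 (Cmod (z t k - w t k))) by apply Cmod_ge_0.
          apply sqrt_le_1_alt, (distance2_ge _ _ _ k), Hin. }
        assert (Hcs : forall a c : C,
          Rabs (Re a * Re c + Im a * Im c) <= Cmod a * Cmod c).
        { intros a c.
          rewrite <- (Rabs_right (Cmod a * Cmod c))
            by (apply Rle_ge, Rmult_le_pos; apply Cmod_ge_0).
          apply Rsqr_le_abs_0. unfold Rsqr.
          replace (Cmod a * Cmod c * (Cmod a * Cmod c))
            with (Cmod a ^ 2 * Cmod c ^ 2) by ring.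
          rewrite !Cmod_sq. assert (X := pow2_ge_0 (Re a * Im c - Im a * Re c)). nra. }
        unfold dE. rewrite Rabs_mult, Rabs_right by lra. rewrite Rmult_assoc.
        apply Rmult_le_compat_l; [lra|]. eapply Rle_trans; [apply Hcs|].
        assert (HE := distance2_nonneg (seq 0 N) (z t) (w t)). fold (E t) in HE.
        replace (L' * E t) with (sqrt (E t) * (L' * sqrt (E t)))
          by (transitivity (L' * (sqrt (E t) * sqrt (E t))); [ring|now rewrite sqrt_sqrt]).
        apply Rmult_le_compat; try apply Cmod_ge_0; assumption. }
    apply X, incl_refl. }
  intros t k Hk. destruct (HL (Rabs t)) as [L HLt].
  assert (Et : E t = 0).
  { apply (gronwall_zero E _ (Rabs t) L (fun s => Hder _ (incl_refl _) s)
      (fun s => distance2_nonneg _ _ _) E0 HLt t (Rle_refl _)). }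
  assert (Hd := distance2_ge (seq 0 N) (z t) (w t) k ltac:(apply in_seq; lia)).
  fold (E t) in Hd. rewrite Et in Hd.
  assert (Hm : Cmod (z t k - w t k) = 0).
  { nra. }
  apply Cmod_eq_0 in Hm.
  replace (z t k) with ((z t k - w t k) + w t k)%C by ring. rewrite Hm. ring.
Qed.

(** * From the vortices to the reduced system *)

(** The configuration [conf4] in coordinates.  Its weights [2 * G' / (G + G')] and
    [2 * G / (G + G')] are [1 + m] and [1 - m]; for [b = 0] it is linear in [(x, y)]
    and also describes velocities. *)
Definition placed (b m x y : R) (k : nat) : C :=
  match k with
  | 0%nat => ((1 + m) * x, b + (1 + m) * y)
  | 1%nat => (- ((1 - m) * x), b - (1 - m) * y)
  | 2%nat => (- ((1 - m) * x), - b + (1 - m) * y)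
  | _ => ((1 + m) * x, - b - (1 + m) * y)
  end.

(** Velocity of the horizontal translation that accompanies the reduced motion. *)
Definition drift (kap b m x y : R) : R :=
  kap * (2 * (1 - m ^ 2) * (sinh (b + m * y) * cosh (b + m * y)) * / gap2 b m x y
    + (1 - m) ^ 2 * (cosh (b + m * y + y) * sinh (b + m * y + y)) * / gap3 b m y
    + (1 + m) ^ 2 * (cosh (b + m * y - y) * sinh (b + m * y - y)) * / gap4 b m y).

Lemma placed_affine (b m : R) (k : nat) : exists p q r, forall x y,
  placed b m x y k = (p * x, q + r * y) /\ placed 0 m x y k = (p * x, r * y).
Proof.
  destruct k as [|[|[|k]]].
  - exists (1 + m), b, (1 + m). split; apply C_eq; simpl; ring.
  - exists (- (1 - m)), b, (- (1 - m)). split; apply C_eq; simpl; ring.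
  - exists (- (1 - m)), (- b), (1 - m). split; apply C_eq; simpl; ring.
  - exists (1 + m), (- b), (- (1 + m)). split; apply C_eq; simpl; ring.
Qed.

Lemma conf4_placed (b m S : R) (zeta : C) (k : nat) : S <> 0 ->
  conf4 b (S * (1 - m) / 2) (S * (1 + m) / 2) zeta k
  = placed b m (Re zeta) (Im zeta) k.
Proof.
  intros HS. unfold conf4, placed.
  replace (2 * (S * (1 + m) / 2) / (S * (1 - m) / 2 + S * (1 + m) / 2)) with (1 + m)
    by (field; replace (S * (1 - m) + S * (1 + m)) with (2 * S) by ring; lra).
  replace (2 * (S * (1 - m) / 2) / (S * (1 - m) / 2 + S * (1 + m) / 2)) with (1 - m)
    by (field; replace (S * (1 - m) + S * (1 + m)) with (2 * S) by ring; lra).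
  destruct zeta as [x y].
  destruct k as [|[|[|k]]]; apply C_eq; simpl; ring.
Qed.

Lemma no_collision_placed (b m x y c : R) (z : nat -> C) :
  (forall k, (k < 4)%nat -> z k = (placed b m x y k + RtoC c)%C) ->
  no_collision 4 z <-> regular b m x y.
Proof.
  intros Hz.
  assert (N : forall k l X Y, (k < 4)%nat -> (l < 4)%nat ->
    (Re (placed b m x y k) - Re (placed b m x y l)) / 2 = X ->
    (Im (placed b m x y k) - Im (placed b m x y l)) / 2 = Y ->
    (~ cyl_eq (z k) (z l) <-> 0 < sin_norm2 X Y)).
  { intros k l X Y Hk Hl HX HY. rewrite not_cyl_eq_sin_norm2, !Hz by assumption.
    rewrite <- HX, <- HY.
    replace (Re (placed b m x y k + RtoC c) - Re (placed b m x y l + RtoC c))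
      with (Re (placed b m x y k) - Re (placed b m x y l)) by (destruct (placed b m x y k), (placed b m x y l); simpl; ring).
    replace (Im (placed b m x y k + RtoC c) - Im (placed b m x y l + RtoC c))
      with (Im (placed b m x y k) - Im (placed b m x y l)) by (destruct (placed b m x y k), (placed b m x y l); simpl; ring).
    reflexivity. }
  assert (Nsym : forall k l, ~ cyl_eq (z k) (z l) -> ~ cyl_eq (z l) (z k)).
  { intros k l. rewrite !not_cyl_eq_sin_norm2.
    replace ((Re (z l) - Re (z k)) / 2) with (- ((Re (z k) - Re (z l)) / 2)) by field.
    replace ((Im (z l) - Im (z k)) / 2) with (- ((Im (z k) - Im (z l)) / 2)) by field.
    now rewrite sin_norm2_opp, sin_norm2_opp_r. }
  assert (S0 : forall v, sin_norm2 0 v = sinh v ^ 2).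
  { intros v. unfold sin_norm2. rewrite sin_0. ring. }
  assert (N01 := N 0%nat 1%nat x y ltac:(lia) ltac:(lia)
    ltac:(simpl; field) ltac:(simpl; field)).
  assert (N02 := N 0%nat 2%nat x (b + m * y) ltac:(lia) ltac:(lia)
    ltac:(simpl; field) ltac:(simpl; field)).
  assert (N03 := N 0%nat 3%nat 0 (b + m * y + y) ltac:(lia) ltac:(lia)
    ltac:(simpl; field) ltac:(simpl; field)).
  assert (N12 := N 1%nat 2%nat 0 (b + m * y - y) ltac:(lia) ltac:(lia)
    ltac:(simpl; field) ltac:(simpl; field)).
  assert (N13 := N 1%nat 3%nat (- x) (b + m * y) ltac:(lia) ltac:(lia)
    ltac:(simpl; field) ltac:(simpl; field)).
  assert (N23 := N 2%nat 3%nat (- x) y ltac:(lia) ltac:(lia)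
    ltac:(simpl; field) ltac:(simpl; field)).
  rewrite S0 in N03, N12. rewrite sin_norm2_opp in N13, N23.
  unfold regular, gap1, gap2, gap3, gap4. split.
  - intros Hn. repeat split.
    + apply N01, Hn; lia.
    + apply N02, Hn; lia.
    + apply N03, Hn; lia.
    + apply N12, Hn; lia.
  - intros (H1 & H2 & H3 & H4) k l Hk Hl Hkl.
    destruct k as [|[|[|[|k]]]]; try lia; destruct l as [|[|[|[|l]]]]; try lia; try tauto;
    apply Nsym; tauto.
Qed.

Lemma admissible_regular (b m S : R) (zeta : C) : S <> 0 ->
  admissible b (S * (1 - m) / 2) (S * (1 + m) / 2) zeta
  <-> regular b m (Re zeta) (Im zeta).
Proof.
  intros HS. apply (no_collision_placed b m (Re zeta) (Im zeta) 0).
  intros k _. rewrite conf4_placed by assumption. ring.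
Qed.

Lemma ham4_energy (b m S : R) (zeta : C) : S <> 0 -> regular b m (Re zeta) (Im zeta) ->
  ham4 b (S * (1 - m) / 2) (S * (1 + m) / 2) zeta
  = - (S ^ 2 / (16 * PI)) * energy b m (Re zeta) (Im zeta).
Proof.
  intros HS (H1 & H2 & H3 & H4).
  unfold ham4, hamiltonian.
  assert (S0 : forall v, sin_norm2 0 v = sinh v ^ 2).
  { intros v. unfold sin_norm2. rewrite sin_0. ring. }
  assert (L : forall k l X Y, 
    (Re (placed b m (Re zeta) (Im zeta) k) - Re (placed b m (Re zeta) (Im zeta) l)) / 2 = X ->
    (Im (placed b m (Re zeta) (Im zeta) k) - Im (placed b m (Re zeta) (Im zeta) l)) / 2 = Y ->
    0 < sin_norm2 X Y ->
    ln (Cmod (Csin ((conf4 b (S * (1 - m) / 2) (S * (1 + m) / 2) zeta k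
      - conf4 b (S * (1 - m) / 2) (S * (1 + m) / 2) zeta l) / 2)))
    = ln (sin_norm2 X Y) / 2).
  { intros k l X Y HX HY Hpos. rewrite !conf4_placed by assumption.
    replace ((placed b m (Re zeta) (Im zeta) k - placed b m (Re zeta) (Im zeta) l) / 2)%C
      with ((X, Y) : C).
    - now apply ln_Cmod_Csin.
    - rewrite <- HX, <- HY. destruct (placed b m (Re zeta) (Im zeta) k),
        (placed b m (Re zeta) (Im zeta) l). apply C_eq; simpl; field. }
  set (x := Re zeta) in *. set (y := Im zeta) in *.
  assert (E3 : gap3 b m y = sin_norm2 0 (b + m * y + y)) by (rewrite S0; reflexivity).
  assert (E4 : gap4 b m y = sin_norm2 0 (b + m * y - y)) by (rewrite S0; reflexivity).
  rewrite E3 in H3. rewrite E4 in H4.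
  cbn [seq flat_map map app Nat.sub fold_right].
  rewrite (L 0%nat 1%nat x y ltac:(simpl; field) ltac:(simpl; field)) by assumption.
  rewrite (L 0%nat 2%nat x (b + m * y) ltac:(simpl; field) ltac:(simpl; field)) by assumption.
  rewrite (L 0%nat 3%nat 0 (b + m * y + y) ltac:(simpl; field) ltac:(simpl; field))
    by assumption.
  rewrite (L 1%nat 2%nat 0 (b + m * y - y) ltac:(simpl; field) ltac:(simpl; field))
    by assumption.
  rewrite (L 1%nat 3%nat (- x) (b + m * y) ltac:(simpl; field) ltac:(simpl; field))
    by (rewrite sin_norm2_opp; assumption).
  rewrite (L 2%nat 3%nat (- x) y ltac:(simpl; field) ltac:(simpl; field))
    by (rewrite sin_norm2_opp; assumption).
  rewrite !sin_norm2_opp, <- E3, <- E4.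
  change (sin_norm2 x y) with (gap1 x y).
  change (sin_norm2 x (b + m * y)) with (gap2 b m x y).
  unfold energy, vort4. field. apply PI_neq0.
Qed.

(** Symmetry makes the velocities of the vortices 0 and 3, and of 1 and 2, complex
    conjugate, and conservation of [G * Im z_0 + G' * Im z_1] removes the vertical
    translation; what remains is tangent to the family of configurations, up to a
    horizontal translation. *)
Lemma velocity_placed (b m S x y c : R) (z : nat -> C) :
  regular b m x y ->
  (forall k, (k < 4)%nat -> z k = (placed b m x y k + RtoC c)%C) ->
  let kap := S / (16 * PI) in
  forall k, (k < 4)%nat ->
  velocity 4 (vort4 (S * (1 - m) / 2) (S * (1 + m) / 2)) z k
  = (placed 0 m (field_x kap b m x y) (field_y kap b m x y) k
     + RtoC (drift kap b m x y))%C.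
Proof.
  intros (H1 & H2 & H3 & H4) Hz kap.
  assert (S0 : forall v, sin_norm2 0 v = sinh v ^ 2).
  { intros v. unfold sin_norm2. rewrite sin_0. ring. }
  assert (L : forall k l X Y, (k < 4)%nat -> (l < 4)%nat ->
    (Re (placed b m x y k) - Re (placed b m x y l)) / 2 = X ->
    (Im (placed b m x y k) - Im (placed b m x y l)) / 2 = Y ->
    0 < sin_norm2 X Y ->
    let u := sin X * cos X * / sin_norm2 X Y in
    let v := sinh Y * cosh Y * / sin_norm2 X Y in
    Ccot ((Cconj (z k) - Cconj (z l)) / 2) = (u, v) /\
    Ccot ((Cconj (z l) - Cconj (z k)) / 2) = (- u, - v)).
  { intros k l X Y Hk Hl HX HY Hpos u v.
    fold (half_conj (z k) (z l)) (half_conj (z l) (z k)).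
    assert (Hh : half_conj (z k) (z l) = (X, - Y) /\ half_conj (z l) (z k) = (- X, Y)).
    { rewrite !half_conj_coords, !Hz, <- HX, <- HY by assumption.
      destruct (placed b m x y k), (placed b m x y l). split; apply C_eq; simpl; field. }
    destruct Hh as [-> ->]. unfold u, v.
    split; rewrite Ccot_coords; simpl Re; simpl Im;
    rewrite ?sin_norm2_opp, ?sin_norm2_opp_r; try assumption;
    rewrite ?sinh_opp, ?cosh_opp, ?sin_neg, ?cos_neg; apply C_eq; simpl; ring. }
  assert (E3 : gap3 b m y = sin_norm2 0 (b + m * y + y)) by (rewrite S0; reflexivity).
  assert (E4 : gap4 b m y = sin_norm2 0 (b + m * y - y)) by (rewrite S0; reflexivity).
  rewrite E3 in H3. rewrite E4 in H4.
  destruct (L 0%nat 1%nat x y ltac:(lia) ltac:(lia)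
    ltac:(simpl; field) ltac:(simpl; field) H1) as [L01 L10].
  destruct (L 0%nat 2%nat x (b + m * y) ltac:(lia) ltac:(lia)
    ltac:(simpl; field) ltac:(simpl; field) H2) as [L02 L20].
  destruct (L 0%nat 3%nat 0 (b + m * y + y) ltac:(lia) ltac:(lia)
    ltac:(simpl; field) ltac:(simpl; field) H3) as [L03 L30].
  destruct (L 1%nat 2%nat 0 (b + m * y - y) ltac:(lia) ltac:(lia)
    ltac:(simpl; field) ltac:(simpl; field) H4) as [L12 L21].
  assert (H1' : 0 < sin_norm2 (- x) y) by (rewrite sin_norm2_opp; exact H1).
  assert (H2' : 0 < sin_norm2 (- x) (b + m * y)) by (rewrite sin_norm2_opp; exact H2).
  destruct (L 1%nat 3%nat (- x) (b + m * y) ltac:(lia) ltac:(lia)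
    ltac:(simpl; field) ltac:(simpl; field) H2') as [L13 L31].
  destruct (L 2%nat 3%nat (- x) y ltac:(lia) ltac:(lia)
    ltac:(simpl; field) ltac:(simpl; field) H1') as [L23 L32].
  clear L Hz.
  rewrite <- E3 in L03, L30. rewrite <- E4 in L12, L21.
  rewrite sin_norm2_opp, sin_neg, cos_neg in L13, L23, L31, L32.
  rewrite sin_0 in L03, L30, L12, L21.
  change (sin_norm2 x y) with (gap1 x y) in *.
  change (sin_norm2 x (b + m * y)) with (gap2 b m x y) in *.
  assert (HP := PI_neq0).
  intros k Hk.
  destruct k as [|[|[|[|k]]]]; [| | | |lia]; unfold velocity, others;
  cbn [seq filter Nat.eqb negb map fold_right];
  rewrite ?L01, ?L02, ?L03, ?L10, ?L12, ?L13, ?L20, ?L21, ?L23, ?L30, ?L31, ?L32;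
  unfold field_x, field_y, velocity_x, velocity_y, drift, kap, placed;
  generalize (/ gap1 x y), (/ gap2 b m x y), (/ gap3 b m y), (/ gap4 b m y);
  intros r1 r2 r3 r4; apply C_eq; simpl; field; assumption.
Qed.

(** * Lifting solutions to motions *)

(** With [S = G + G'] and [m = (G' - G) / S]. *)
Definition vort (m S : R) : nat -> R := vort4 (S * (1 - m) / 2) (S * (1 + m) / 2).

Definition follows (b m : R) (x y c : R -> R) (z : R -> nat -> C) : Prop :=
  forall t k, (k < 4)%nat -> z t k = (placed b m (x t) (y t) k + RtoC (c t))%C.

Lemma continuous_drift (kap b m t : R) (x y : R -> R) :
  regular b m (x t) (y t) -> ex_derive x t -> ex_derive y t ->
  continuous (fun s => drift kap b m (x s) (y s)) t.
Proof.
  intros (H1 & H2 & H3 & H4) Hx Hy. apply (ex_derive_continuous (V := R_NormedModule)).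
  unfold drift, gap1, gap2, gap3, gap4, sin_norm2 in *.
  auto_derive. repeat split; try assumption; apply Rgt_not_eq; assumption.
Qed.

Lemma is_derive_placed (b m t dx dy dc : R) (x y c : R -> R) (k : nat) :
  is_derive x t dx -> is_derive y t dy -> is_derive c t dc ->
  is_derive (V := C_R_NormedModule)
    (fun s => (placed b m (x s) (y s) k + RtoC (c s))%C) t
    (placed 0 m dx dy k + RtoC dc)%C.
Proof.
  intros Hx Hy Hc. destruct (placed_affine b m k) as (p & q & r & Hp).
  rewrite (proj2 (Hp _ _)).
  apply (is_derive_ext (V := C_R_NormedModule) (fun s => (p * x s + c s, q + r * y s) : C)).
  { intros s. rewrite (proj1 (Hp _ _)). apply C_eq; simpl; ring. }
  apply is_derive_C. simpl. split; auto_derive; try (repeat split; eexists; eassumption).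
  - known_derivatives. ring.
  - known_derivatives. ring.
Qed.

(** A solution of the reduced system lifts to a motion, since the translational
    velocity [drift] depends on the reduced variables alone. *)
Lemma lift_exists (b m S : R) (x y : R -> R) :
  solution (S / (16 * PI)) b m x y ->
  exists c z, c 0 = 0 /\ motion 4 (vort m S) z /\ follows b m x y c z.
Proof.
  intros Hsol. set (kap := S / (16 * PI)) in *.
  assert (Hc : forall t, continuous (fun s => drift kap b m (x s) (y s)) t).
  { intros t. destruct (Hsol t) as (Hr & Hx & Hy).
    apply continuous_drift; [assumption|eexists; eassumption|eexists; eassumption]. }
  set (c := fun t => RInt (fun s => drift kap b m (x s) (y s)) 0 t).
  exists c, (fun t k => (placed b m (x t) (y t) k + RtoC (c t))%C).
  split; [apply (RInt_point (V := R_CompleteNormedModule))|]. split; [|intros t k _; reflexivity].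
  intros t. destruct (Hsol t) as (Hr & Hx & Hy). split.
  - apply (no_collision_placed b m (x t) (y t) (c t)); [intros; reflexivity|assumption].
  - intros k Hk. unfold vort.
    rewrite (velocity_placed b m S (x t) (y t) (c t)) by (assumption || reflexivity).
    apply is_derive_placed; [assumption|assumption|].
    apply (is_derive_integral (fun s => drift kap b m (x s) (y s))), Hc.
Qed.

Lemma lift_unique (b m S : R) (x y : R -> R) (z : R -> nat -> C) :
  solution (S / (16 * PI)) b m x y -> motion 4 (vort m S) z ->
  (forall k, (k < 4)%nat -> z 0 k = placed b m (x 0) (y 0) k) ->
  exists c, follows b m x y c z.
Proof.
  intros Hsol Hz H0. destruct (lift_exists b m S x y Hsol) as (c & w & c0 & Hw & Hf).
  exists c. intros t k Hk. rewrite <- Hf by assumption.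
  apply (motion_unique 4 (vort m S) z w Hz Hw); [|assumption].
  intros j Hj. rewrite H0, Hf, c0 by assumption. ring.
Qed.

Lemma placed_inj (b m x y c x' y' c' : R) :
  (forall k, (k < 4)%nat ->
    (placed b m x y k + RtoC c)%C = (placed b m x' y' k + RtoC c')%C) ->
  x = x' /\ y = y'.
Proof.
  intros H. assert (H0 := H 0%nat ltac:(lia)). assert (H1 := H 1%nat ltac:(lia)).
  simpl in H0, H1.
  assert (A0 := f_equal Re H0). assert (A1 := f_equal Re H1).
  assert (B0 := f_equal Im H0). assert (B1 := f_equal Im H1).
  simpl in *. split; lra.
Qed.

Lemma solution_shift (kap b m t0 : R) (x y : R -> R) :
  solution kap b m x y -> solution kap b m (fun t => x (t0 + t)) (fun t => y (t0 + t)).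
Proof.
  intros H t. destruct (H (t0 + t)) as (Hr & Hx & Hy). split; [assumption|].
  assert (X : forall (f : R -> R) l, is_derive f (t0 + t) l ->
    is_derive (fun s => f (t0 + s)) t l).
  { intros f l Hf. auto_derive; [eexists; eassumption|].
    known_derivatives. ring. }
  split; now apply X.
Qed.

(** Inherited from the uniqueness of the motions to which solutions lift. *)
Lemma solution_unique (S b m t0 : R) (x y x' y' : R -> R) :
  solution (S / (16 * PI)) b m x y -> solution (S / (16 * PI)) b m x' y' ->
  x t0 = x' t0 -> y t0 = y' t0 -> forall t, x t = x' t /\ y t = y' t.
Proof.
  intros H H' Hx Hy t.
  apply solution_shift with (t0 := t0) in H, H'.
  destruct (lift_exists _ _ _ _ _ H) as (c & z & c0 & Hz & Hf).
  destruct (lift_unique _ _ _ _ _ z H' Hz) as (c' & Hf').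
  { intros k Hk. rewrite (Hf 0 k Hk), c0, Rplus_0_r, <- Hx, <- Hy. ring. }
  destruct (placed_inj b m (x t) (y t) (c (t - t0)) (x' t) (y' t) (c' (t - t0))) as [A B].
  - intros k Hk. replace t with (t0 + (t - t0)) by ring.
    replace (t0 + (t - t0) - t0) with (t - t0) by ring.
    rewrite <- (Hf (t - t0) k Hk). apply (Hf' (t - t0) k Hk).
  - split; assumption.
Qed.

(** All motions released at the configuration are lifts of the same solution, so
    that a property of motions needs to be established for lifts only. *)
Lemma vortices_form_intro (b m S : R) (P : (R -> nat -> C) -> Prop) (x y : R -> R)
    (zeta : C) :
  S <> 0 -> solution (S / (16 * PI)) b m x y -> x 0 = Re zeta -> y 0 = Im zeta ->
  (forall z c, motion 4 (vort m S) z -> follows b m x y c z -> P z) ->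
  vortices_form b (S * (1 - m) / 2) (S * (1 + m) / 2) P zeta.
Proof.
  intros HS Hsol Hx Hy HP. split.
  - destruct (lift_exists _ _ _ _ _ Hsol) as (c & z & c0 & Hz & Hf). exists z.
    split; [assumption|]. intros k Hk.
    rewrite conf4_placed, Hf, c0, Hx, Hy by assumption. ring.
  - intros z Hz H0.
    destruct (lift_unique b m S x y z Hsol Hz) as [c Hc].
    { intros k Hk. rewrite H0, conf4_placed, Hx, Hy by assumption. reflexivity. }
    split; [|now apply (HP z c)].
    exists (fun t => (x t, y t)). split; [apply C_eq; assumption|].
    intros t. exists (RtoC (c t)). intros k Hk.
    rewrite conf4_placed by assumption. now apply Hc.
Qed.

Lemma vortices_form_elim (b m S : R) (P : (R -> nat -> C) -> Prop) (x y : R -> R)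
    (zeta : C) :
  S <> 0 -> solution (S / (16 * PI)) b m x y -> x 0 = Re zeta -> y 0 = Im zeta ->
  vortices_form b (S * (1 - m) / 2) (S * (1 + m) / 2) P zeta ->
  exists z c, motion 4 (vort m S) z /\ follows b m x y c z /\ P z.
Proof.
  intros HS Hsol Hx Hy [[z [Hz H0]] HP].
  destruct (lift_unique b m S x y z Hsol Hz) as [c Hc].
  { intros k Hk. rewrite H0, conf4_placed, Hx, Hy by assumption. reflexivity. }
  exists z, c. split; [assumption|]. split; [assumption|]. now apply HP.
Qed.

(** * Reversibility *)

Lemma sin_cos_half_turns (n : Z) (x : R) :
  sin (IZR n * PI - x) ^ 2 = sin x ^ 2 /\
  sin (IZR n * PI - x) * cos (IZR n * PI - x) = - (sin x * cos x).
Proof.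
  assert (Hs : sin (IZR n * PI) = 0) by (apply sin_eq_0_1; exists n; reflexivity).
  assert (Hc : cos (IZR n * PI) ^ 2 = 1) by (rewrite cos_sq, Hs; ring).
  rewrite sin_minus, cos_minus, Hs. split.
  - replace ((0 * cos x - cos (IZR n * PI) * sin x) ^ 2)
      with (cos (IZR n * PI) ^ 2 * sin x ^ 2) by ring. rewrite Hc. ring.
  - replace ((0 * cos x - cos (IZR n * PI) * sin x) * (cos (IZR n * PI) * cos x + 0 * sin x))
      with (- (cos (IZR n * PI) ^ 2 * (sin x * cos x))) by ring. rewrite Hc. ring.
Qed.

Lemma sin_cos_eq_0 (x : R) : sin x * cos x = 0 <-> exists n : Z, x = IZR n * PI / 2.
Proof.
  split.
  - intros H. destruct (sin_eq_0_0 (2 * x)) as [n Hn]; [rewrite sin_2a; lra|].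
    exists n. lra.
  - intros [n ->]. assert (H : sin (2 * (IZR n * PI / 2)) = 0).
    { apply sin_eq_0_1. exists n. field. }
    rewrite sin_2a in H. lra.
Qed.

Lemma field_eq_of_sin_cos (kap b m x x' y : R) :
  sin x' ^ 2 = sin x ^ 2 -> sin x' * cos x' = - (sin x * cos x) ->
  (regular b m x y -> regular b m x' y) /\
  field_x kap b m x' y = field_x kap b m x y /\
  field_y kap b m x' y = - field_y kap b m x y.
Proof.
  intros H1 H2.
  unfold regular, field_x, field_y, velocity_x, velocity_y, gap1, gap2, gap3, gap4, sin_norm2.
  rewrite H1, H2. split; [|split]; [tauto|reflexivity|ring].
Qed.

Lemma solution_reflect (kap b m t0 : R) (n : Z) (x y : R -> R) :
  solution kap b m x y ->
  solution kap b m (fun t => IZR n * PI - x (2 * t0 - t)) (fun t => y (2 * t0 - t)).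
Proof.
  intros H t. destruct (H (2 * t0 - t)) as (Hr & Hx & Hy).
  destruct (sin_cos_half_turns n (x (2 * t0 - t))) as [E1 E2].
  destruct (field_eq_of_sin_cos kap b m _ _ (y (2 * t0 - t)) E1 E2) as (F1 & F2 & F3).
  rewrite F2, F3. split; [auto|]. split.
  - auto_derive; [eexists; eassumption|].
    known_derivatives. ring.
  - auto_derive; [eexists; eassumption|].
    known_derivatives. ring.
Qed.

(** A solution that is on an axis at time [t0] coincides at [t0] with its reflection
    in this axis, run backwards. *)
Lemma reflection (S b m t0 : R) (n : Z) (x y : R -> R) :
  solution (S / (16 * PI)) b m x y -> x t0 = IZR n * PI / 2 ->
  forall t, x (2 * t0 - t) = IZR n * PI - x t /\ y (2 * t0 - t) = y t.
Proof.
  intros H H0 t.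
  destruct (solution_unique S b m t0 _ _ _ _ H (solution_reflect _ _ _ t0 n _ _ H)) with t
    as [A B].
  - replace (2 * t0 - t0) with t0 by ring. rewrite H0. field.
  - replace (2 * t0 - t0) with t0 by ring. reflexivity.
  - split; [|symmetry; exact B]. rewrite A. ring.
Qed.

(** The composition of two reflections in time is a translation in time, and the
    corresponding reflections in space compose to a translation in space. *)
Lemma periodic_of_two_symmetric_times (S b m t0 t1 : R) (x y : R -> R) :
  solution (S / (16 * PI)) b m x y -> t0 < t1 ->
  sin (x t0) * cos (x t0) = 0 -> sin (x t1) * cos (x t1) = 0 ->
  exists (T : R) (n : Z), 0 < T /\
    forall t, x (t + T) = x t + IZR n * PI /\ y (t + T) = y t.
Proof.
  intros H Ht H0 H1. apply sin_cos_eq_0 in H0, H1.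
  destruct H0 as [k Hk], H1 as [l Hl].
  exists (2 * (t1 - t0)), (l - k)%Z. split; [lra|]. intros t.
  replace (t + 2 * (t1 - t0)) with (2 * t1 - (2 * t0 - t)) by ring.
  destruct (reflection S b m t1 l x y H Hl (2 * t0 - t)) as [-> ->].
  destruct (reflection S b m t0 k x y H Hk t) as [-> ->].
  rewrite minus_IZR. split; [ring|reflexivity].
Qed.

Lemma cyl_eq_translate (z w : C) (n : Z) :
  w = (z + RtoC (2 * PI * IZR n))%C -> cyl_eq w z.
Proof. intros ->. exists n. ring. Qed.

Lemma relative_periodic_of_periodic (b m S T : R) (n : Z) (x y c : R -> R)
    (z : R -> nat -> C) :
  0 < T -> (forall t, x (t + T) = x t + IZR n * PI /\ y (t + T) = y t) ->
  motion 4 (vort m S) z -> follows b m x y c z ->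
  relative_periodic_orbit 4 (vort m S) z.
Proof.
  intros HT Hper Hz Hf. split; [assumption|]. exists T. split; [assumption|].
  intros t. exists (RtoC ((1 + m) * (IZR n * PI) + c (t + T) - c t)). intros k Hk.
  rewrite !Hf by assumption. destruct (Hper t) as [-> ->].
  (* when [x] grows by [n * PI], the vortices 0 and 3 move by [(1 + m) * n * PI], and
     1 and 2 by [- (1 - m) * n * PI], which is less by [2 * n * PI] *)
  destruct k as [|[|[|[|k]]]]; [| | | |lia].
  1, 4 : apply cyl_eq_translate with 0%Z; apply C_eq; simpl; ring.
  all : apply cyl_eq_translate with (- n)%Z; apply C_eq; simpl; rewrite ?opp_IZR; ring.
Qed.

(** * Asymptotic behaviour *)

Definition equilibrium (kap b m x y : R) : Prop :=
  regular b m x y /\ field_x kap b m x y = 0 /\ field_y kap b m x y = 0.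

Lemma pinfty_le (f : R -> R) (l c : R) :
  filterlim f (Rbar_locally p_infty) (locally l) -> (forall t, f t <= c) -> l <= c.
Proof.
  intros Hf Hc. apply Rnot_lt_le. intros H.
  destruct (proj1 (filterlim_p_infty_eps f l) Hf (l - c)) as [M HM]; [lra|].
  specialize (HM (M + 1) ltac:(lra)). specialize (Hc (M + 1)).
  apply Rabs_lt_between in HM. lra.
Qed.

Lemma pinfty_ge (f : R -> R) (l c : R) :
  filterlim f (Rbar_locally p_infty) (locally l) -> (forall t, c <= f t) -> c <= l.
Proof.
  intros Hf Hc. apply Rnot_lt_le. intros H.
  destruct (proj1 (filterlim_p_infty_eps f l) Hf (c - l)) as [M HM]; [lra|].
  specialize (HM (M + 1) ltac:(lra)). specialize (Hc (M + 1)).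
  apply Rabs_lt_between in HM. lra.
Qed.

Lemma pinfty_comp (g f : R -> R) (l : R) :
  filterlim f (Rbar_locally p_infty) (locally l) -> ex_derive g l ->
  filterlim (fun t => g (f t)) (Rbar_locally p_infty) (locally (g l)).
Proof.
  intros Hf Hg. apply (filterlim_comp _ _ _ f g _ (locally l)); [exact Hf|].
  now apply (ex_derive_continuous (V := R_NormedModule) g).
Qed.

Lemma pinfty_plus (f g : R -> R) (l l' : R) :
  filterlim f (Rbar_locally p_infty) (locally l) ->
  filterlim g (Rbar_locally p_infty) (locally l') ->
  filterlim (fun t => f t + g t) (Rbar_locally p_infty) (locally (l + l')).
Proof. intros Hf Hg. apply (is_lim_plus' f g p_infty l l' Hf Hg). Qed.

Lemma pinfty_mult (f g : R -> R) (l l' : R) :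
  filterlim f (Rbar_locally p_infty) (locally l) ->
  filterlim g (Rbar_locally p_infty) (locally l') ->
  filterlim (fun t => f t * g t) (Rbar_locally p_infty) (locally (l * l')).
Proof. intros Hf Hg. apply (is_lim_mult f g p_infty l l' Hf Hg). exact I. Qed.

Lemma pinfty_unique (f : R -> R) (l l' : R) :
  filterlim f (Rbar_locally p_infty) (locally l) ->
  filterlim f (Rbar_locally p_infty) (locally l') -> l = l'.
Proof. intros H H'. apply (filterlim_locally_unique f l l' H H'). Qed.

(** The inverse of the square of the sine is continuous on a quarter turn between two
    multiples of [PI / 2]: in
    [sin x ^ 2 - sin x' ^ 2 = sin (x + x') * sin (x - x')] both factors are at least
    [sin e] in absolute value if [x] and [x'] are at least [e] apart. *)
Lemma sin_sq_quarter_turn (n : Z) (x x' e : R) :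
  IZR n * PI / 2 <= x <= IZR n * PI / 2 + PI / 2 ->
  IZR n * PI / 2 <= x' <= IZR n * PI / 2 + PI / 2 ->
  0 < e <= PI / 2 -> Rabs (sin x ^ 2 - sin x' ^ 2) < sin e ^ 2 -> Rabs (x - x') < e.
Proof.
  intros Hx Hx' He Hs. apply Rnot_le_lt. intros Hle.
  assert (Hmono : forall s, e <= s <= PI - e -> sin e <= sin s).
  { intros s Hs'. destruct (Rle_or_lt s (PI / 2)).
    - apply sin_incr_1; lra.
    - rewrite <- (sin_PI_x s). apply sin_incr_1; lra. }
  assert (Hse : 0 < sin e) by (apply sin_gt_0; lra).
  set (a := IZR n * PI / 2) in *.
  assert (Ha : sin (2 * a) = 0) by (apply sin_eq_0_1; exists n; unfold a; field).
  assert (Hca : Rabs (cos (2 * a)) = 1).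
  { assert (X := cos_sq (2 * a)). rewrite Ha in X.
    rewrite <- (sqrt_Rsqr_abs). replace (Rsqr (cos (2 * a))) with 1 by (unfold Rsqr; lra).
    apply sqrt_1. }
  assert (Hfac : sin x ^ 2 - sin x' ^ 2 = sin (x + x') * sin (x - x')).
  { rewrite sin_plus, sin_minus. assert (A := cos_sq x). assert (B := cos_sq x').
    replace ((sin x * cos x' + cos x * sin x') * (sin x * cos x' - cos x * sin x'))
      with (sin x ^ 2 * cos x' ^ 2 - cos x ^ 2 * sin x' ^ 2) by ring.
    rewrite A, B. ring. }
  set (s := (x - a) + (x' - a)).
  assert (H1 : sin e <= Rabs (sin (x + x'))).
  { replace (x + x') with (2 * a + s) by (unfold s; ring).
    rewrite sin_plus, Ha, Rmult_0_l, Rplus_0_l, Rabs_mult, Hca, Rmult_1_l.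
    eapply Rle_trans; [apply (Hmono s)|apply Rle_abs].
    unfold s, Rabs in *. destruct (Rcase_abs (x - x')); lra. }
  assert (H2 : sin e <= Rabs (sin (x - x'))).
  { unfold Rabs in Hle. destruct (Rcase_abs (x - x')).
    - eapply Rle_trans; [apply (Hmono (- (x - x'))); lra|].
      rewrite sin_neg. rewrite <- Rabs_Ropp. apply Rle_abs.
    - eapply Rle_trans; [apply (Hmono (x - x')); lra|]. apply Rle_abs. }
  rewrite Hfac, Rabs_mult in Hs.
  assert (sin e * sin e <= Rabs (sin (x + x')) * Rabs (sin (x - x')))
    by (apply Rmult_le_compat; lra). lra.
Qed.

(** After [t0], the function [x] stays in one quarter turn. *)
Lemma limit_of_sin_sq (x : R -> R) (t0 U : R) :
  (forall t, continuous x t) -> (forall t, t0 < t -> sin (x t) * cos (x t) <> 0) ->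
  filterlim (fun t => sin (x t) ^ 2) (Rbar_locally p_infty) (locally U) ->
  exists xl, filterlim x (Rbar_locally p_infty) (locally xl) /\ sin xl ^ 2 = U.
Proof.
  intros Hx Hn HU. assert (HP := PI_RGT_0).
  set (t1 := t0 + 1). set (r := 2 * x t1 / PI).
  destruct (archimed r) as [A1 A2].
  set (n := (up r - 1)%Z).
  assert (Hxr : x t1 = r * PI / 2) by (unfold r; field; lra).
  set (a := IZR n * PI / 2).
  assert (Hna : IZR n = IZR (up r) - 1) by (unfold n; now rewrite minus_IZR).
  assert (Ha0 : sin a * cos a = 0) by (apply sin_cos_eq_0; exists n; reflexivity).
  assert (Ha1 : sin (a + PI / 2) * cos (a + PI / 2) = 0).
  { apply sin_cos_eq_0. exists (n + 1)%Z. rewrite plus_IZR. unfold a. field. }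
  assert (Hin : forall t, t0 < t -> a <= x t <= a + PI / 2).
  { assert (H1 : a < x t1 < a + PI / 2).
    { assert (Hne : x t1 <> a).
      { intros E. apply (Hn t1); [unfold t1; lra|]. rewrite E. exact Ha0. }
      assert (a <= x t1 < a + PI / 2); [|lra].
      rewrite Hxr. unfold a. rewrite Hna. split; nra. }
    intros t Ht. apply NNPP. intros Hout.
    assert (Hivt : forall c, Rmin (x t1) (x t) <= c <= Rmax (x t1) (x t) ->
      sin c * cos c <> 0).
    { intros c Hc. destruct (IVT_gen x t1 t c) as [s [Hs <-]].
      - intros s. apply continuity_pt_filterlim, Hx.
      - exact Hc.
      - apply Hn. unfold t1, Rmin in Hs. destruct (Rle_dec (t0 + 1) t); lra. }
    destruct (Rlt_or_le (x t) a) as [H|H].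
    - apply (Hivt a); [|exact Ha0].
      rewrite Rmin_right, Rmax_left by lra. lra.
    - apply (Hivt (a + PI / 2)); [|exact Ha1].
      rewrite Rmin_left, Rmax_right by lra. lra. }
  assert (HU01 : 0 <= U <= 1).
  { split.
    - apply (pinfty_ge _ _ _ HU). intros t. apply pow2_ge_0.
    - apply (pinfty_le _ _ _ HU). intros t.
      assert (X := cos_sq (x t)). assert (X' := pow2_ge_0 (cos (x t))). lra. }
  destruct (IVT_gen (fun v => sin v ^ 2) a (a + PI / 2) U) as [xl [Hxl HxlU]].
  { intros v. apply continuity_pt_filterlim.
    apply (ex_derive_continuous (V := R_NormedModule)). auto_derive. trivial. }
  { replace (sin (a + PI / 2)) with (cos a) by (rewrite Rplus_comm, <- cos_sin; reflexivity).
    rewrite cos_sq. assert (E : sin a ^ 2 = 0 \/ sin a ^ 2 = 1).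
    { apply Rmult_integral in Ha0. destruct Ha0 as [E|E]; [left; rewrite E; ring|right].
      assert (X := cos_sq a). rewrite E in X. lra. }
    destruct E as [-> | ->]; unfold Rmin, Rmax; destruct Rle_dec; lra. }
  rewrite Rmin_left, Rmax_right in Hxl by lra.
  exists xl. split; [|exact HxlU].
  apply filterlim_p_infty_eps. intros e He.
  set (e' := Rmin e (PI / 2)).
  assert (He' : 0 < e' <= PI / 2).
  { split; [apply Rmin_glb_lt; lra|apply Rmin_r]. }
  assert (Hse : 0 < sin e') by (apply sin_gt_0; lra).
  destruct (proj1 (filterlim_p_infty_eps _ U) HU (sin e' ^ 2)) as [M HM];
    [now apply pow_lt|].
  exists (Rmax M t0). intros t Ht.
  assert (X1 := Rmax_l M t0). assert (X2 := Rmax_r M t0).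
  apply (Rlt_le_trans _ e'); [|apply Rmin_l].
  apply (sin_sq_quarter_turn n); [apply Hin; lra|exact Hxl|exact He'|].
  rewrite HxlU. apply HM. lra.
Qed.

(** If the vortices do not cross the symmetry axes [sin x * cos x = 0] any more,
    then [y] is monotone, hence convergent. On a level set of the energy,
    [sin x ^ 2] is a function of [y], because the difference of the first two gaps
    depends on [y] alone; so [x] converges too. *)
Lemma limit_equilibrium (kap b m Y d t0 : R) (x y : R -> R) :
  kap <> 0 -> Rabs m < 1 -> 0 < d -> solution kap b m x y ->
  (forall t, thick b m Y d (x t) (y t)) ->
  (forall t, t0 < t -> sin (x t) * cos (x t) <> 0) ->
  exists xl yl, equilibrium kap b m xl yl /\
    energy b m xl yl = energy b m (x 0) (y 0) /\
    filterlim x (Rbar_locally p_infty) (locally xl) /\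
    filterlim y (Rbar_locally p_infty) (locally yl).
Proof.
  intros Hkap Hm Hd Hsol Hth Hn.
  assert (Hm' := proj1 (Rabs_lt_between _ _) Hm).
  assert (HY : 0 <= Y) by (assert (X := Rabs_pos (y 0)); destruct (Hth 0); lra).
  assert (Hcx : forall t, continuous x t).
  { intros t. destruct (Hsol t) as (_ & Hx & _). exact (continuous_of_derive _ _ _ Hx). }
  assert (Hcy : forall t, continuous y t).
  { intros t. destruct (Hsol t) as (_ & _ & Hy). exact (continuous_of_derive _ _ _ Hy). }
  set (al := 2 * (1 - m ^ 2)). assert (Hal : 0 < al) by (unfold al; nra).
  set (h := energy b m (x 0) (y 0)).
  assert (Hen : forall t, energy b m (x t) (y t) = h).
  { intros t. apply (constant_of_derive_0 (fun s => energy b m (x s) (y s))).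
    intros s _. destruct (Hsol s) as (Hr & Hx & Hy). now apply (energy_conserved kap). }
  destruct (monotone_bounded_limit y (fun t => field_y kap b m (x t) (y t)) t0 Y)
    as [yl Hyl].
  - intros t. apply Hsol.
  - intros t. apply (continuous_ext (fun t => truncated_y kap b m Y d (x t) (y t))).
    + intros s. now apply truncated_y_thick.
    + apply bounded_lipschitz_continuous; auto. now apply bounded_lipschitz_truncated_y.
  - intros t Ht. destruct (Hsol t) as ((H1 & H2 & H3 & H4) & _ & _).
    assert (Hg := regular_gap_difference b m (x t) (y t) (proj1 (Hsol t))).
    rewrite <- (gap2_minus_gap1 b m (x t)) in Hg.
    unfold field_y, velocity_y.
    replace (/ gap1 (x t) (y t) + - / gap2 b m (x t) (y t))
      with ((gap2 b m (x t) (y t) - gap1 (x t) (y t))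
        * (/ gap1 (x t) (y t) * / gap2 b m (x t) (y t))) by (field; lra).
    repeat apply Rmult_integral_contrapositive_currified; try lra; auto;
    try apply Rinv_neq_0_compat; try lra.
    + intros E. apply (Hn t Ht). rewrite E. ring.
    + intros E. apply (Hn t Ht). rewrite E. ring.
  - intros t. apply Hth.
  - assert (HylY : Rabs yl <= Y).
    { assert (Hb := fun t => proj1 (Rabs_le_between _ _) (proj1 (Hth t))).
      apply Rabs_le. split.
      - apply (pinfty_ge _ _ _ Hyl). intros t. apply Hb.
      - apply (pinfty_le _ _ _ Hyl). intros t. apply Hb. }
    assert (L3 : filterlim (fun t => gap3 b m (y t)) (Rbar_locally p_infty)
      (locally (gap3 b m yl))).
    { apply (pinfty_comp (fun v => gap3 b m v) y yl Hyl). unfold gap3. auto_derive. trivial. }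
    assert (L4 : filterlim (fun t => gap4 b m (y t)) (Rbar_locally p_infty)
      (locally (gap4 b m yl))).
    { apply (pinfty_comp (fun v => gap4 b m v) y yl Hyl). unfold gap4. auto_derive. trivial. }
    assert (D3 : d <= gap3 b m yl) by (apply (pinfty_ge _ _ _ L3); intros; apply Hth).
    assert (D4 : d <= gap4 b m yl) by (apply (pinfty_ge _ _ _ L4); intros; apply Hth).
    assert (Hgl : gap_difference b m yl <> 0).
    { intros E. assert (X := gap_difference_sq b m yl). rewrite E in X. nra. }
    (* the value of [gap1 / gap2] on the level set, as a function of the height *)
    set (rho := fun v => exp ((h + (1 - m) ^ 2 * ln (gap3 b m v)
      + (1 + m) ^ 2 * ln (gap4 b m v)) / al)).
    assert (Hrho : forall t, gap1 (x t) (y t) = rho (y t) * gap2 b m (x t) (y t)).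
    { intros t. destruct (proj1 (Hsol t)) as (H1 & H2 & H3 & H4).
      apply ln_inv; [assumption|apply Rmult_lt_0_compat; [apply exp_pos|assumption]|].
      rewrite ln_mult by (apply exp_pos || assumption).
      unfold rho. rewrite ln_exp, <- (Hen t). unfold energy. fold al. field. lra. }
    (* the value of [/ gap2] *)
    set (lam := fun v => (1 - rho v) / gap_difference b m v).
    assert (Hlam : forall t, / gap2 b m (x t) (y t) = lam (y t)).
    { intros t. destruct (proj1 (Hsol t)) as (H1 & H2 & H3 & H4).
      assert (Hg := regular_gap_difference b m (x t) (y t) (proj1 (Hsol t))).
      assert (E := gap2_minus_gap1 b m (x t) (y t)). rewrite Hrho in E.
      unfold lam. rewrite <- E in *. field. split; lra. }
    assert (Hexl : ex_derive lam yl).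
    { unfold lam, rho, gap_difference, gap3, gap4 in *. auto_derive.
      unfold Rminus in D4, Hgl. repeat split; lra. }
    assert (Llam := pinfty_comp lam y yl Hyl Hexl).
    assert (Hl0 : 0 < lam yl).
    { set (K := 1 + sinh (Rabs b + Y) ^ 2).
      assert (HK : 0 < K) by (unfold K; assert (X := pow2_ge_0 (sinh (Rabs b + Y))); lra).
      apply (Rlt_le_trans _ (/ K)); [now apply Rinv_0_lt_compat|].
      apply (pinfty_ge _ _ _ Llam). intros t. rewrite <- Hlam.
      destruct (proj1 (Hsol t)) as (H1 & H2 & H3 & H4).
      apply Rinv_le_contravar; [assumption|].
      eapply Rle_trans; [apply sin_norm2_bounds|]. apply Rplus_le_compat_l, sinh_sq_le.
      eapply Rle_trans; [apply Rabs_triang|]. rewrite Rabs_mult.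
      assert (X := proj1 (Hth t)). assert (X' := Rabs_pos (y t)).
      assert (X'' := Rabs_pos m). nra. }
    assert (Lu : filterlim (fun t => sin (x t) ^ 2) (Rbar_locally p_infty)
      (locally (/ lam yl - sinh (b + m * yl) ^ 2))).
    { apply (filterlim_ext (fun t => / lam (y t) - sinh (b + m * y t) ^ 2)).
      - intros t. rewrite <- Hlam, Rinv_inv. unfold gap2, sin_norm2. ring.
      - apply (pinfty_comp (fun v => / lam v - sinh (b + m * v) ^ 2) y yl Hyl).
        auto_derive. repeat split; [exact Hexl|lra]. }
    destruct (limit_of_sin_sq x t0 _ Hcx Hn Lu) as [xl [Hxl Hul]].
    exists xl, yl.
    assert (L1 : filterlim (fun t => gap1 (x t) (y t)) (Rbar_locally p_infty)
      (locally (gap1 xl yl))).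
    { apply pinfty_plus.
      - apply (pinfty_comp (fun v => sin v ^ 2) x xl Hxl). auto_derive. trivial.
      - apply (pinfty_comp (fun v => sinh v ^ 2) y yl Hyl). auto_derive. trivial. }
    assert (L2 : filterlim (fun t => gap2 b m (x t) (y t)) (Rbar_locally p_infty)
      (locally (gap2 b m xl yl))).
    { apply pinfty_plus.
      - apply (pinfty_comp (fun v => sin v ^ 2) x xl Hxl). auto_derive. trivial.
      - apply (pinfty_comp (fun v => sinh (b + m * v) ^ 2) y yl Hyl). auto_derive. trivial. }
    assert (D1 : d <= gap1 xl yl) by (apply (pinfty_ge _ _ _ L1); intros; apply Hth).
    assert (D2 : d <= gap2 b m xl yl) by (apply (pinfty_ge _ _ _ L2); intros; apply Hth).
    assert (Hthl : thick b m Y d xl yl) by (repeat split; assumption).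
    assert (Hfield : forall f g : R -> R -> R, bounded_lipschitz g ->
      (forall x y, thick b m Y d x y -> g x y = f x y) ->
      filterlim (fun t => f (x t) (y t)) (Rbar_locally p_infty) (locally (f xl yl))).
    { intros f g Hg Hfg. rewrite <- (Hfg xl yl Hthl).
      apply (filterlim_ext (fun t => g (x t) (y t))); [intros t; now apply Hfg|].
      apply bounded_lipschitz_filterlim; auto. apply Rbar_locally_filter. }
    split; [split; [|split]|].
    + exact (thick_regular _ _ _ _ _ _ Hd Hthl).
    + apply (derive_limit_0 x _ xl _ (fun t => proj1 (proj2 (Hsol t))) Hxl).
      apply (Hfield _ (truncated_x kap b m Y d)).
      * now apply bounded_lipschitz_truncated_x.
      * intros; now apply truncated_x_thick.
    + apply (derive_limit_0 y _ yl _ (fun t => proj2 (proj2 (Hsol t))) Hyl).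
      apply (Hfield _ (truncated_y kap b m Y d)).
      * now apply bounded_lipschitz_truncated_y.
      * intros; now apply truncated_y_thick.
    + split; [|split; assumption].
      assert (Hln : forall g gl, filterlim g (Rbar_locally p_infty) (locally gl) ->
        d <= gl -> filterlim (fun t => ln (g t)) (Rbar_locally p_infty) (locally (ln gl))).
      { intros g gl Hg Hgl'. apply pinfty_comp; [assumption|]. auto_derive. lra. }
      assert (Hc : forall c g gl, filterlim g (Rbar_locally p_infty) (locally gl) ->
        filterlim (fun t => c * g t) (Rbar_locally p_infty) (locally (c * gl))).
      { intros c g gl Hg. apply pinfty_mult; [apply filterlim_const|assumption]. }
      assert (Le := pinfty_plus _ _ _ _
        (pinfty_plus _ _ _ _ (Hc al _ _ (Hln _ _ L1 D1)) (Hc (- al) _ _ (Hln _ _ L2 D2)))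
        (pinfty_plus _ _ _ _ (Hc (- (1 - m) ^ 2) _ _ (Hln _ _ L3 D3))
          (Hc (- (1 + m) ^ 2) _ _ (Hln _ _ L4 D4)))).
      apply (pinfty_unique (fun _ => h)); [|apply filterlim_const].
      replace (energy b m xl yl) with
        (al * ln (gap1 xl yl) + - al * ln (gap2 b m xl yl)
         + (- (1 - m) ^ 2 * ln (gap3 b m yl) + - (1 + m) ^ 2 * ln (gap4 b m yl)))
        by (unfold energy; fold al; ring).
      eapply filterlim_ext; [|exact Le]. intros t. cbv beta.
      rewrite <- (Hen t). unfold energy. fold al. ring.
Qed.

(** * Equilibria *)

(** The conditions for an equilibrium with [sin x = 0], respectively [cos x = 0],
    after clearing denominators. *)
Definition axis0_equation (b m y : R) : Prop :=
  cosh y * sinh (b + m * y) ^ 3 + m * cosh (b + m * y) * sinh y ^ 3 = 0.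

Definition axis1_equation (b m y : R) : Prop :=
  sinh y * cosh (b + m * y) ^ 3 + m * sinh (b + m * y) * cosh y ^ 3 = 0.

Lemma sinh_cosh_products (a y : R) :
  cosh (a + y) * sinh (a - y) = cosh a * sinh a - cosh y * sinh y /\
  cosh (a - y) * sinh (a + y) = cosh a * sinh a + cosh y * sinh y.
Proof.
  assert (A := cosh_sinh_sq a). assert (B := cosh_sinh_sq y).
  rewrite cosh_plus, cosh_minus, sinh_plus, sinh_minus. split.
  - transitivity (cosh a * sinh a * (cosh y ^ 2 - sinh y ^ 2)
      - cosh y * sinh y * (cosh a ^ 2 - sinh a ^ 2)); [ring|]. rewrite A, B. ring.
  - transitivity (cosh a * sinh a * (cosh y ^ 2 - sinh y ^ 2)
      + cosh y * sinh y * (cosh a ^ 2 - sinh a ^ 2)); [ring|]. rewrite A, B. ring.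
Qed.

(** On the axis [sin x = 0] all terms of the horizontal field are hyperbolic
    cotangents, and the addition formulas turn it into a single fraction; on the
    axis [cos x = 0] hyperbolic tangents appear instead. *)
Lemma field_x_axis0 (kap b m x y : R) :
  regular b m x y -> sin x = 0 ->
  field_x kap b m x y
    * (sinh (b + m * y + y) * sinh (b + m * y - y) * (sinh y * sinh (b + m * y)))
  = - 2 * kap * (cosh y * sinh (b + m * y) ^ 3 + m * cosh (b + m * y) * sinh y ^ 3).
Proof.
  intros (H1 & H2 & H3 & H4) Hs.
  unfold field_x, velocity_x, gap1, gap2, gap3, gap4, sin_norm2 in *. rewrite Hs in *.
  set (a := b + m * y) in *.
  destruct (sinh_cosh_products a y) as [E1 E2]. assert (E3 := sinh_sq_mult a y).
  set (S3 := sinh (a + y)) in *. set (S4 := sinh (a - y)) in *.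
  set (C3 := cosh (a + y)) in *. set (C4 := cosh (a - y)) in *.
  assert (N3 : S3 <> 0) by (intros E; rewrite E in H3; lra).
  assert (N4 : S4 <> 0) by (intros E; rewrite E in H4; lra).
  assert (N1 : sinh y <> 0) by (intros E; rewrite E in H1; lra).
  assert (N2 : sinh a <> 0) by (intros E; rewrite E in H2; lra).
  transitivity (kap * (- 2 * cosh y * sinh a * (S3 * S4)
    + 2 * m * cosh a * sinh y * (S3 * S4)
    + sinh y * sinh a * ((1 - m) * (C3 * S4) - (1 + m) * (C4 * S3)))).
  - field. repeat split; assumption.
  - rewrite E1, E2, E3. ring.
Qed.

Lemma field_x_axis1 (kap b m x y : R) :
  regular b m x y -> cos x = 0 ->
  field_x kap b m x y
    * (sinh (b + m * y + y) * sinh (b + m * y - y) * (cosh y * cosh (b + m * y)))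
  = - 2 * kap * (sinh y * cosh (b + m * y) ^ 3 + m * sinh (b + m * y) * cosh y ^ 3).
Proof.
  intros (H1 & H2 & H3 & H4) Hc.
  assert (Hs : sin x ^ 2 = 1) by (assert (X := cos_sq x); rewrite Hc in X; lra).
  unfold field_x, velocity_x, gap1, gap2, gap3, gap4, sin_norm2 in *. rewrite Hs in *.
  set (a := b + m * y) in *.
  destruct (sinh_cosh_products a y) as [E1 E2]. assert (E3 := sinh_sq_mult a y).
  assert (Ca := cosh_sinh_sq a). assert (Cy := cosh_sinh_sq y).
  rewrite <- Ca, <- Cy in *.
  assert (Pa := cosh_pos a). assert (Py := cosh_pos y).
  set (S3 := sinh (a + y)) in *. set (S4 := sinh (a - y)) in *.
  set (C3 := cosh (a + y)) in *. set (C4 := cosh (a - y)) in *.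
  assert (N3 : S3 <> 0) by (intros E; rewrite E in H3; lra).
  assert (N4 : S4 <> 0) by (intros E; rewrite E in H4; lra).
  transitivity (kap * (- 2 * sinh y * cosh a * (S3 * S4)
    + 2 * m * sinh a * cosh y * (S3 * S4)
    + cosh y * cosh a * ((1 - m) * (C3 * S4) - (1 + m) * (C4 * S3)))).
  - field. repeat split; try assumption; lra.
  - rewrite E1, E2, E3.
    transitivity (- 2 * kap * (sinh y * cosh a * (sinh a ^ 2 - sinh y ^ 2 + cosh y ^ 2)
      + m * sinh a * cosh y * (cosh a ^ 2 - sinh a ^ 2 + sinh y ^ 2))); [ring|].
    replace (sinh a ^ 2 - sinh y ^ 2 + cosh y ^ 2) with (cosh a ^ 2) by lra.
    replace (cosh a ^ 2 - sinh a ^ 2 + sinh y ^ 2) with (cosh y ^ 2) by lra. ring.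
Qed.

Lemma field_y_eq_0 (kap b m x y : R) :
  kap <> 0 -> regular b m x y -> field_y kap b m x y = 0 <-> sin x * cos x = 0.
Proof.
  intros Hk Hr. assert (Hg := regular_gap_difference b m x y Hr).
  destruct Hr as (H1 & H2 & _). rewrite <- (gap2_minus_gap1 b m x) in Hg.
  assert (E : field_y kap b m x y = sin x * cos x *
    (2 * kap * (gap2 b m x y - gap1 x y) * (/ gap1 x y * / gap2 b m x y)))
    by (unfold field_y, velocity_y; field; lra).
  rewrite E. split.
  - intros H. apply Rmult_integral in H. destruct H as [H|H]; [assumption|].
    exfalso. revert H. repeat apply Rmult_integral_contrapositive_currified;
    try apply Rinv_neq_0_compat; lra.
  - intros ->. ring.
Qed.

Lemma equilibrium_equations (kap b m x y : R) :
  kap <> 0 -> equilibrium kap b m x y ->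
  (sin x = 0 /\ y <> 0 /\ b + m * y <> 0 /\ axis0_equation b m y) \/
  (cos x = 0 /\ axis1_equation b m y).
Proof.
  intros Hk (Hr & Hx & Hy).
  apply field_y_eq_0 in Hy; [|assumption|assumption].
  apply Rmult_integral in Hy. destruct Hy as [Hs|Hc]; [left|right].
  - split; [assumption|].
    assert (E := field_x_axis0 kap b m x y Hr Hs). rewrite Hx, Rmult_0_l in E.
    destruct Hr as (H1 & H2 & _). unfold gap1, gap2, sin_norm2 in *. rewrite Hs in *.
    split; [|split].
    + intros ->. rewrite sinh_0 in H1. lra.
    + intros E0. rewrite E0, sinh_0 in H2. lra.
    + symmetry in E. apply Rmult_integral in E. destruct E as [E|E]; [nra|exact E].
  - split; [assumption|].
    assert (E := field_x_axis1 kap b m x y Hr Hc). rewrite Hx, Rmult_0_l in E.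
    symmetry in E. apply Rmult_integral in E. destruct E as [E|E]; [nra|exact E].
Qed.

(** [cosh y / sinh y ^ 3 + m * cosh a / sinh a ^ 3] is decreasing between its poles. *)
Lemma finite_axis0 (b m : R) :
  finite_set (fun y => y <> 0 /\ b + m * y <> 0 /\ axis0_equation b m y).
Proof.
  set (f := fun y => cosh y / sinh y ^ 3 + m * (cosh (b + m * y) / sinh (b + m * y) ^ 3)).
  set (f' := fun y => - ((3 + 2 * sinh y ^ 2) / sinh y ^ 4)
    - m ^ 2 * ((3 + 2 * sinh (b + m * y) ^ 2) / sinh (b + m * y) ^ 4)).
  assert (Hs : forall v, v <> 0 -> sinh v <> 0).
  { intros v Hv E. now apply Hv, sinh_eq_0. }
  assert (Hf : forall y, y <> 0 -> b + m * y <> 0 -> is_derive f y (f' y)).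
  { intros y Hy Ha. apply Hs in Hy, Ha. unfold f, f'. auto_derive.
    - assert (Hp : forall v, v <> 0 -> v * (v * (v * 1)) <> 0).
      { intros v Hv. replace (v * (v * (v * 1))) with (v ^ 3) by ring. now apply pow_nonzero. }
      repeat split; now apply Hp.
    - assert (A := cosh_sinh_sq (b + m * y)). assert (B := cosh_sinh_sq y).
      set (c := cosh y) in *. set (s := sinh y) in *.
      set (C := cosh (b + m * y)) in *. set (s' := sinh (b + m * y)) in *.
      transitivity ((s ^ 2 - 3 * c ^ 2) / s ^ 4 + m ^ 2 * ((s' ^ 2 - 3 * C ^ 2) / s' ^ 4)).
      + field. split; assumption.
      + rewrite A, B. field. split; assumption. }
  assert (Hneg : forall y, y <> 0 -> b + m * y <> 0 -> f' y <> 0).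
  { intros y Hy Ha. apply Hs in Hy, Ha. unfold f'.
    assert (P : forall s, s <> 0 -> 0 < (3 + 2 * s ^ 2) / s ^ 4).
    { intros s H0. assert (X := pow2_ge_0 s).
      apply Rdiv_lt_0_compat; [lra|]. replace (s ^ 4) with ((s ^ 2) ^ 2) by ring.
      apply pow_lt, pow2_gt_0, H0. }
    assert (P1 := P _ Hy). assert (P2 := P _ Ha). assert (P3 := pow2_ge_0 m).
    assert (0 <= m ^ 2 * ((3 + 2 * sinh (b + m * y) ^ 2) / sinh (b + m * y) ^ 4))
      by (apply Rmult_le_pos; lra). lra. }
  assert (Hpiece : forall I : R -> Prop,
    (forall u v w, I u -> I v -> u <= w <= v -> I w) ->
    (forall y, I y -> y <> 0 /\ b + m * y <> 0) ->
    finite_set (fun y => I y /\ f y = 0)).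
  { intros I HI Hn. apply (finite_zeros f f' I HI).
    - intros y Hy. destruct (Hn y Hy). auto.
    - exists nil. intros y [Hy H0]. destruct (Hn y Hy). now apply (Hneg y). }
  assert (Hq : forall e1 e2 : R, finite_set (fun y =>
    (0 < e1 * y /\ 0 < e2 * (b + m * y)) /\ f y = 0)).
  { intros e1 e2. apply Hpiece.
    - intros u v w [U1 U2] [V1 V2] Hw. split.
      + destruct (Rle_or_lt 0 e1); nra.
      + destruct (Rle_or_lt 0 (e2 * m)) as [H|H]; nra.
    - intros y [Y1 Y2]. split; intros E; rewrite E in *; lra. }
  apply (finite_set_subset _ _ (finite_set_union _ _
    (finite_set_union _ _ (Hq 1 1) (Hq 1 (- 1)))
    (finite_set_union _ _ (Hq (- 1) 1) (Hq (- 1) (- 1))))).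
  intros y (Hy & Ha & Heq).
  assert (H0 : f y = 0).
  { unfold f. assert (Sy := Hs _ Hy). assert (Sa := Hs _ Ha).
    unfold axis0_equation in Heq.
    transitivity ((cosh y * sinh (b + m * y) ^ 3 + m * cosh (b + m * y) * sinh y ^ 3)
      / (sinh y ^ 3 * sinh (b + m * y) ^ 3)); [field; split; assumption|].
    rewrite Heq. unfold Rdiv. apply Rmult_0_l. }
  destruct (Rtotal_order y 0) as [?|[?|?]], (Rtotal_order (b + m * y) 0) as [?|[?|?]];
  try contradiction.
  - right; right. repeat split; try lra; assumption.
  - right; left. repeat split; try lra; assumption.
  - left; right. repeat split; try lra; assumption.
  - left; left. repeat split; try lra; assumption.
Qed.

(** The logarithm of the quotient of the two sides has a positive third derivative,
    hence at most three zeros. *)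
Lemma finite_axis1_quadrant (b m : R) : 0 < m ->
  finite_set (fun s => (0 < s /\ 0 < b - m * s) /\
    sinh s * cosh (b - m * s) ^ 3 = m * sinh (b - m * s) * cosh s ^ 3).
Proof.
  intros Hm.
  set (I := fun s => 0 < s /\ 0 < b - m * s).
  set (L0 := fun s => ln (sinh s) - 3 * ln (cosh s)
    - ln (sinh (b - m * s)) + 3 * ln (cosh (b - m * s)) - ln m).
  set (L1 := fun s => cosh s / sinh s - 3 * (sinh s / cosh s)
    + m * (cosh (b - m * s) / sinh (b - m * s) - 3 * (sinh (b - m * s) / cosh (b - m * s)))).
  set (L2 := fun s => - (/ sinh s ^ 2) - 3 * / cosh s ^ 2
    + m ^ 2 * (/ sinh (b - m * s) ^ 2 + 3 * / cosh (b - m * s) ^ 2)).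
  set (L3 := fun s => 2 * (cosh s / sinh s ^ 3) + 6 * (sinh s / cosh s ^ 3)
    + m ^ 3 * (2 * (cosh (b - m * s) / sinh (b - m * s) ^ 3)
               + 6 * (sinh (b - m * s) / cosh (b - m * s) ^ 3))).
  assert (HI : forall u v w, I u -> I v -> u <= w <= v -> I w).
  { intros u v w [U1 U2] [V1 V2] Hw. split; nra. }
  assert (Hpos : forall s, I s -> 0 < sinh s /\ 0 < cosh s /\
    0 < sinh (b - m * s) /\ 0 < cosh (b - m * s)).
  { intros s [S1 S2]. repeat split; try apply cosh_pos; now apply sinh_pos. }
  assert (D0 : forall s, I s -> is_derive L0 s (L1 s)).
  { intros s Hs. destruct (Hpos s Hs) as (P1 & P2 & P3 & P4). unfold L0, L1, Rminus in *.
    auto_derive; [repeat split; assumption|]. field. repeat split; lra. }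
  assert (D1 : forall s, I s -> is_derive L1 s (L2 s)).
  { intros s Hs. destruct (Hpos s Hs) as (P1 & P2 & P3 & P4).
    assert (A := cosh_sinh_sq s). assert (B := cosh_sinh_sq (b - m * s)).
    unfold L1, L2, Rminus in *.
    auto_derive; [repeat split; lra|].
    set (c := cosh s) in *. set (v := sinh s) in *.
    set (C := cosh (b + - (m * s))) in *. set (V := sinh (b + - (m * s))) in *.
    transitivity ((v ^ 2 - c ^ 2) / v ^ 2 - 3 * ((c ^ 2 - v ^ 2) / c ^ 2)
      - m ^ 2 * ((V ^ 2 - C ^ 2) / V ^ 2 - 3 * ((C ^ 2 - V ^ 2) / C ^ 2))).
    - field. repeat split; lra.
    - replace (v ^ 2 - c ^ 2) with (- 1) by lra. replace (c ^ 2 - v ^ 2) with 1 by lra.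
      replace (V ^ 2 - C ^ 2) with (- 1) by lra. replace (C ^ 2 - V ^ 2) with 1 by lra.
      field. repeat split; lra. }
  assert (D2 : forall s, I s -> is_derive L2 s (L3 s)).
  { intros s Hs. destruct (Hpos s Hs) as (P1 & P2 & P3 & P4).
    unfold L2, L3, Rminus in *.
    auto_derive.
    - assert (Hp : forall v, 0 < v -> v * (v * 1) <> 0) by (intros v Hv; nra).
      repeat split; now apply Hp.
    - field. repeat split; lra. }
  assert (P3 : forall s, I s -> L3 s <> 0).
  { intros s Hs. destruct (Hpos s Hs) as (Q1 & Q2 & Q3 & Q4). apply Rgt_not_eq.
    assert (X : forall u v, 0 < u -> 0 < v -> 0 < u / v ^ 3)
      by (intros; apply Rdiv_lt_0_compat; [assumption|now apply pow_lt]).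
    assert (X1 := X _ _ Q2 Q1). assert (X2 := X _ _ Q1 Q2).
    assert (X3 := X _ _ Q4 Q3). assert (X4 := X _ _ Q3 Q4).
    assert (0 < m ^ 3) by now apply pow_lt. unfold L3.
    assert (0 < m ^ 3 * (2 * (cosh (b - m * s) / sinh (b - m * s) ^ 3)
               + 6 * (sinh (b - m * s) / cosh (b - m * s) ^ 3)))
      by (apply Rmult_lt_0_compat; lra). lra. }
  assert (F : finite_set (fun s => I s /\ L0 s = 0)).
  { apply (finite_zeros L0 L1 I HI D0). apply (finite_zeros L1 L2 I HI D1).
    apply (finite_zeros L2 L3 I HI D2). exists nil. intros s [Hs E]. now apply (P3 s). }
  apply (finite_set_subset _ _ F). intros s [Hs E]. split; [exact Hs|].
  destruct (Hpos s Hs) as (Q1 & Q2 & Q3 & Q4).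
  apply (f_equal ln) in E.
  replace (cosh (b - m * s) ^ 3)
    with (cosh (b - m * s) * cosh (b - m * s) * cosh (b - m * s)) in E by ring.
  replace (cosh s ^ 3) with (cosh s * cosh s * cosh s) in E by ring.
  rewrite !ln_mult in E by (repeat (assumption || apply Rmult_lt_0_compat)).
  unfold L0. lra.
Qed.

Lemma finite_axis1 (b m : R) : b <> 0 -> finite_set (axis1_equation b m).
Proof.
  intros Hb. assert (Hcp : forall v, 0 < cosh v ^ 3) by (intros v; apply pow_lt, cosh_pos).
  assert (Hpos : forall b m, 0 < m ->
    finite_set (fun y => axis1_equation b m y /\ 0 < b + m * y)).
  { clear - Hcp. intros b m Hm.
    apply (finite_set_subset _ _ (finite_set_image Ropp _ (finite_axis1_quadrant b m Hm))).
    intros y [E Ha]. exists (- y). split; [|ring].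
    replace (b - m * - y) with (b + m * y) by ring. unfold axis1_equation in E.
    rewrite sinh_opp, cosh_opp. split; [split; [|assumption]|lra].
    apply Ropp_0_gt_lt_contravar, Rnot_le_lt. intros Hy.
    assert (Sa := sinh_pos _ Ha). assert (Sy := sinh_ge y Hy).
    assert (0 <= sinh y * cosh (b + m * y) ^ 3)
      by (apply Rmult_le_pos; [lra|apply Rlt_le, Hcp]).
    assert (0 < m * sinh (b + m * y) * cosh y ^ 3)
      by (apply Rmult_lt_0_compat; [now apply Rmult_lt_0_compat|apply Hcp]). lra. }
  (* the reflections [(m, y) -> (- m, - y)] and [(b, y) -> (- b, - y)] *)
  assert (Hup : forall b m, m <> 0 ->
    finite_set (fun y => axis1_equation b m y /\ 0 < b + m * y)).
  { clear b Hb m. intros b m Hm.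
    destruct (Rtotal_order m 0) as [H|[H|H]]; [|contradiction|now apply Hpos].
    apply (finite_set_subset _ _ (finite_set_image Ropp _ (Hpos b (- m) ltac:(lra)))).
    intros y [E Ha]. exists (- y). split; [|ring]. unfold axis1_equation in *.
    replace (b + - m * - y) with (b + m * y) by ring. rewrite sinh_opp, cosh_opp.
    split; lra. }
  destruct (Req_dec m 0) as [->|Hm].
  - exists (0 :: nil). intros y E. left. unfold axis1_equation in E.
    rewrite !Rmult_0_l, !Rplus_0_r in E. assert (Cb := Hcp b).
    symmetry. apply sinh_eq_0. nra.
  - apply (finite_set_subset _ _ (finite_set_union _ _ (Hup b m Hm)
      (finite_set_image Ropp _ (Hup (- b) m Hm)))).
    intros y E. destruct (Rtotal_order (b + m * y) 0) as [Ha|[Ha|Ha]]; [right| |left].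
    + exists (- y). split; [|ring]. unfold axis1_equation in *.
      replace (- b + m * - y) with (- (b + m * y)) by ring.
      rewrite !sinh_opp, !cosh_opp. split; lra.
    + exfalso. unfold axis1_equation in E. rewrite Ha, sinh_0, cosh_0 in E.
      assert (y = 0) by (apply sinh_eq_0; lra). subst y. lra.
    + split; assumption.
Qed.

Lemma finite_equilibrium_heights (kap b m : R) : kap <> 0 -> b <> 0 ->
  finite_set (fun y => exists x, equilibrium kap b m x y).
Proof.
  intros Hk Hb.
  apply (finite_set_subset _ _ (finite_set_union _ _ (finite_axis0 b m) (finite_axis1 b m Hb))).
  intros y [x Hx]. apply equilibrium_equations in Hx; tauto.
Qed.

Lemma energy_sin_sq (b m x x' y : R) : sin x ^ 2 = sin x' ^ 2 ->
  energy b m x y = energy b m x' y.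
Proof. intros E. unfold energy, gap1, gap2, sin_norm2. now rewrite E. Qed.

Lemma finite_critical_values (kap b m : R) : kap <> 0 -> b <> 0 ->
  finite_set (fun h => exists x y, equilibrium kap b m x y /\ h = energy b m x y).
Proof.
  intros Hk Hb. assert (F := finite_equilibrium_heights kap b m Hk Hb).
  apply (finite_set_subset _ _ (finite_set_union _ _
    (finite_set_image (energy b m 0) _ F) (finite_set_image (energy b m (PI / 2)) _ F))).
  intros h (x & y & He & ->).
  assert (Hex : exists x, equilibrium kap b m x y) by (now exists x).
  apply equilibrium_equations in He as [(Hs & _)|(Hc & _)]; [left|right|assumption];
  exists y; (split; [assumption|]); apply energy_sin_sq.
  - rewrite Hs, sin_0. reflexivity.
  - rewrite sin_PI2. assert (X := cos_sq x). rewrite Hc in X. lra.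
Qed.

(** The equation on the axis [cos x = 0] changes sign between [0] and the zero
    [- b / m] of [b + m * y]. *)
Lemma equilibrium_exists (kap b m : R) : b <> 0 -> Rabs m < 1 ->
  exists y, equilibrium kap b m (PI / 2) y /\ (m = 0 -> y = 0).
Proof.
  intros Hb Hm. assert (Hm' := proj1 (Rabs_lt_between _ _) Hm).
  assert (Hcp := cosh_pos).
  assert (exists y, axis1_equation b m y /\ (m = 0 -> y = 0)) as (y & E & Hy0).
  { destruct (Req_dec m 0) as [->|Hm0].
    { exists 0. split; [|trivial]. unfold axis1_equation. rewrite sinh_0. ring. }
    set (g := fun y => sinh y * cosh (b + m * y) ^ 3 + m * sinh (b + m * y) * cosh y ^ 3).
    destruct (IVT_gen g 0 (- b / m) 0) as [y [_ Hy]].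
    - intros v. apply continuity_pt_filterlim, (ex_derive_continuous (V := R_NormedModule)).
      unfold g. auto_derive. trivial.
    - assert (G0 : g 0 = m * sinh b).
      { unfold g. rewrite Rmult_0_r, Rplus_0_r, sinh_0, cosh_0. ring. }
      assert (G1 : g (- b / m) = - sinh (b / m)).
      { unfold g. replace (b + m * (- b / m)) with 0 by (field; assumption).
        rewrite sinh_0, cosh_0. replace (- b / m) with (- (b / m)) by (field; assumption).
        rewrite sinh_opp. ring. }
      rewrite G0, G1.
      assert (Hsgn : 0 < m * sinh b * sinh (b / m)).
      { assert (Hs : forall v, v <> 0 -> 0 < v * sinh v).
        { intros v Hv. destruct (Rtotal_order v 0) as [H|[H|H]]; [|contradiction|].
          - apply sinh_neg in H as H'. nra.
          - apply sinh_pos in H as H'. nra. }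
        assert (Hbm : b / m <> 0) by (apply Rmult_integral_contrapositive_currified;
          [assumption|now apply Rinv_neq_0_compat]).
        assert (A := Rmult_lt_0_compat _ _ (Hs b Hb) (Hs _ Hbm)).
        replace (b * sinh b * (b / m * sinh (b / m)))
          with ((b / m) ^ 2 * (m * sinh b * sinh (b / m))) in A by (field; assumption).
        assert (X := pow2_ge_0 (b / m)). nra. }
      unfold Rmin, Rmax. destruct Rle_dec; split; nra.
    - exists y. split; [exact Hy|]. intros; contradiction. }
  exists y. split; [|exact Hy0].
  assert (Hcos : cos (PI / 2) = 0) by apply cos_PI2.
  assert (Hr : regular b m (PI / 2) y).
  { assert (G : forall v, 0 < sin_norm2 (PI / 2) v).
    { intros v. unfold sin_norm2. rewrite sin_PI2. assert (X := pow2_ge_0 (sinh v)). lra. }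
    (* at the points where the field is singular, [b + m * y] is [y] or [- y] *)
    assert (Hline : forall e : R, (e = 1 \/ e = - 1) -> b + m * y <> e * y).
    { intros e He E0. unfold axis1_equation in E. rewrite E0 in E.
      assert (Es : sinh (e * y) = e * sinh y /\ cosh (e * y) = cosh y).
      { destruct He as [->| ->].
        - rewrite !Rmult_1_l. split; reflexivity.
        - replace (- 1 * y) with (- y) by ring. rewrite sinh_opp, cosh_opp. split; ring. }
      destruct Es as [-> ->] in E.
      assert (C3 : 0 < cosh y ^ 3) by (apply pow_lt, Hcp).
      assert (E1 : (1 + m * e) * cosh y ^ 3 * sinh y = 0) by lra.
      apply Rmult_integral in E1. destruct E1 as [E1|E1].
      - apply Rmult_integral in E1. destruct He as [->| ->]; lra.
      - apply sinh_eq_0 in E1. subst y. lra. }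
    split; [apply G|]. split; [apply G|]. split; apply pow2_gt_0; intros H0;
    apply sinh_eq_0 in H0.
    - apply (Hline (- 1)); [now right|lra].
    - apply (Hline 1); [now left|lra]. }
  split; [assumption|]. split.
  - assert (F := field_x_axis1 kap b m (PI / 2) y Hr Hcos).
    unfold axis1_equation in E. rewrite E, Rmult_0_r in F.
    apply Rmult_integral in F. destruct F as [F|F]; [assumption|]. exfalso.
    revert F. destruct Hr as (_ & _ & H3 & H4). unfold gap3, gap4 in *.
    assert (N3 : sinh (b + m * y + y) <> 0) by (intros X; rewrite X in H3; lra).
    assert (N4 : sinh (b + m * y - y) <> 0) by (intros X; rewrite X in H4; lra).
    assert (Ny : cosh y <> 0) by apply Rgt_not_eq, Hcp.
    assert (Na : cosh (b + m * y) <> 0) by apply Rgt_not_eq, Hcp.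
    repeat (assumption || apply Rmult_integral_contrapositive_currified).
  - unfold field_y, velocity_y. rewrite Hcos. ring.
Qed.

(** * Relative equilibria and separatrices *)

Lemma equilibrium_solution (kap b m x y : R) :
  equilibrium kap b m x y -> solution kap b m (fun _ => x) (fun _ => y).
Proof.
  intros (Hr & Hx & Hy) t. rewrite Hx, Hy.
  split; [assumption|split; apply (is_derive_const (V := R_NormedModule))].
Qed.

Lemma relative_equilibrium_of_constant (b m S x y : R) (c : R -> R) (z : R -> nat -> C) :
  motion 4 (vort m S) z -> follows b m (fun _ => x) (fun _ => y) c z ->
  relative_equilibrium 4 (vort m S) z.
Proof.
  intros Hz Hf. split; [assumption|]. intros t. exists (RtoC (c t - c 0)).
  intros k Hk. rewrite !Hf by assumption. apply cyl_eq_translate with 0%Z.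
  destruct (placed b m x y k). apply C_eq; simpl; ring.
Qed.

Lemma filterlim_C {T : Type} (F : (T -> Prop) -> Prop) {FF : Filter F}
    (f : T -> C) (l : C) :
  filterlim (fun t => Re (f t)) F (locally (Re l)) ->
  filterlim (fun t => Im (f t)) F (locally (Im l)) ->
  filterlim f F (locally l).
Proof.
  intros H1 H2. apply filterlim_locally. intros e.
  generalize (filter_and _ _ (proj1 (filterlim_locally _ _) H1 e)
    (proj1 (filterlim_locally _ _) H2 e)).
  apply filter_imp. intros t [A B]. split; assumption.
Qed.

Lemma filterlim_placed {T : Type} (F : (T -> Prop) -> Prop) {FF : Filter F}
    (b m xl yl : R) (x y : T -> R) (k : nat) :
  filterlim x F (locally xl) -> filterlim y F (locally yl) ->
  filterlim (fun t => placed b m (x t) (y t) k) F (locally (placed b m xl yl k)).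
Proof.
  intros Hx Hy. destruct (placed_affine b m k) as (p & q & r & Hp).
  rewrite (proj1 (Hp _ _)).
  assert (Haff : forall (u : T -> R) (ul a e : R), filterlim u F (locally ul) ->
    filterlim (fun t => a + e * u t) F (locally (a + e * ul))).
  { intros u ul a e Hu.
    apply (filterlim_comp _ _ _ u (fun v => a + e * v) F (locally ul)); [exact Hu|].
    apply (ex_derive_continuous (V := R_NormedModule) (fun v => a + e * v)).
    auto_derive. trivial. }
  apply filterlim_C; [exact FF| |].
  - apply (filterlim_ext (fun t => 0 + p * x t)).
    + intros t. rewrite (proj1 (Hp _ _)). apply Rplus_0_l.
    + simpl Re. rewrite <- (Rplus_0_l (p * xl)). now apply Haff.
  - apply (filterlim_ext (fun t => q + r * y t)).
    + intros t. now rewrite (proj1 (Hp _ _)).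
    + now apply Haff.
Qed.

Lemma orbit_converges_of_limits (b m xl yl : R) (F : (R -> Prop) -> Prop) {FF : Filter F}
    (x y c : R -> R) (z : R -> nat -> C) (e : nat -> C) :
  follows b m x y c z -> filterlim x F (locally xl) -> filterlim y F (locally yl) ->
  (forall k, (k < 4)%nat -> e k = placed b m xl yl k) ->
  orbit_converges 4 F z e.
Proof.
  intros Hf Hx Hy He. exists (fun t => placed b m (x t) (y t)). split.
  - intros t. exists (RtoC (- c t)). intros k Hk. rewrite Hf by assumption.
    apply cyl_eq_translate with 0%Z. destruct (placed b m (x t) (y t) k).
    apply C_eq; simpl; ring.
  - intros k Hk. rewrite He by assumption. now apply filterlim_placed.
Qed.

Lemma filterlim_reverse_time (f : R -> R) (l : R) :
  filterlim (fun t => f (- t)) (Rbar_locally p_infty) (locally l) ->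
  filterlim f (Rbar_locally m_infty) (locally l).
Proof.
  intros H. apply (filterlim_ext (fun t => f (- - t))).
  { intros t. now rewrite Ropp_involutive. }
  apply (filterlim_comp _ _ _ Ropp (fun t => f (- t)) _ (Rbar_locally p_infty)); [|exact H].
  apply (filterlim_Rbar_opp m_infty).
Qed.

Lemma solution_reverse_time (kap b m : R) (x y : R -> R) :
  solution kap b m x y -> solution (- kap) b m (fun t => x (- t)) (fun t => y (- t)).
Proof.
  intros H t. destruct (H (- t)) as (Hr & Hx & Hy). split; [assumption|].
  assert (X : forall (f : R -> R) l, is_derive f (- t) l ->
    is_derive (fun s => f (- s)) t (- l)).
  { intros f l Hf. auto_derive; [eexists; eassumption|].
    known_derivatives. ring. }
  apply X in Hx, Hy. unfold field_x, field_y, velocity_x, velocity_y in *.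
  rewrite Ropp_mult_distr_l in Hx, Hy. split; assumption.
Qed.

Lemma equilibrium_opp (kap b m x y : R) :
  equilibrium (- kap) b m x y -> equilibrium kap b m x y.
Proof.
  unfold equilibrium, field_x, field_y, velocity_x, velocity_y.
  rewrite <- !Ropp_mult_distr_l. intros (Hr & Hx & Hy). split; [assumption|lra].
Qed.

(** The limit at minus infinity is the limit at plus infinity of the solution run
    backwards, which solves the system with [- kap]. *)
Lemma separatrix_limits (S b m Y d s0 : R) (x y : R -> R) :
  let kap := S / (16 * PI) in
  kap <> 0 -> Rabs m < 1 -> 0 < d -> solution kap b m x y ->
  (forall t, thick b m Y d (x t) (y t)) ->
  (forall t, t <> s0 -> sin (x t) * cos (x t) <> 0) ->
  (exists xe ye, equilibrium kap b m xe ye /\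
    energy b m xe ye = energy b m (x 0) (y 0)) /\
  forall z c, motion 4 (vort m S) z -> follows b m x y c z ->
    relative_heteroclinic_orbit 4 (vort m S) z.
Proof.
  intros kap Hk Hm Hd Hsol Hth Hn.
  destruct (limit_equilibrium kap b m Y d s0 x y Hk Hm Hd Hsol Hth)
    as (xp & yp & Ep & Enp & Xp & Yp).
  { intros t Ht. apply Hn. lra. }
  destruct (limit_equilibrium (- kap) b m Y d (- s0) _ _ ltac:(lra) Hm Hd
    (solution_reverse_time _ _ _ _ _ Hsol) (fun t => Hth (- t)))
    as (xm & ym & Em & Enm & Xm & Ym).
  { intros t Ht. apply Hn. lra. }
  apply equilibrium_opp in Em.
  split; [exists xp, yp; split; assumption|].
  intros z c Hz Hf. split; [assumption|].
  destruct (lift_exists b m S _ _ (equilibrium_solution _ _ _ _ _ Em))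
    as (cm & zm & cm0 & Mm & Fm).
  destruct (lift_exists b m S _ _ (equilibrium_solution _ _ _ _ _ Ep))
    as (cp & zp & cp0 & Mp & Fp).
  exists zm, zp. split; [|split; [|split]].
  - now apply (relative_equilibrium_of_constant b m S xm ym cm).
  - now apply (relative_equilibrium_of_constant b m S xp yp cp).
  - apply (orbit_converges_of_limits b m xm ym _ x y c); [assumption| | |].
    + now apply filterlim_reverse_time.
    + now apply filterlim_reverse_time.
    + intros k Hk4. rewrite Fm, cm0 by assumption. ring.
  - apply (orbit_converges_of_limits b m xp yp _ x y c); [assumption| | |]; try assumption.
    intros k Hk4. rewrite Fp, cp0 by assumption. ring.
Qed.

(** Constant height means that the vertical velocity vanishes, so that the solution
    stays on an axis; the axes are discrete, so [x] is constant too. *)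
Lemma equilibrium_of_constant_height (kap b m : R) (x y : R -> R) :
  kap <> 0 -> solution kap b m x y -> (forall t, y t = y 0) ->
  equilibrium kap b m (x 0) (y 0).
Proof.
  intros Hk Hsol Hy.
  assert (Hy0 : forall t, field_y kap b m (x t) (y t) = 0).
  { intros t. destruct (Hsol t) as (_ & _ & D).
    rewrite <- (is_derive_unique _ _ _ D).
    apply is_derive_unique. apply (is_derive_ext (fun _ => y 0)).
    - intros s. symmetry. apply Hy.
    - apply (is_derive_const (V := R_NormedModule)). }
  assert (Hsc : forall t, sin (x t) * cos (x t) = 0).
  { intros t. apply (field_y_eq_0 kap b m (x t) (y t)); [assumption|apply Hsol|apply Hy0]. }
  destruct (Hsol 0) as (Hr & Dx & _). split; [assumption|]. split; [|apply Hy0].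
  assert (D : is_derive (fun t => sin (x t) * cos (x t)) 0
    (field_x kap b m (x 0) (y 0) * (cos (x 0) ^ 2 - sin (x 0) ^ 2))).
  { auto_derive; [repeat split; eexists; eassumption|].
    known_derivatives. ring. }
  apply is_derive_unique in D.
  rewrite (Derive_ext _ (fun _ => 0)), Derive_const in D by apply Hsc.
  symmetry in D. apply Rmult_integral in D. destruct D as [D|D]; [assumption|exfalso].
  assert (E := Hsc 0). assert (X := cos_sq (x 0)).
  apply Rmult_integral in E. destruct E as [E|E]; rewrite E in *; lra.
Qed.

(** The difference of the heights of the vortices 0 and 1 is [2 * y], and is invariant
    under translations. *)
Lemma constant_height_of_relative_equilibrium (b m S : R) (x y c : R -> R)
    (z : R -> nat -> C) :
  follows b m x y c z -> relative_equilibrium 4 (vort m S) z -> forall t, y t = y 0.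
Proof.
  intros Hf [_ Ho] t. destruct (Ho t) as [a Ha].
  destruct (Ha 0%nat ltac:(lia)) as [n0 E0]. destruct (Ha 1%nat ltac:(lia)) as [n1 E1].
  rewrite !Hf in E0, E1 by lia.
  apply (f_equal Im) in E0, E1. simpl in E0, E1. lra.
Qed.

(** In every translate of the configuration, [2 * y] is a difference of heights, and
    so it converges if the translates do. *)
Lemma height_limit_of_heteroclinic (b m S : R) (x y c : R -> R) (z : R -> nat -> C) :
  follows b m x y c z -> relative_heteroclinic_orbit 4 (vort m S) z ->
  exists yl, filterlim y (Rbar_locally p_infty) (locally yl).
Proof.
  intros Hf (_ & em & ep & _ & _ & _ & (w & Hw & Hlim)).
  exists (/ 2 * Im (ep 0 0%nat) + - / 2 * Im (ep 0 1%nat)).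
  assert (HIm : forall k, (k < 4)%nat ->
    filterlim (fun t => Im (w t k)) (Rbar_locally p_infty) (locally (Im (ep 0 k)))).
  { intros k Hk. apply (filterlim_comp _ _ _ (fun t => w t k) Im _ _ _ (Hlim k Hk)).
    apply (continuous_snd (U := R_UniformSpace) (V := R_UniformSpace)). }
  apply (filterlim_ext (fun t => / 2 * Im (w t 0%nat) + - / 2 * Im (w t 1%nat))).
  - intros t. destruct (Hw t) as [a Ha].
    destruct (Ha 0%nat ltac:(lia)) as [n0 E0]. destruct (Ha 1%nat ltac:(lia)) as [n1 E1].
    rewrite !Hf in E0, E1 by lia.
    apply (f_equal Im) in E0, E1. simpl in E0, E1.
    apply Rminus_diag_uniq. unfold Im. lra.
  - apply (pinfty_plus (fun t => / 2 * Im (w t 0%nat)) (fun t => - / 2 * Im (w t 1%nat))).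
    + apply (pinfty_mult (fun _ => / 2)); [apply filterlim_const|apply HIm; lia].
    + apply (pinfty_mult (fun _ => - / 2)); [apply filterlim_const|apply HIm; lia].
Qed.

Lemma constant_of_periodic_limit (y : R -> R) (T yl : R) :
  0 < T -> (forall t, y (t + T) = y t) ->
  filterlim y (Rbar_locally p_infty) (locally yl) -> forall t, y t = yl.
Proof.
  intros HT Hper Hlim t.
  assert (Hn : forall n, y (t + INR n * T) = y t).
  { induction n as [|n IH]; [simpl; f_equal; ring|].
    rewrite S_INR, <- IH. rewrite <- (Hper (t + INR n * T)). f_equal. ring. }
  apply NNPP. intros H.
  destruct (proj1 (filterlim_p_infty_eps y yl) Hlim (Rabs (y t - yl))) as [M HM].
  { apply Rabs_pos_lt. lra. }
  destruct (INR_unbounded ((M - t) / T)) as [n Hn'].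
  assert (H1 : M < t + INR n * T).
  { apply (Rmult_lt_compat_r T) in Hn'; [|assumption].
    replace ((M - t) / T * T) with (M - t) in Hn' by (field; lra). lra. }
  specialize (HM _ H1). rewrite Hn in HM. lra.
Qed.

Lemma at_most_one_time (A : R -> Prop) :
  (exists t0 t1, t0 < t1 /\ A t0 /\ A t1) \/ (exists s0, forall t, t <> s0 -> ~ A t).
Proof.
  destruct (classic (exists s0, A s0)) as [[s0 H0]|H].
  - destruct (classic (exists t, t <> s0 /\ A t)) as [[t [Ht HA]]|H].
    + left. destruct (Rtotal_order t s0) as [?|[?|?]]; [|contradiction|].
      * exists t, s0. auto.
      * exists s0, t. auto.
    + right. exists s0. intros t Ht HA. apply H. exists t. auto.
  - right. exists 0. intros t _ HA. apply H. exists t. assumption.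
Qed.

(** * Genericity *)

Lemma continuous_gaps_plane (b m : R) (zeta : C) :
  continuous (fun w : C => gap1 (Re w) (Im w)) zeta /\
  continuous (fun w : C => gap2 b m (Re w) (Im w)) zeta /\
  continuous (fun w : C => gap3 b m (Im w)) zeta /\
  continuous (fun w : C => gap4 b m (Im w)) zeta.
Proof.
  assert (Hre : forall g : R -> R, (forall v, ex_derive g v) ->
    continuous (fun w : C => g (Re w)) zeta).
  { intros g Hg. apply (continuous_comp (Re : C -> R) g).
    - apply (continuous_fst (U := R_UniformSpace) (V := R_UniformSpace)).
    - apply (ex_derive_continuous (V := R_NormedModule) g), Hg. }
  assert (Him : forall g : R -> R, (forall v, ex_derive g v) ->
    continuous (fun w : C => g (Im w)) zeta).
  { intros g Hg. apply (continuous_comp (Im : C -> R) g).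
    - apply (continuous_snd (U := R_UniformSpace) (V := R_UniformSpace)).
    - apply (ex_derive_continuous (V := R_NormedModule) g), Hg. }
  unfold gap1, gap2, gap3, gap4, sin_norm2. split; [|split; [|split]].
  - apply (continuous_plus (V := R_NormedModule)).
    + apply (Hre (fun v => sin v ^ 2)). intros v. auto_derive. trivial.
    + apply (Him (fun v => sinh v ^ 2)). intros v. auto_derive. trivial.
  - apply (continuous_plus (V := R_NormedModule)).
    + apply (Hre (fun v => sin v ^ 2)). intros v. auto_derive. trivial.
    + apply (Him (fun v => sinh (b + m * v) ^ 2)). intros v. auto_derive. trivial.
  - apply (Him (fun v => sinh (b + m * v + v) ^ 2)). intros v. auto_derive. trivial.
  - apply (Him (fun v => sinh (b + m * v - v) ^ 2)). intros v. auto_derive. trivial.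
Qed.

Lemma locally_lt_plane (g : C -> R) (zeta : C) (c : R) :
  continuous g zeta -> c < g zeta -> locally zeta (fun w => c < g w).
Proof.
  intros Hg Hc. apply (Hg (fun v => c < v)). apply locally_R_ball.
  exists (g zeta - c). split; [lra|]. intros s Hs. apply Rabs_lt_between in Hs. lra.
Qed.

Lemma open_regular (b m : R) : open (fun zeta : C => regular b m (Re zeta) (Im zeta)).
Proof.
  intros zeta (H1 & H2 & H3 & H4).
  destruct (continuous_gaps_plane b m zeta) as (C1 & C2 & C3 & C4).
  generalize (filter_and _ _
    (filter_and _ _ (locally_lt_plane _ _ _ C1 H1) (locally_lt_plane _ _ _ C2 H2))
    (filter_and _ _ (locally_lt_plane _ _ _ C3 H3) (locally_lt_plane _ _ _ C4 H4))).
  apply filter_imp. intros w [[A B] [E F]]. repeat split; assumption.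
Qed.

Lemma continuous_energy (b m : R) (zeta : C) : regular b m (Re zeta) (Im zeta) ->
  continuous (fun w : C => energy b m (Re w) (Im w)) zeta.
Proof.
  intros (H1 & H2 & H3 & H4).
  destruct (continuous_gaps_plane b m zeta) as (C1 & C2 & C3 & C4).
  assert (Hln : forall g : C -> R, continuous g zeta -> 0 < g zeta ->
    forall c, continuous (fun w => c * ln (g w)) zeta).
  { intros g Hg Hpos c. apply (continuous_comp g (fun v => c * ln v)); [assumption|].
    apply (ex_derive_continuous (V := R_NormedModule) (fun v => c * ln v)).
    auto_derive. assumption. }
  apply (continuous_ext (fun w : C =>
    (2 * (1 - m ^ 2) * ln (gap1 (Re w) (Im w))
      + - (2 * (1 - m ^ 2)) * ln (gap2 b m (Re w) (Im w)))
    + (- (1 - m) ^ 2 * ln (gap3 b m (Im w)) + - (1 + m) ^ 2 * ln (gap4 b m (Im w))))).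
  { intros w. unfold energy. match goal with |- ?a = ?c => change (@eq R a c) end. ring. }
  apply (continuous_plus (V := R_NormedModule));
  apply (continuous_plus (V := R_NormedModule)); now apply Hln.
Qed.

(** At a fixed height, the energy is a function of the quotient of the first two gaps,
    whose difference is a nonzero constant there. *)
Lemma sin_sq_of_energy (b m x x' y : R) : Rabs m < 1 ->
  regular b m x y -> regular b m x' y -> energy b m x y = energy b m x' y ->
  sin x ^ 2 = sin x' ^ 2.
Proof.
  intros Hm Hr (P1 & P2 & _) HE. assert (Hg := regular_gap_difference b m x y Hr).
  destruct Hr as (H1 & H2 & _). assert (Hm' := proj1 (Rabs_lt_between _ _) Hm).
  unfold energy in HE.
  assert (Hd : ln (gap1 x y) - ln (gap2 b m x y) = ln (gap1 x' y) - ln (gap2 b m x' y))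
    by (apply (Rmult_eq_reg_l (2 * (1 - m ^ 2))); [lra|nra]).
  assert (Hl : ln (gap1 x y) + ln (gap2 b m x' y) = ln (gap1 x' y) + ln (gap2 b m x y)) by lra.
  rewrite <- !ln_mult in Hl by assumption.
  apply ln_inv in Hl; [|now apply Rmult_lt_0_compat|now apply Rmult_lt_0_compat].
  unfold gap_difference in Hg. unfold gap1, gap2, sin_norm2 in Hl.
  apply Rminus_diag_uniq. apply (Rmult_eq_reg_r (sinh (b + m * y) ^ 2 - sinh y ^ 2)); lra.
Qed.

Lemma sin_nonzero_right (v : R) :
  exists e, 0 < e <= PI /\ forall r, 0 < r < e -> sin (v + r) <> 0.
Proof.
  assert (HP := PI_RGT_0). destruct (Req_dec (sin v) 0) as [H0|H0].
  - exists PI. split; [lra|]. intros r Hr. rewrite sin_plus, H0, Rmult_0_l, Rplus_0_l.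
    assert (X := cos_sq v). rewrite H0 in X.
    assert (0 < sin r) by (apply sin_gt_0; lra).
    apply Rmult_integral_contrapositive_currified; [|lra]. intros E. rewrite E in X. lra.
  - destruct (proj1 (continuous_R_eps sin v) (continuous_of_derive _ _ _ (is_derive_sin v))
      (Rabs (sin v))) as [d [Hd H]]; [now apply Rabs_pos_lt|].
    exists (Rmin d PI). split; [split; [now apply Rmin_glb_lt|apply Rmin_r]|].
    intros r Hr E. assert (X := Rmin_l d PI).
    assert (Hv := H (v + r)). rewrite E in Hv.
    replace (v + r - v) with r in Hv by ring. rewrite (Rabs_right r) in Hv by lra.
    specialize (Hv ltac:(lra)). replace (0 - sin v) with (- sin v) in Hv by ring.
    rewrite Rabs_Ropp in Hv. lra.
Qed.

Lemma sin_sq_injective_right (x : R) : exists e, 0 < e /\ forall s s',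
  0 < s < e -> 0 < s' < e -> sin (x + s) ^ 2 = sin (x + s') ^ 2 -> s = s'.
Proof.
  destruct (sin_nonzero_right (2 * x)) as [e [He Hn]].
  exists (e / 2). split; [lra|]. intros s s' Hs Hs' E.
  assert (Hfac : sin ((x + s) + (x + s')) * sin ((x + s) - (x + s')) = 0).
  { rewrite sin_plus, (sin_minus (x + s)). assert (A := cos_sq (x + s)).
    assert (B := cos_sq (x + s')).
    transitivity (sin (x + s) ^ 2 * cos (x + s') ^ 2 - cos (x + s) ^ 2 * sin (x + s') ^ 2);
      [ring|]. rewrite A, B, E. ring. }
  apply Rmult_integral in Hfac. destruct Hfac as [H|H].
  - exfalso. apply (Hn (s + s')); [lra|]. rewrite <- H. f_equal. ring.
  - replace (x + s - (x + s')) with (s - s') in H by ring.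
    destruct (Rtotal_order s s') as [Hlt|[?|Hlt]]; [|assumption|]; exfalso.
    + assert (X := sin_gt_0 (s' - s) ltac:(lra) ltac:(lra)).
      replace (s' - s) with (- (s - s')) in X by ring. rewrite sin_neg in X. lra.
    + assert (X := sin_gt_0 (s - s') ltac:(lra) ltac:(lra)). lra.
Qed.

(** The point [w] is found by moving [zeta] horizontally to the right. *)
Lemma regular_level_dense (b m : R) (A : R -> Prop) (D : C -> Prop) (zeta : C) :
  Rabs m < 1 -> finite_set A -> (forall w, D w -> regular b m (Re w) (Im w)) ->
  locally zeta D -> exists w, D w /\ ~ A (energy b m (Re w) (Im w)).
Proof.
  intros Hm HA HD [[e He] Hball].
  destruct (sin_sq_injective_right (Re zeta)) as [e' [He' Hinj]].
  set (r := Rmin e e'). assert (Hr : 0 < r) by now apply Rmin_glb_lt.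
  assert (R1 : r <= e) by apply Rmin_l. assert (R2 : r <= e') by apply Rmin_r.
  assert (HDs : forall s, 0 < s < r -> D (Re zeta + s, Im zeta)).
  { intros s Hs. apply Hball. split.
    - change (Rabs (Re zeta + s - Re zeta) < e).
      replace (Re zeta + s - Re zeta) with s by ring. rewrite Rabs_right; lra.
    - change (Rabs (Im zeta - Im zeta) < e). rewrite Rminus_diag, Rabs_R0. exact He. }
  destruct (injective_avoids_finite_set
    (fun s => energy b m (Re zeta + s) (Im zeta)) A r Hr HA) as [s [Hs Hns]].
  - intros s s' Hs Hs' E. apply Hinj; [lra|lra|].
    apply (sin_sq_of_energy b m _ _ (Im zeta) Hm);
      [exact (HD _ (HDs s Hs))|exact (HD _ (HDs s' Hs'))|exact E].
  - exists (Re zeta + s, Im zeta). split; [now apply HDs|exact Hns].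
Qed.

(** Equilibria have finitely many heights, and lie on axes [PI / 2] apart. *)
Lemma equilibrium_isolated (kap b m : R) (zeta : C) : kap <> 0 -> b <> 0 ->
  equilibrium kap b m (Re zeta) (Im zeta) ->
  locally zeta (fun w : C => equilibrium kap b m (Re w) (Im w) -> w = zeta).
Proof.
  intros Hk Hb He. assert (HP := PI_RGT_0).
  destruct (finite_set_isolated _ (finite_equilibrium_heights kap b m Hk Hb) (Im zeta))
    as [d [Hd Hiso]].
  assert (Hax : forall x y, equilibrium kap b m x y -> exists n : Z, x = IZR n * PI / 2).
  { intros x y (Hr & _ & Hy). apply sin_cos_eq_0.
    now apply (field_y_eq_0 kap b m x y). }
  assert (Hr : 0 < Rmin d (PI / 2)) by (apply Rmin_glb_lt; lra).
  exists (mkposreal _ Hr). intros w [Hw1 Hw2] Hew.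
  change (Rabs (Re w - Re zeta) < Rmin d (PI / 2)) in Hw1.
  change (Rabs (Im w - Im zeta) < Rmin d (PI / 2)) in Hw2.
  assert (R1 := Rmin_l d (PI / 2)). assert (R2 := Rmin_r d (PI / 2)).
  apply C_eq.
  - destruct (Hax _ _ He) as [n Hn], (Hax _ _ Hew) as [n' Hn'].
    rewrite Hn, Hn' in *. apply Rabs_lt_between in Hw1.
    assert (Hd1 : - 1 < IZR n' - IZR n < 1) by nra.
    rewrite <- minus_IZR in Hd1.
    assert (n' - n = 0)%Z by (destruct Hd1 as [A B]; apply lt_IZR in A, B; lia).
    now replace n' with n by lia.
  - apply Hiso; [exists (Re w); assumption|lra].
Qed.

(** * Classification of the motions *)

(** Here [D] stands for the two sets of initial values in the theorem; what matters
    is that the solutions through its points are confined. *)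
Lemma classification (b m S : R) (D : C -> Prop) :
  b <> 0 -> S <> 0 -> Rabs m < 1 -> open D ->
  (forall zeta, D zeta -> regular b m (Re zeta) (Im zeta) /\
                          confined b m (Re zeta) (Im zeta)) ->
  (exists y, equilibrium (S / (16 * PI)) b m (PI / 2) y /\ D (PI / 2, y)) ->
  periodic_except_isolated b (S * (1 - m) / 2) (S * (1 + m) / 2) D.
Proof.
  intros Hb HS Hm HDo HD Heq. assert (HP := PI_RGT_0).
  set (kap := S / (16 * PI)) in *.
  assert (Hk : kap <> 0).
  { unfold kap. apply Rmult_integral_contrapositive_currified; [assumption|].
    apply Rinv_neq_0_compat. lra. }
  set (G := S * (1 - m) / 2). set (G' := S * (1 + m) / 2).
  set (critical := fun h => exists x y, equilibrium kap b m x y /\ h = energy b m x y).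
  assert (Hcrit : finite_set critical) by now apply finite_critical_values.
  (* through every point of [D] there is a solution that is periodic, or else
     joins two equilibria of the same energy *)
  assert (Hflow : forall zeta, D zeta -> exists x y : R -> R,
    x 0 = Re zeta /\ y 0 = Im zeta /\ solution kap b m x y /\
    ((exists T n, 0 < T /\ forall t, x (t + T) = x t + IZR n * PI /\ y (t + T) = y t) \/
     (critical (energy b m (Re zeta) (Im zeta)) /\
      forms_separatrix b G G' zeta))).
  { intros zeta Hz. destruct (HD zeta Hz) as [Hr Hc].
    destruct (global_solution kap b m _ _ Hb Hm Hr Hc)
      as (x & y & Y & d & Hx & Hy & Hsol & Hd & Hth).
    exists x, y. split; [assumption|]. split; [assumption|]. split; [assumption|].
    destruct (at_most_one_time (fun t => sin (x t) * cos (x t) = 0))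
      as [(t0 & t1 & Ht & H0 & H1)|[s0 Hs]].
    - left. now apply (periodic_of_two_symmetric_times S b m t0 t1).
    - right. destruct (separatrix_limits S b m Y d s0 x y Hk Hm Hd Hsol Hth Hs)
        as [(xe & ye & He & Hen) Hhet].
      split.
      + exists xe, ye. rewrite Hen, Hx, Hy. split; [assumption|reflexivity].
      + apply (vortices_form_intro b m S _ x y zeta HS Hsol Hx Hy). exact Hhet. }
  assert (Hper : forall zeta x y, x 0 = Re zeta -> y 0 = Im zeta -> solution kap b m x y ->
    (exists T n, 0 < T /\ forall t, x (t + T) = x t + IZR n * PI /\ y (t + T) = y t) ->
    forms_rel_periodic b G G' zeta).
  { intros zeta x y Hx Hy Hsol (T & n & HT & Hp).
    apply (vortices_form_intro b m S _ x y zeta HS Hsol Hx Hy).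
    intros z c Hz Hf. now apply (relative_periodic_of_periodic b m S T n x y c). }
  assert (Heqform : forall zeta, equilibrium kap b m (Re zeta) (Im zeta) ->
    forms_rel_equilibrium b G G' zeta).
  { intros zeta He. apply (vortices_form_intro b m S _ _ _ zeta HS
      (equilibrium_solution _ _ _ _ _ He) eq_refl eq_refl).
    intros z c Hz Hf. now apply (relative_equilibrium_of_constant b m S (Re zeta) (Im zeta) c). }
  assert (Heqelim : forall zeta, D zeta -> forms_rel_equilibrium b G G' zeta ->
    equilibrium kap b m (Re zeta) (Im zeta)).
  { intros zeta Hz Hform. destruct (Hflow zeta Hz) as (x & y & Hx & Hy & Hsol & _).
    destruct (vortices_form_elim b m S _ x y zeta HS Hsol Hx Hy Hform) as (z & c & Mz & Fz & Pz).
    rewrite <- Hx, <- Hy. apply equilibrium_of_constant_height; try assumption.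
    now apply (constant_height_of_relative_equilibrium b m S x y c z). }
  assert (Hexc : forall zeta, D zeta ->
    forms_rel_equilibrium b G G' zeta \/ forms_separatrix b G G' zeta ->
    critical (energy b m (Re zeta) (Im zeta))).
  { intros zeta Hz [He|Hs].
    - exists (Re zeta), (Im zeta). split; [now apply Heqelim|reflexivity].
    - destruct (Hflow zeta Hz) as (x & y & Hx & Hy & Hsol & [(T & n & HT & Hp)|[Hc _]]);
        [|assumption].
      (* a heteroclinic motion that is periodic is at rest *)
      destruct (vortices_form_elim b m S _ x y zeta HS Hsol Hx Hy Hs) as (z & c & Mz & Fz & Pz).
      destruct (height_limit_of_heteroclinic b m S x y c z Fz Pz) as [yl Hyl].
      assert (Hconst := constant_of_periodic_limit y T yl HT (fun t => proj2 (Hp t)) Hyl).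
      exists (x 0), (y 0). split; [|now rewrite Hx, Hy].
      apply equilibrium_of_constant_height; try assumption.
      intros t. now rewrite !Hconst. }
  split; [|split; [|split; [|split]]].
  - exists (fun zeta => D zeta /\ ~ critical (energy b m (Re zeta) (Im zeta))).
    split; [|split].
    + intros zeta [Hz Hn]. destruct (HD zeta Hz) as [Hr _].
      destruct (finite_set_isolated _ Hcrit (energy b m (Re zeta) (Im zeta))) as [d [Hd Hiso]].
      assert (Hce := continuous_energy b m zeta Hr).
      generalize (filter_and _ _ (HDo zeta Hz)
        (Hce (fun v => Rabs (v - energy b m (Re zeta) (Im zeta)) < d)
          (proj2 (locally_R_ball _ _) (ex_intro _ d (conj Hd (fun s Hs => Hs)))))).
      apply filter_imp. intros w [Dw Hw]. split; [assumption|]. intros Hcw.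
      apply Hn. rewrite <- (Hiso _ Hcw Hw). exact Hcw.
    + intros zeta [Hz Hn]. split; [assumption|].
      destruct (Hflow zeta Hz) as (x & y & Hx & Hy & Hsol & [Hp|[Hc _]]); [|contradiction].
      now apply (Hper zeta x y).
    + intros zeta Hz V HV.
      destruct (regular_level_dense b m critical (fun w => D w /\ V w) zeta Hm Hcrit)
        as (w & [Dw Vw] & Hw).
      * intros w [Dw _]. now apply HD.
      * apply filter_and; [now apply HDo|assumption].
      * exists w. auto.
  - intros zeta Hz.
    destruct (Hflow zeta Hz) as (x & y & Hx & Hy & Hsol & [Hp|[Hc Hs]]).
    + left. now apply (Hper zeta x y).
    + right. auto.
  - destruct Heq as (y & He & Dy). exists (PI / 2, y). split; [assumption|]. left.
    now apply Heqform.
  - intros zeta [Hz He]. apply (Heqelim zeta Hz) in He.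
    apply (filter_imp _ _) with (2 := equilibrium_isolated kap b m zeta Hk Hb He).
    intros w Hw [Dw Hew]. apply Hw. now apply Heqelim.
  - assert (Hfin : finite_set (fun h => exists h', critical h' /\
      h = - (S ^ 2 / (16 * PI)) * h'))
      by (apply (finite_set_image (fun h' => - (S ^ 2 / (16 * PI)) * h')), Hcrit).
    assert (Hham : forall h, (exists zeta, (D zeta /\ (forms_rel_equilibrium b G G' zeta \/
      forms_separatrix b G G' zeta)) /\ h = ham4 b G G' zeta) ->
      exists h', critical h' /\ h = - (S ^ 2 / (16 * PI)) * h').
    { intros h (zeta & [Hz He] & ->). exists (energy b m (Re zeta) (Im zeta)).
      split; [now apply Hexc|]. apply ham4_energy; [assumption|now apply HD]. }
    intros h Hh. destruct (finite_set_isolated _ Hfin h) as [d [Hd Hiso]].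
    apply locally_R_ball. exists d. split; [assumption|]. intros h' Hd' Hh'.
    apply Hiso; [now apply Hham|assumption].
Qed.

Theorem theorem4 :
  forall b G G' : R,
    b <> 0 -> G <> 0 -> G' <> 0 -> 0 < G * G' ->
    (G / G' <> 1 ->
       periodic_except_isolated b G G' (admissible b G G')) /\
    (G / G' = 1 ->
       periodic_except_isolated b G G'
         (fun zeta : C =>
            admissible b G G' zeta /\
            (Rabs (Im zeta) < Rabs b \/
             PI * ham4 b G G' zeta / G ^ 2 < ln (sinh (Rabs b))))).
Proof.
  intros b G G' Hb HG HG' HGG. assert (HP := PI_RGT_0).
  assert (HS : G + G' <> 0) by (intros E; replace G' with (- G) in HGG by lra; nra).
  set (S := G + G') in *. set (m := (G' - G) / S).
  assert (EG : G = S * (1 - m) / 2) by (unfold m, S in *; field; assumption).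
  assert (EG' : G' = S * (1 + m) / 2) by (unfold m, S in *; field; assumption).
  assert (Hm : Rabs m < 1).
  { assert (H : 0 < S ^ 2 * (1 - m ^ 2) / 4).
    { replace (S ^ 2 * (1 - m ^ 2) / 4) with (G * G') by (rewrite EG, EG'; field). exact HGG. }
    apply Rabs_def1; nra. }
  clearbody m S. subst G G'.
  destruct (equilibrium_exists (S / (16 * PI)) b m Hb Hm) as (ye & He & Hye0).
  assert (Hopen : open (admissible b (S * (1 - m) / 2) (S * (1 + m) / 2))).
  { intros zeta Hz. apply admissible_regular in Hz; [|assumption].
    apply (filter_imp _ _) with (2 := open_regular b m zeta Hz).
    intros w Hw. now apply admissible_regular. }
  split.
  - intros Hne. assert (Hm0 : m <> 0).
    { intros ->. apply Hne. field. lra. }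
    apply classification; try assumption.
    + intros zeta Hz. apply admissible_regular in Hz; [|assumption].
      split; [assumption|]. now apply confined_asymmetric.
    + exists ye. split; [assumption|]. apply admissible_regular; [assumption|]. apply He.
  - intros H1. assert (Hm0 : m = 0).
    { apply (f_equal (fun v => v * (S * (1 + m) / 2))) in H1.
      unfold Rdiv at 1 in H1. rewrite Rmult_assoc, Rinv_l, Rmult_1_r, Rmult_1_l in H1
        by assumption. nra. }
    subst m. specialize (Hye0 eq_refl). subst ye.
    assert (Hbp : 0 < Rabs b) by now apply Rabs_pos_lt.
    assert (Hsb := sinh_pos _ Hbp).
    (* the condition on the Hamiltonian, in terms of the energy *)
    assert (Hcond : forall zeta : C, regular b 0 (Re zeta) (Im zeta) ->
      (PI * ham4 b (S * (1 - 0) / 2) (S * (1 + 0) / 2) zeta / (S * (1 - 0) / 2) ^ 2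
         < ln (sinh (Rabs b)) <->
       - 2 * ln (sinh b ^ 2) < energy b 0 (Re zeta) (Im zeta))).
    { intros zeta Hr. rewrite ham4_energy by assumption.
      replace (PI * (- (S ^ 2 / (16 * PI)) * energy b 0 (Re zeta) (Im zeta))
        / (S * (1 - 0) / 2) ^ 2) with (- energy b 0 (Re zeta) (Im zeta) / 4)
        by (field; split; lra).
      rewrite <- (sinh_sq_even b).
      replace (sinh (Rabs b) ^ 2) with (sinh (Rabs b) * sinh (Rabs b)) by ring.
      rewrite ln_mult by assumption. lra. }
    apply classification; try assumption.
    + intros zeta [Hz Hc]. assert (Hr := Hz). apply admissible_regular in Hr; [|assumption].
      destruct Hc as [Hc|Hc].
      * assert (Cim : continuous (fun w : C => - Rabs (Im w)) zeta).
        { apply (continuous_opp (V := R_NormedModule) (fun w : C => Rabs (Im w))).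
          apply (continuous_comp (Im : C -> R) Rabs); [|apply continuous_Rabs].
          apply (continuous_snd (U := R_UniformSpace) (V := R_UniformSpace)). }
        generalize (filter_and _ _ (Hopen zeta Hz)
          (locally_lt_plane _ _ (- Rabs b) Cim ltac:(cbv beta; lra))).
        apply filter_imp. intros w [A B]. split; [assumption|left; lra].
      * apply Hcond in Hc; [|assumption].
        generalize (filter_and _ _ (Hopen zeta Hz)
          (locally_lt_plane _ _ _ (continuous_energy b 0 zeta Hr) Hc)).
        apply filter_imp. intros w [A B]. split; [assumption|right].
        apply Hcond; [now apply (admissible_regular b 0 S w HS)|assumption].
    + intros zeta [Hz Hc]. apply admissible_regular in Hz; [|assumption].
      split; [assumption|]. apply confined_symmetric; [assumption|].
      destruct Hc as [Hc|Hc]; [left|right; now apply Hcond].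
      unfold gap_difference. rewrite Rmult_0_l, Rplus_0_r.
      assert (X : sinh (Rabs (Im zeta)) < sinh (Rabs b)) by now apply sinh_lt.
      rewrite <- (sinh_sq_even (Im zeta)), <- (sinh_sq_even b).
      assert (Rabs (Im zeta) <= sinh (Rabs (Im zeta))) by (apply sinh_ge, Rabs_pos).
      assert (X0 := Rabs_pos (Im zeta)). nra.
    + exists 0. split; [assumption|]. split.
      * apply admissible_regular; [assumption|]. apply He.
      * left. simpl. rewrite Rabs_R0. exact Hbp.
Qed.
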